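(* Let $Y_V$ be a causal MCAR$(p)$ process, and let $a,b\in V$ with $a\ne b$. Then: (a) $Y_a\not\sim Y_b\mid Y_V$ if and only if $$\left[\int_0^{\min(h,\tilde h)}\mathbf{C}e^{\mathbf{A}(h-u)}\mathbf{B}\Sigma_L\mathbf{B}^\top e^{\mathbf{A}^\top(\tilde h-u)}\mathbf{C}^\top\,du\right]_{ab}=0\quad\text{for all }h,\tilde h\in[0,1].$$ (b) $Y_a\not\sim_0Y_b\mid Y_V$ if and only if $[\Sigma_L]_{ab}=0$.
   Context: $V=\{1,\ldots,k\}$. $L^2$ is the Hilbert space of square-integrable complex random variables with $\langle X,Y\rangle=\mathbb{E}[X\overline{Y}]$; $P_{\mathcal L}$ is orthogonal projection onto a closed subspace. $\mathcal{L}_{Y_A}(s,t)$ is the closed linear span of $\{Y_a(u):a\in A,u\in[s,t]\cap\mathbb{R}\}$ and $\mathcal{L}_{Y_A}(t)=\mathcal{L}_{Y_A}(-\infty,t)$. $\mathcal{L}_1\perp\mathcal{L}_2\mid\mathcal{L}_3$ means $\mathbb{E}[(X-P_{\mathcal{L}_3}X)\overline{(Y-P_{\mathcal{L}_3}Y)}]=0$ for all $X\in\mathcal{L}_1,Y\in\mathcal{L}_2$. $D^{(j)}$ is the $j$-th mean-square derivative, $D^{(0)}Y_v=Y_v$; an MCAR$(p)$ process is $p-1$ times mean-square differentiable, and in the local relation the derivative order is $j_v=p-1$ for every $v\in V$. $Y_a\not\sim Y_b\mid Y_V$ (contemporaneously uncorrelated): $\mathcal{L}_{Y_a}(t,t+1)\perp\mathcal{L}_{Y_b}(t,t+1)\mid\mathcal{L}_{Y_V}(t)$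 for all $t\in\mathbb{R}$. $Y_a\not\sim_0Y_b\mid Y_V$ (locally contemporaneously uncorrelated): for all $t\in\mathbb{R}$, $\lim_{h\downarrow0}\frac1h\mathbb{E}[(D^{(p-1)}Y_a(t+h)-P_{\mathcal{L}_{Y_V}(t)}D^{(p-1)}Y_a(t+h))\overline{(D^{(p-1)}Y_b(t+h)-P_{\mathcal{L}_{Y_V}(t)}D^{(p-1)}Y_b(t+h))}]=0$. Lévy process: $L$ is a two-sided $k$-dimensional Lévy process, i.e. $L(t)=L_1(t)$ for $t\ge0$ and $L(t)=-\lim_{s\nearrow-t}L_2(s)$ for $t<0$ with independent copies $L_1,L_2$ of a one-sided Lévy process, with $\mathbb{E}L(1)=0$, $\mathbb{E}\|L(1)\|^2<\infty$, $\Sigma_L=\mathbb{E}[L(1)L(1)^\top]$. Causal MCAR$(p)$ process, $p\ge1$: let $A_1,\ldots,A_p\in\mathbb{R}^{k\times k}$ and let $\mathbf{A}\in\mathbb{R}^{kp\times kp}$ be the block companion matrix whose $i$-th block row, $i=1,\ldots,p-1$, has $I_k$ in block column $i+1$ and zeros otherwise, and whose last block row is $(-A_p,\ldots,-A_1)$; all eigenvalues of $\mathbf{A}$ have strictly negative real part. Let $\mathbf{B}^\top=(0_k,\ldots,0_k,I_k)$, $\mathbf{C}=(I_k,0_k,\ldots,0_k)\in\mathbb{R}^{k\times kp}$. Then $Y_V(t)=\mathbf{C}X(t)$ with $X(t)=\int_{-\infty}^te^{\mathbf{A}(t-u)}\mathbf{B}\,dL(u)$, the unique stationary solution of $dX(t)=\mathbf{A}X(t)dt+\mathbf{B}dL(t)$.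 *)

(* Defs.v *)
From HB Require Import structures.
From mathcomp Require Import all_boot all_order all_algebra complex.
From mathcomp Require Import all_classical all_reals all_analysis.

Set Implicit Arguments.
Unset Strict Implicit.
Unset Printing Implicit Defensive.
Import Order.TTheory GRing.Theory Num.Theory numFieldNormedType.Exports.
Local Open Scope classical_set_scope.
Local Open Scope complex_scope.
Local Open Scope ring_scope.

Section matrices.
Variable R : realType.

Definition expmx n (M : 'M[R]_n) : 'M[R]_n :=
  limn (series (fun m : nat => (m`!%:R)^-1 *: (M ^+ m) : 'M[R]_n)).

Definition mx_integral m n (D : set R) (F : R -> 'M[R]_(m, n)) : 'M[R]_(m, n) :=
  \matrix_(i, j) (\int[lebesgue_measure]_(u in D) F u i j)%R.

(* squared Euclidean (Frobenius) norm; the library norm on matrices is the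
   sup norm *)
Definition sqnorm m n (M : 'M[R]_(m, n)) : R := \sum_i \sum_j M i j ^+ 2.

Definition borel n (B : set 'cV[R]_n) : Prop := <<s @open 'cV[R]_n >> B.

Definition stable_matrix n (M : 'M[R]_n) : Prop :=
  forall z : R[i], eigenvalue (map_mx (real_complex R) M) z -> complex.Re z < 0.

End matrices.

Section hilbert_space.
Context d (T : measurableType d) (R : realType) (P : probability T R).
Implicit Types (X Y Z : T -> R[i]) (S : set (T -> R[i])).

Definition cexpectation X : R[i] :=
  fine 'E_P[fun w => complex.Re (X w)] +i* fine 'E_P[fun w => complex.Im (X w)].

Definition sqdist X Y : \bar R :=
  'E_P[fun w => complex.Re (X w - Y w) ^+ 2 + complex.Im (X w - Y w) ^+ 2].

(* Elements of L^2 are represented by functions rather than by classes modulo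
   almost sure equality. *)
Definition L2 : set (T -> R[i]) := [set X : T -> R[i] |
  [/\ measurable_fun setT (fun w => complex.Re (X w)),
      measurable_fun setT (fun w => complex.Im (X w)) &
      (sqdist X (fun=> 0%R) < +oo)%E]].

Definition inner X Y : R[i] := cexpectation (fun w => X w * (Y w)^*).

Definition lin_span S : set (T -> R[i]) := [set X |
  exists (n : nat) (c : 'I_n -> R[i]) (Z : 'I_n -> T -> R[i]),
    (forall i, S (Z i)) /\ X = (fun w => \sum_i c i * Z i w)].

Definition closed_span S : set (T -> R[i]) := [set X | L2 X /\
  forall e : R, 0 < e -> exists2 Z, lin_span S Z & (sqdist X Z < e%:E)%E].

(* P_S X, for a closed subspace S: an arbitrary version of the orthogonal
   projection, which is unique up to almost sure equality *)
Definition L2_proj S X : T -> R[i] :=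
  xget (fun=> 0) [set Z | S Z /\
    forall W, S W -> inner (fun w => X w - Z w) W = 0].

Definition residual S X : T -> R[i] := fun w => X w - L2_proj S X w.

Definition cond_orth S1 S2 S3 : Prop :=
  forall X Y, S1 X -> S2 Y -> inner (residual S3 X) (residual S3 Y) = 0.

(* a version of the mean-square derivative *)
Definition ms_derive (X : R -> T -> R[i]) : R -> T -> R[i] := fun t =>
  xget (fun=> 0) [set Z | L2 Z /\
    sqdist (fun w => (h^-1)%:C * (X (t + h) w - X t w)) Z
      @[h --> 0^'] --> 0%E].

Definition ms_derive_n (j : nat) (X : R -> T -> R[i]) : R -> T -> R[i] :=
  iter j ms_derive X.

End hilbert_space.

Section relations.
Context d (T : measurableType d) (R : realType) (P : probability T R) (k : nat).
Variable Y : R -> T -> 'cV[R]_k.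

Definition component (v : 'I_k) : R -> T -> R[i] := fun t w => (Y t w v 0)%:C.

Definition lin_space (V : set 'I_k) (I : set R) : set (T -> R[i]) :=
  closed_span P [set X | exists v u, [/\ V v, I u & X = component v u]].

Definition lin_space_past (V : set 'I_k) (t : R) : set (T -> R[i]) :=
  lin_space V `]-oo, t].

Definition contemp_uncorrelated (a b : 'I_k) : Prop := forall t : R,
  cond_orth P (lin_space [set a] `[t, t + 1]) (lin_space [set b] `[t, t + 1])
    (lin_space_past setT t).

Definition local_contemp_uncorrelated (p : nat) (a b : 'I_k) : Prop :=
  forall t : R,
  ((h^-1)%:C *
    inner P
     (residual P (lin_space_past setT t)
        (ms_derive_n P p.-1 (component a) (t + h)))
     (residual P (lin_space_past setT t)
        (ms_derive_n P p.-1 (component b) (t + h))) : R[i]^o)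
    @[h --> 0^'+] --> (0 : R[i]^o).

End relations.

Section levy_processes.
Context d (T : measurableType d) (R : realType) (P : probability T R).

Definition random_vector n (X : T -> 'cV[R]_n) : Prop :=
  forall i, measurable_fun setT (fun w => X w i 0).

Definition process_sigma n (L : R -> T -> 'cV[R]_n) : set (set T) :=
  <<s [set E | exists (t : R) (B : set 'cV[R]_n), [/\ 0 <= t, borel B & E = L t @^-1` B]] >>.

Definition independent_processes n (L1 L2 : R -> T -> 'cV[R]_n) : Prop :=
  forall E F, process_sigma L1 E -> process_sigma L2 F ->
    P (E `&` F) = (P E * P F)%E.

Definition same_law n (L1 L2 : R -> T -> 'cV[R]_n) : Prop :=
  forall (m : nat) (t : 'I_m -> R) (B : 'I_m -> set 'cV[R]_n),
    (forall i, 0 <= t i) -> (forall i, borel (B i)) ->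
    P (\bigcap_i (L1 (t i) @^-1` B i)) = P (\bigcap_i (L2 (t i) @^-1` B i)).

(* time runs over [0, +oo[; the values L t for t < 0 are irrelevant *)
Record one_sided_levy n (L : R -> T -> 'cV[R]_n) : Prop := OneSidedLevy {
  levy_measurable : forall t : R, 0 <= t -> random_vector (L t);
  levy_init : {ae P, forall w, L 0 w = 0};
  levy_indep_incr :
    forall (m : nat) (t : nat -> R) (B : nat -> set 'cV[R]_n),
      0 <= t 0%N -> {homo t : i j / (i <= j)%N >-> i <= j} ->
      (forall i, borel (B i)) ->
      P (\bigcap_(i < m) [set w | B i (L (t i.+1) w - L (t i) w)]) =
      (\prod_(i < m) P [set w | B i (L (t i.+1) w - L (t i) w)%R])%E;
  levy_stat_incr :
    forall (s t : R) (B : set 'cV[R]_n), 0 <= s -> 0 <= t -> borel B ->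
      P [set w | B (L (s + t) w - L s w)] = P [set w | B (L t w - L 0 w)];
  levy_stoch_cont :
    forall t e : R, 0 <= t -> 0 < e ->
      P [set w | e < `|L s w - L t w|]
        @[s --> within [set s | 0 <= s] (nbhs t)] --> 0%E;
  levy_cadlag :
    {ae P, forall w, forall t : R, 0 <= t ->
      (L s w @[s --> t^'+] --> L t w) /\
      (0 < t -> cvg (L s w @[s --> t^'-]))}
}.

Record two_sided_levy n (L : R -> T -> 'cV[R]_n) : Prop := TwoSidedLevy {
  levy2_measurable : forall t, random_vector (L t);
  levy2_decomp : exists L1 L2 : R -> T -> 'cV[R]_n,
    [/\ one_sided_levy L1, one_sided_levy L2,
        independent_processes L1 L2, same_law L1 L2 &
        {ae P, forall w,
          (forall t : R, 0 <= t -> L t w = L1 t w) /\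
          (forall t : R, t < 0 -> L2 s w @[s --> (- t)^'-] --> - L t w)}]
}.

Definition levy_centered n (L : R -> T -> 'cV[R]_n) : Prop :=
  forall i, ('E_P[fun w => L 1%R w i 0%R] = 0)%E.

Definition levy_square_integrable n (L : R -> T -> 'cV[R]_n) : Prop :=
  ('E_P[fun w => sqnorm (L 1%R w)] < +oo)%E.

Definition Sigma_L n (L : R -> T -> 'cV[R]_n) : 'M[R]_n :=
  \matrix_(i, j) fine ('E_P[fun w => ((L 1 w *m (L 1 w)^T) i j)%R])%E.

(* Integral with respect to L of a deterministic square-integrable integrand f,
   as the mean-square limit of the integrals of step functions approximating f
   in L^2(lebesgue_measure). The step function coded by a sequence of triples
   ((s, t), M) is the sum of the M * 1_{]s, t]}, its integral is the sum of the
   M (L(t) - L(s)). *)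
Definition step_fun m n (phi : seq (R * R * 'M[R]_(m, n))) (u : R) :
    'M[R]_(m, n) :=
  \sum_(x <- phi) (if x.1.1 < u <= x.1.2 then x.2 else 0).

Definition step_integral m n (L : R -> T -> 'cV[R]_n)
    (phi : seq (R * R * 'M[R]_(m, n))) (w : T) : 'cV[R]_m :=
  \sum_(x <- phi) x.2 *m (L x.1.2 w - L x.1.1 w).

Definition is_levy_integral m n (L : R -> T -> 'cV[R]_n)
    (f : R -> 'M[R]_(m, n)) (Z : T -> 'cV[R]_m) : Prop :=
  random_vector Z /\
  exists phi : nat -> seq (R * R * 'M[R]_(m, n)),
    [/\ forall r, all (fun x => x.1.1 <= x.1.2) (phi r),
        (\int[lebesgue_measure]_u (sqnorm (f u - step_fun (phi r) u)%R)%:E)%E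
          @[r --> \oo] --> 0%E &
        ('E_P[fun w => sqnorm (Z w - step_integral L (phi r) w)%R])%E
          @[r --> \oo] --> 0%E].

End levy_processes.

Section mcar.
Context d (T : measurableType d) (R : realType) (P : probability T R).
Variables (k p : nat).

(* A_ i stands for the coefficient matrix of index i + 1 *)
Definition companion (A_ : 'I_p -> 'M[R]_k) : 'M[R]_(\sum_(i < p) k) :=
  \mxblock_(i < p, j < p)
    (if i.+1 == p then - A_ (rev_ord j)
     else if (j : nat) == i.+1 then 1%:M else 0).

Definition mcar_B : 'M[R]_(\sum_(i < p) k, k) :=
  \mxcol_(i < p) (if i.+1 == p then 1%:M else 0 : 'M[R]_k).

Definition mcar_C : 'M[R]_(k, \sum_(i < p) k) :=
  \mxrow_(j < p) (if (j : nat) == 0%N then 1%:M else 0 : 'M[R]_k).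

Record causal_MCAR (A_ : 'I_p -> 'M[R]_k) (L Y : R -> T -> 'cV[R]_k) : Prop :=
  CausalMCAR {
  mcar_order : (0 < p)%N;
  mcar_levy : two_sided_levy P L;
  mcar_centered : levy_centered P L;
  mcar_square_integrable : levy_square_integrable P L;
  mcar_stable : stable_matrix (companion A_);
  mcar_state : exists X : R -> T -> 'cV[R]_(\sum_(i < p) k),
    (forall t, is_levy_integral P L
      (fun u => if u <= t then expmx ((t - u) *: companion A_) *m mcar_B else 0)
      (X t)) /\
    (forall t w, Y t w = mcar_C *m X t w)
}.

End mcar.

Arguments mcar_B {R k p}.
Arguments mcar_C {R k p}.

(* Main.v *)
Require Import Defs.
From HB Require Import structures.
From mathcomp Require Import all_boot all_order all_algebra complex.
From mathcomp Require Import all_classical all_reals all_analysis.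
From mathcomp Require Import measurable_realfun ring lra.
Set Implicit Arguments.
Unset Strict Implicit.
Unset Printing Implicit Defensive.
Import Order.TTheory GRing.Theory Num.Theory numFieldNormedType.Exports.
Local Open Scope classical_set_scope.
Local Open Scope complex_scope.
Local Open Scope ring_scope.

(** The proof rests on the decomposition, for t <= s, of the state
  X(s) = exp((s - t)A) X(t) + N(t, s),
where the innovation N(t, s) is the Levy integral of exp((s - u)A) B over u in
]t, s]. It is orthogonal to X(r) for r <= t ([innovation_orth]), hence to the
past of Y, since Y is the first block of X.

Conversely the closed span of the past of Y up to t contains all of X(t)
([state_in_past]). If a row i of B is zero, the variance of N_i(t, t + h) is
O(|h|^3) and X_i is mean-square differentiable with derivative (A X)_i
([state_ms_derivative]). For the companion matrix this says that each block of the
state but the last has the next block as its derivative, so that block j is the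
j-th mean-square derivative of Y; derivatives taken from the left are limits of
past observations. Therefore exp((s - t)A) X(t) is the projection of X(s) on
the past of Y, and N(t, s) is its residual ([prediction_proj],
[inner_residual]).

By the isometry of Levy integrals ([levy_isometry]) the covariance of N(t, t + h)
and N(t, t + h') is the integral over u in `[0, min(h, h')] of
  exp((h - u)A) B Sigma_L B^T exp((h' - u)A^T)
([innovation_cov_integral]), whatever t is.

(a) The integral in the statement is thus the covariance of the residuals of
Y_a(t + h) and Y_b(t + h'). Conditional orthogonality contains these conditions,
and conversely extends from generators to closed spans
([cond_orth_generators]).

(b) The derivative of order p - 1 of Y is the last block of X. The covariance of
the residuals at t + h, divided by h, is the mean over `[0, h] of a continuous
function whose value at 0 is the entry of B Sigma_L B^T in the last block, that is
Sigma_L a b ([innovation_cov_average], [noise_cov_last_block]). So the limit that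
defines the local relation always exists and is Sigma_L a b.

The isometry comes from E[L_i(s) L_j(t)] = (Sigma_L)_ij <chi_s, chi_t> with chi_t
the signed indicator function of the interval from 0 to t ([levy_cov]). Only
L(1) is known to have a second moment, and the moments at other times are
deduced from the independence and the stationarity of the increments: L(t) is an
independent summand of some L(n), its mean is additive in t and bounded near 0 by
stochastic continuity, and its variance is additive and nonnegative, hence linear
in t ([sqi_levy], [levy_mean], [levy_variance]). *)

(** * The matrix exponential *)

Section matrix_exponential.
Variable R : realType.

Lemma cvg_mx_entries m n (F : nat -> 'M[R]_(m, n)) (l : 'M[R]_(m, n)) :
  (forall i j, (fun r => F r i j) @ \oo --> l i j) -> F @ \oo --> l.
Proof.
move=> Fl A [B nB BA].
have : \forall r \near \oo, forall i j, B i j (F r i j).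
  apply: filter_forall => i; apply: filter_forall => j.
  exact: (Fl i j _ (nB i j)).
by apply: filterS => r /= h; apply: BA.
Qed.

Definition entry_sum n (M : 'M[R]_n) : R := \sum_i \sum_j `|M i j|.

Lemma entry_sum_ge0 n (M : 'M[R]_n) : 0 <= entry_sum M.
Proof. by apply: sumr_ge0 => i _; apply: sumr_ge0. Qed.

Lemma norm_expr_entry n (M : 'M[R]_n) m i j :
  `|(M ^+ m) i j| <= entry_sum M ^+ m.
Proof.
elim: m i j => [|m IH] i j.
  by rewrite !expr0 mxE; case: (i == j); rewrite ?normr1 ?normr0 ?ler01.
rewrite exprS -mulmxE mxE (le_trans (ler_norm_sum _ _ _))// exprS.
apply: (@le_trans _ _ (\sum_l `|M i l| * entry_sum M ^+ m)).
  by apply: ler_sum => l _; rewrite normrM ler_wpM2l.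
rewrite -mulr_suml ler_wpM2r ?exprn_ge0 ?entry_sum_ge0//.
rewrite /entry_sum [leRHS](bigD1 i)//= lerDl.
by apply: sumr_ge0 => l _; apply: sumr_ge0.
Qed.

Lemma exprZmx n (M : 'M[R]_n) t m : (t *: M) ^+ m = t ^+ m *: M ^+ m.
Proof.
elim: m => [|m IH]; first by rewrite !expr0 scale1r.
by rewrite !exprS IH -!mulmxE -scalemxAl -scalemxAr scalerA.
Qed.

Definition expmx_coef n (M : 'M[R]_n) i j (m : nat) : R :=
  (m`!%:R)^-1 * (M ^+ m) i j.

(** The series is dominated by the one of the exponential of the sum of the
absolute values of the entries of M. *)
Lemma is_cvg_expmx_coef n (M : 'M[R]_n) i j t :
  cvgn (pseries (expmx_coef M i j) t).
Proof.
apply: normed_cvg.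
apply: (@series_le_cvg _ _ (exp_coeff (entry_sum M * `|t|))) => //.
- by move=> m; rewrite /= normr_ge0.
- by move=> m; rewrite exp_coeff_ge0// mulr_ge0// entry_sum_ge0.
- move=> m; rewrite /exp_coeff /expmx_coef /= !normrM normrX exprMn.
  rewrite [leRHS]mulrAC ler_wpM2r ?exprn_ge0// [leRHS]mulrC normfV.
  by rewrite normr_nat ler_wpM2l ?invr_ge0// norm_expr_entry.
- exact: is_cvg_series_exp_coeff.
Qed.

(** Each entry of exp(tM) is a scalar power series in t, to which the theory of
real power series applies; the series of matrices converges because it does
entrywise. *)
Lemma expmxE n (M : 'M[R]_n) t i j :
  expmx (t *: M) i j = limn (pseries (expmx_coef M i j) t).
Proof.
pose l : 'M[R]_n := \matrix_(i, j) limn (pseries (expmx_coef M i j) t).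
suff -> : expmx (t *: M) = l by rewrite mxE.
apply: cvg_lim; first exact: norm_hausdorff.
apply: cvg_mx_entries => a b; rewrite mxE.
have -> : (fun r => series (fun m => (m`!%:R)^-1 *: (t *: M) ^+ m) r a b) =
    pseries (expmx_coef M a b) t.
  apply/funext => r; rewrite /pseries /series /= summxE; apply: eq_bigr => m _.
  by rewrite mxE exprZmx mxE /expmx_coef mulrCA mulrC.
exact: is_cvg_expmx_coef.
Qed.

Lemma expmx_coef_diffs n (M : 'M[R]_n) i j :
  pseries_diffs (expmx_coef M i j) =
  fun m => \sum_l M i l * expmx_coef M l j m.
Proof.
apply/funext => m; rewrite /pseries_diffs /expmx_coef factS natrM invfM exprS.
rewrite -mulmxE mxE !mulrA divff// mul1r mulr_sumr.
by apply: eq_bigr => l _; rewrite mulrCA.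
Qed.

Lemma pseries_sum n (c : 'I_n -> R^nat) (a : 'I_n -> R) t :
  (forall l, cvgn (pseries (c l) t)) ->
  pseries (fun m => \sum_l a l * c l m) t @ \oo -->
    \sum_l a l * limn (pseries (c l) t).
Proof.
move=> cc.
have -> : pseries (fun m => \sum_l a l * c l m) t =
    (fun r => \sum_l a l * pseries (c l) t r).
  apply/funext => r; rewrite /pseries /series /=.
  under [RHS]eq_bigr do rewrite mulr_sumr.
  rewrite exchange_big; apply: eq_bigr => m _ /=.
  by rewrite mulr_suml; apply: eq_bigr => l _; rewrite mulrA.
apply: cvg_big => [|l _]; first exact: add_continuous.
by apply: cvgM; [exact: cvg_cst|exact: cc].
Qed.

(** The coefficients of the termwise derivative are linear combinations of the
original ones, so that its convergence and that of the second derivative come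
from the convergence of the series itself. *)
Lemma is_derive_expmx n (M : 'M[R]_n) i j (t : R) :
  is_derive t 1 (fun s : R => expmx (s *: M) i j) ((M *m expmx (t *: M)) i j).
Proof.
have cd a b s : cvgn (pseries (pseries_diffs (expmx_coef M a b)) s).
  rewrite expmx_coef_diffs; apply/cvg_ex; eexists.
  by apply: (pseries_sum (a := M a)) => l; exact: is_cvg_expmx_coef.
have cdd a b s :
    cvgn (pseries (pseries_diffs (pseries_diffs (expmx_coef M a b))) s).
  have -> : pseries_diffs (pseries_diffs (expmx_coef M a b)) =
      fun m => \sum_l M a l * pseries_diffs (expmx_coef M l b) m.
    apply/funext => m; rewrite expmx_coef_diffs /pseries_diffs mulr_sumr.
    by apply: eq_bigr => l _; rewrite mulrCA.
  apply/cvg_ex; eexists.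
  by apply: (pseries_sum (a := M a)) => l; exact: cd.
rewrite (_ : (fun s : R => _) = fun s => limn (pseries (expmx_coef M i j) s));
  last by apply/funext => s; rewrite expmxE.
have -> : (M *m expmx (t *: M)) i j =
    limn (pseries (pseries_diffs (expmx_coef M i j)) t).
  rewrite mxE expmx_coef_diffs; apply/esym/cvg_lim => //.
  under eq_bigr do rewrite expmxE.
  by apply: pseries_sum => l; exact: is_cvg_expmx_coef.
apply: (@pseries_snd_diffs _ _ (`|t| + 1)) => //.
  exact: is_cvg_expmx_coef.
by rewrite [ltRHS]ger0_norm ?addr_ge0// ltrDl.
Qed.

Lemma expmx0 n (M : 'M[R]_n) : expmx (0 *: M) = 1%:M.
Proof.
apply/matrixP => i j; rewrite expmxE.
apply: cvg_lim => //; apply/cvg_ballP => e e0; near=> r.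
have -> : pseries (expmx_coef M i j) 0 r = (1%:M : 'M[R]_n) i j.
  rewrite /pseries /series /= big_ltn; last by near: r; exists 1%N.
  rewrite big1_seq ?addr0 => [|m].
    by rewrite /expmx_coef !expr0 mulr1 fact0 invr1 mul1r.
  by rewrite mem_index_iota /= => /andP[m0 _]; rewrite expr0n eqn0Ngt m0 mulr0.
exact: ballxx.
Unshelve. all: by end_near. Qed.

Lemma expmx_comm n (M : 'M[R]_n) t :
  M *m expmx (t *: M) = expmx (t *: M) *m M.
Proof.
apply/matrixP => i j; rewrite !mxE.
transitivity (limn (pseries (fun m => \sum_l M i l * expmx_coef M l j m) t)).
  apply/esym/cvg_lim => //; under eq_bigr do rewrite expmxE.
  by apply: pseries_sum => l; exact: is_cvg_expmx_coef.
transitivity (limn (pseries (fun m => \sum_l M l j * expmx_coef M i l m) t)).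
  congr (limn (pseries _ t)); apply/funext => m.
  have := congr1 (fun N : 'M[R]_n => (m`!%:R)^-1 * N i j) (exprSr M m).
  rewrite exprS -!mulmxE !mxE !mulr_sumr /expmx_coef => h.
  rewrite (eq_bigr _ (fun l _ => mulrCA _ _ _)) h.
  by apply: eq_bigr => l _; rewrite mulrA mulrC.
apply: cvg_lim => //.
under eq_bigr do rewrite expmxE mulrC.
by apply: pseries_sum => l; exact: is_cvg_expmx_coef.
Qed.

(** The derivative in t of the left-hand side vanishes since M commutes with its
exponential; at t = 0 it is the right-hand side. *)
Lemma expmx_shift n (M : 'M[R]_n) s t :
  expmx ((t + s) *: M) *m expmx (- t *: M) = expmx (s *: M).
Proof.
apply/matrixP => i j.
pose G (u : R) : R := (expmx ((u + s) *: M) *m expmx (- u *: M)) i j.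
have GE : G = \sum_l ((fun u : R => expmx ((u + s) *: M) i l) *
                      (fun u : R => expmx (- u *: M) l j)).
  apply/funext => u; rewrite /G mxE fct_sumE.
  by apply: eq_bigr.
suff dG (u : R) : is_derive u 1 G 0.
  have /= := is_derive_0_is_cst t 0 dG.
  by rewrite /G => ->; rewrite add0r oppr0 expmx0 mulmx1.
pose D1 (v : R) a b := (M *m expmx (v *: M)) a b.
have d1 l : is_derive u 1 (fun u : R => expmx ((u + s) *: M) i l)
    (D1 (u + s) i l).
  have h := @is_derive1_comp R (fun u : R => expmx (u *: M) i l) (fun u => u + s)
    u (D1 (u + s) i l) 1 (is_derive_expmx _ _ _ _) _.
  have hs : is_derive u 1 (fun v : R => v + s) (1 + 0) by exact: is_deriveD.
  by rewrite addr0 in hs; rewrite mulr1 in h; exact: h.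
have d2 l : is_derive u 1 (fun u : R => expmx (- u *: M) l j)
    (- D1 (- u) l j).
  have h := @is_derive1_comp R (fun u : R => expmx (u *: M) l j) (fun u => - u)
    u (D1 (- u) l j) (-1) (is_derive_expmx _ _ _ _) _.
  by rewrite -mulrN1; apply: h.
rewrite GE.
pose D l : R := expmx ((u + s) *: M) i l *: (- D1 (- u) l j) +
  expmx (- u *: M) l j *: D1 (u + s) i l.
have -> : 0 = \sum_l D l.
  rewrite big_split /= addrC; apply/esym/eqP.
  have h : \sum_l expmx (- u *: M) l j * D1 (u + s) i l =
      ((M *m expmx ((u + s) *: M)) *m expmx (- u *: M)) i j.
    by rewrite [RHS]mxE; apply: eq_bigr => l _; rewrite mulrC.
  have h' : \sum_l expmx ((u + s) *: M) i l * (- D1 (- u) l j) =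
      - (expmx ((u + s) *: M) *m (M *m expmx (- u *: M))) i j.
    by rewrite [X in _ = - X]mxE -sumrN; apply: eq_bigr => l _; rewrite mulrN.
  by rewrite h h' expmx_comm mulmxA subrr.
apply: is_derive_sum => l; exact: is_deriveM.
Qed.

Lemma expmxD n (M : 'M[R]_n) s t :
  expmx ((s + t) *: M) = expmx (s *: M) *m expmx (t *: M).
Proof.
have inv : expmx (- t *: M) *m expmx (t *: M) = 1%:M.
  have := expmx_shift M 0 (- t); rewrite addr0 opprK => ->; exact: expmx0.
by rewrite -(expmx_shift M s t) -mulmxA inv mulmx1 addrC.
Qed.

Lemma trmx_expmx n (M : 'M[R]_n) t : (expmx (t *: M))^T = expmx (t *: M^T).
Proof.
apply/matrixP => i j; rewrite mxE !expmxE; congr (limn (pseries _ t)).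
apply/funext => m; rewrite /expmx_coef; congr (_ * _).
elim: m i j => [|m IH] i j; first by rewrite !expr0 !mxE eq_sym.
rewrite exprSr exprS -!mulmxE !mxE.
by apply: eq_bigr => l _; rewrite mxE IH mulrC.
Qed.

Lemma continuous_expmx n (M : 'M[R]_n) i j :
  continuous (fun t : R => expmx (t *: M) i j).
Proof.
move=> t; apply/differentiable_continuous/derivable1_diffP.
by have [] := is_derive_expmx M i j t.
Qed.

Lemma expmx_diff_quotient n (M : 'M[R]_n) i j :
  h^-1 * (expmx (h *: M) i j - (1%:M : 'M[R]_n) i j) @[h --> (0:R)^'] --> M i j.
Proof.
have [d0 d1] := is_derive_expmx M i j 0.
move: d0; rewrite /derivable => /cvgP; move: d1; rewrite /derive => -> .
rewrite expmx0 mulmx1 /= => h; apply: cvg_trans h; apply: near_eq_cvg.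
by apply: nearW => s; rewrite addr0 scaler1.
Qed.

(** The difference quotients at 0 converge, hence are bounded near 0. *)
Lemma expmx_lipschitz n (M : 'M[R]_n) : exists2 C : R, 0 < C &
  \forall s \near (0 : R), forall i j,
    `|expmx (s *: M) i j - (1%:M : 'M[R]_n) i j| <= C * `|s|.
Proof.
pose C := 1 + entry_sum M; exists C; first by rewrite ltr_pwDl// entry_sum_ge0.
suff H i j : \forall s \near (0 : R),
    `|expmx (s *: M) i j - (1%:M : 'M[R]_n) i j| <= C * `|s|.
  pose f i j s := `|expmx (s *: M) i j - (1%:M : 'M[R]_n) i j| <= C * `|s|.
  have H1 i' := @filter_forall R _ (f i') (nbhs (0 : R)) (nbhs_filter (0 : R)) (H i').
  exact: (@filter_forall R _ _ (nbhs (0 : R)) (nbhs_filter (0 : R)) H1).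
have Mle : `|M i j| <= entry_sum M by have := norm_expr_entry M 1 i j; rewrite !expr1.
have /cvgrPdist_le/(_ _ ltr01) := @expmx_diff_quotient n M i j.
rewrite near_withinE; apply: filterS => s hs.
have [->|s0] := eqVneq s 0.
  by rewrite expmx0 subrr !normr0 mulr0.
have {}hs := hs s0.
rewrite -[X in `|X|](mulVKf s0) normrM mulrC ler_wpM2r//.
rewrite /C -lerBlDr (le_trans _ hs)// distrC.
apply: le_trans (lerB_dist _ _); exact: lerB.
Qed.

End matrix_exponential.

(** * Real square-integrable functions and their inner product *)

Section square_integrable.
Context d (T : measurableType d) (R : realType).
Variable mu : {measure set T -> \bar R}.
Implicit Types f g h : T -> R.

Definition sqi f : Prop :=
  measurable_fun setT f /\ (\int[mu]_x (f x ^+ 2)%:E < +oo)%E.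

Definition ip f g : R := \int[mu]_x (f x * g x).

Lemma integrable_sqr f : sqi f ->
  mu.-integrable setT (EFin \o (fun x => f x ^+ 2)).
Proof.
move=> [mf If]; apply/integrableP; split.
  by apply/measurable_EFinP; exact: measurable_funX.
under eq_integral => x _ do rewrite /= ger0_norm ?sqr_ge0//.
exact: If.
Qed.

Lemma integrable_ip f g : sqi f -> sqi g ->
  mu.-integrable setT (EFin \o (fun x => f x * g x)).
Proof.
move=> sf sg; have [[mf _] [mg _]] := (sf, sg).
have h := integrableD measurableT (integrable_sqr sf) (integrable_sqr sg).
apply: le_integrable h => //.
  by apply/measurable_EFinP; exact: measurable_funM.
move=> x _ /=; rewrite lee_fin [leRHS]ger0_norm ?addr_ge0 ?sqr_ge0//.
rewrite ler_norml; apply/andP; split.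
  have := sqr_ge0 (f x + g x); nra.
have := sqr_ge0 (f x - g x); nra.
Qed.

Lemma EFin_ip f : sqi f -> (ip f f)%:E = (\int[mu]_x (f x ^+ 2)%:E)%E.
Proof.
move=> sf; rewrite /ip /Rintegral fineK//.
by apply: integrable_fin_num => //; exact: integrable_ip.
Qed.

Lemma sqi_integrable f : measurable_fun setT f ->
  mu.-integrable setT (EFin \o (fun x => f x ^+ 2)) -> sqi f.
Proof.
move=> mf /integrableP[_]; under eq_integral => x _ do
  rewrite /= ger0_norm ?sqr_ge0//.
by split.
Qed.

Lemma sqi0 : sqi (0 : T -> R).
Proof.
split; first exact: (measurable_cst (0 : R)).
by rewrite integral0_eq ?ltry// => x _; rewrite expr0n.
Qed.

Lemma sqiD f g : sqi f -> sqi g -> sqi (f + g).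
Proof.
move=> sf sg; have [[mf _] [mg _]] := (sf, sg).
apply: sqi_integrable; first exact: measurable_funD.
have h := integrableD measurableT (integrable_sqr sf) (integrable_sqr sg).
apply: le_integrable (integrableZl measurableT 2 h) => //.
  by apply/measurable_EFinP/measurable_funX; exact: measurable_funD.
move=> x _ /=; rewrite lee_fin (ger0_norm (sqr_ge0 _)) ger0_norm; last first.
  by rewrite mulr_ge0 ?addr_ge0 ?sqr_ge0.
rewrite -[(f + g) x]/(f x + g x); have := sqr_ge0 (f x - g x); nra.
Qed.

Lemma sqiZ c f : sqi f -> sqi (c *: f).
Proof.
move=> sf; have [mf _] := sf.
have mcf : measurable_fun setT (c *: f).
  by apply: measurable_funM => //; exact: measurable_cst.
apply: sqi_integrable => //.
have := integrableZl measurableT (c ^+ 2) (integrable_sqr sf).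
by apply: eq_integrable => // x _ /=; rewrite -EFinM -exprMn.
Qed.

Lemma sqiN f : sqi f -> sqi (- f).
Proof. by rewrite -scaleN1r; exact: sqiZ. Qed.

Lemma sqiB f g : sqi f -> sqi g -> sqi (f - g).
Proof. by move=> sf sg; apply: sqiD => //; exact: sqiN. Qed.

Lemma sqi_sum (I : Type) (r : seq I) (Q : pred I) (F : I -> T -> R) :
  (forall i, sqi (F i)) -> sqi (\sum_(i <- r | Q i) F i).
Proof.
by move=> sF; elim/big_ind: _ => //; [exact: sqi0|exact: sqiD].
Qed.

#[local] Hint Resolve sqi0 sqiD sqiB sqiN sqiZ : core.

Lemma ipC f g : ip f g = ip g f.
Proof. by apply: eq_Rintegral => x _; rewrite mulrC. Qed.

Lemma ipDl f g h : sqi f -> sqi g -> sqi h -> ip (f + g) h = ip f h + ip g h.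
Proof.
move=> sf sg sh; rewrite /ip -RintegralD//; [|exact: integrable_ip..].
by apply: eq_Rintegral => x _; rewrite -mulrDl.
Qed.

Lemma ipZl c f h : sqi f -> sqi h -> ip (c *: f) h = c * ip f h.
Proof.
move=> sf sh; rewrite /ip -RintegralZl//; last exact: integrable_ip.
by apply: eq_Rintegral => x _; rewrite mulrA.
Qed.

Lemma ip0l h : ip 0 h = 0.
Proof.
rewrite /ip /Rintegral integral0_eq// => x _.
by rewrite [(0 : T -> R) x]/0 mul0r.
Qed.

Lemma ipNl f h : sqi f -> sqi h -> ip (- f) h = - ip f h.
Proof. by move=> sf sh; rewrite -scaleN1r ipZl// mulN1r. Qed.

Lemma ipBl f g h : sqi f -> sqi g -> sqi h -> ip (f - g) h = ip f h - ip g h.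
Proof. by move=> *; rewrite ipDl ?ipNl//; exact: sqiN. Qed.

Lemma ip_suml (I : Type) (r : seq I) (Q : pred I) (F : I -> T -> R) h :
  (forall i, sqi (F i)) -> sqi h ->
  ip (\sum_(i <- r | Q i) F i) h = \sum_(i <- r | Q i) ip (F i) h.
Proof.
move=> sF sh; elim: r => [|i r IH]; first by rewrite !big_nil ip0l.
rewrite !big_cons; case: ifP => // _; rewrite ipDl ?IH//; exact: sqi_sum.
Qed.

Lemma ipDr f g h : sqi f -> sqi g -> sqi h -> ip h (f + g) = ip h f + ip h g.
Proof. by move=> *; rewrite ipC ipDl// ipC [ip g h]ipC. Qed.

Lemma ipZr c f h : sqi f -> sqi h -> ip h (c *: f) = c * ip h f.
Proof. by move=> *; rewrite ipC ipZl// ipC. Qed.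

Lemma ipNr f h : sqi f -> sqi h -> ip h (- f) = - ip h f.
Proof. by move=> *; rewrite ipC ipNl// ipC. Qed.

Lemma ipBr f g h : sqi f -> sqi g -> sqi h -> ip h (f - g) = ip h f - ip h g.
Proof. by move=> *; rewrite ipC ipBl// ipC [ip g h]ipC. Qed.

Lemma ip_sumr (I : Type) (r : seq I) (Q : pred I) (F : I -> T -> R) h :
  (forall i, sqi (F i)) -> sqi h ->
  ip h (\sum_(i <- r | Q i) F i) = \sum_(i <- r | Q i) ip h (F i).
Proof.
by move=> *; rewrite ipC ip_suml//; apply: eq_bigr => i _; rewrite ipC.
Qed.

Lemma ipBB f g f' g' : sqi f -> sqi g -> sqi f' -> sqi g' ->
  ip (f - g) (f' - g') = ip f f' - ip f g' - (ip g f' - ip g g').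
Proof. by move=> *; rewrite ipBl ?ipBr//; exact: sqiB. Qed.

Lemma ip_ge0 f : 0 <= ip f f.
Proof. by apply: Rintegral_ge0 => x _; rewrite -expr2 sqr_ge0. Qed.

Lemma ip_cauchy_schwarz f g : sqi f -> sqi g ->
  `|ip f g| <= Num.sqrt (ip f f) * Num.sqrt (ip g g).
Proof.
move=> sf sg.
have q t : 0 <= ip g g - 2 * t * ip f g + t ^+ 2 * ip f f.
  have := ip_ge0 (g - t *: f).
  rewrite ipBl ?ipBr ?ipZl ?ipZr//; auto.
  rewrite [ip g f]ipC; nra.
rewrite -sqrtrM ?ip_ge0// -sqrtr_sqr ler_wsqrtr//.
have [f0|f0] := eqVneq (ip f f) 0.
  have [->|fg0] := eqVneq (ip f g) 0.
    by rewrite expr0n mulr_ge0 ?ip_ge0.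
  (* q is affine here, and equal to -1 at this point *)
  have := q ((ip g g + 1) / (2 * ip f g)).
  rewrite f0 mulr0 addr0.
  have -> : 2 * ((ip g g + 1) / (2 * ip f g)) * ip f g = ip g g + 1 by field.
  lra.
have f1 : 0 < ip f f by rewrite lt_def f0 ip_ge0.
have := q (ip f g / ip f f).
have -> : ip g g - 2 * (ip f g / ip f f) * ip f g +
    (ip f g / ip f f) ^+ 2 * ip f f = (ip f f * ip g g - ip f g ^+ 2) / ip f f.
  by field.
by rewrite pmulr_lge0 ?invr_gt0// subr_ge0.
Qed.

Lemma ip_null f g : sqi f -> sqi g -> ip f f = 0 -> ip f g = 0.
Proof.
move=> sf sg f0; apply/eqP; rewrite -normr_le0.
by rewrite (le_trans (ip_cauchy_schwarz sf sg))// f0 sqrtr0 mul0r.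
Qed.

Definition null f : Prop := sqi f /\ ip f f = 0.

Lemma null_ae f : measurable_fun setT f -> {ae mu, forall x, f x = 0} -> null f.
Proof.
move=> mf f0.
have If : (\int[mu]_x (f x ^+ 2)%:E = 0)%E.
  rewrite (ge0_ae_eq_integral (g := cst 0%E))//.
  - by rewrite integral_cst// mul0e.
  - by apply/measurable_EFinP; exact: measurable_funX.
  - by move=> x _; rewrite lee_fin sqr_ge0.
  - by apply: filterS f0 => x /= -> _; rewrite expr0n.
have sf : sqi f by split => //; rewrite If ltry.
by split => //; apply: EFin_inj; rewrite EFin_ip.
Qed.

Lemma nullN f : null f -> null (- f).
Proof. by move=> [sf f0]; split; [exact: sqiN|rewrite ipNl ?ipNr ?opprK//; auto]. Qed.

Lemma null_sqi f g : sqi f -> null (f - g) -> sqi g.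
Proof. by move=> sf [sfg _]; rewrite -[g](subKr f) ; auto. Qed.

Lemma ip_nulll f g h : sqi f -> null (f - g) -> sqi h -> ip f h = ip g h.
Proof.
move=> sf nfg sh; have sg := null_sqi sf nfg; case: nfg => sfg fg0.
by apply/eqP; rewrite -subr_eq0 -ipBl// (ip_null sfg sh fg0).
Qed.

Lemma ip_nullr f g h : sqi f -> null (f - g) -> sqi h -> ip h f = ip h g.
Proof. by move=> *; rewrite ipC (@ip_nulll f g)// ipC. Qed.

(** By Fatou's lemma the mean-square distance of g to the pointwise limit is at
most the limit of the mean-square distances. *)
Lemma null_ae_cvg (f_ : nat -> T -> R) f g :
  (forall n, sqi (f_ n)) -> measurable_fun setT f -> sqi g ->
  {ae mu, forall x, f_ n x @[n --> \oo] --> f x} ->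
  ip (f_ n - g) (f_ n - g) @[n --> \oo] --> 0 -> null (f - g).
Proof.
move=> sf mf sg fl gl; have [mg _] := sg.
have mfg : measurable_fun setT (f - g) by exact: measurable_funB.
pose F n x := (((f_ n - g) x) ^+ 2)%:E.
have mF n : measurable_fun setT (F n).
  apply/measurable_EFinP/measurable_funX; apply: measurable_funB => //.
  by have [] := sf n.
have le0 : (\int[mu]_x (((f - g) x) ^+ 2)%:E <= 0)%E.
  have := fatou mu measurableT mF (fun n x _ => sqr_ge0 ((f_ n - g) x)).
  have -> : limn_einf (fun n => \int[mu]_x F n x)%E = 0%E.
    have h : (\int[mu]_x F n x)%E @[n --> \oo] --> 0%E.
      have -> : (fun n => \int[mu]_x F n x)%E =
          EFin \o (fun n => ip (f_ n - g) (f_ n - g)).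
        by apply/funext => n; rewrite /= EFin_ip//; auto.
      by apply: cvg_EFin; [exact: nearW|exact: gl].
    by have /cvg_lim <- // := h; rewrite is_cvg_limn_einfE//; apply/cvg_ex; exists 0%E.
  apply: le_trans; rewrite le_eqVlt; apply/orP; left; apply/eqP.
  apply: ge0_ae_eq_integral => //.
  - by apply/measurable_EFinP/measurable_funX.
  - have -> : (fun x => limn_einf (F^~ x)) =
        (fun x => - limn_esup (fun n => - F n x))%E.
      by apply/funext => x; rewrite (limn_esupN (F^~ x)) oppeK.
    apply: measurableT_comp => //; apply: measurable_fun_limn_esup => n.
    exact: measurableT_comp (mF n).
  - by move=> x _; rewrite lee_fin sqr_ge0.
  - move=> x _; rewrite limn_einf_lim; apply: lime_ge.
      exact: is_cvg_einfs.
    apply: nearW => n; apply: le_ereal_inf_tmp => _ [m _ <-].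
    by rewrite lee_fin sqr_ge0.
  apply: filterS fl => x fx _; apply/esym.
  have h : F n x @[n --> \oo] --> (((f - g) x) ^+ 2)%:E.
    apply: cvg_EFin; first exact: nearW.
    apply: (@cvg_comp _ _ _ _ (fun y => y ^+ 2)).
      exact: cvgB fx (cvg_cst _).
    exact: (@exprn_continuous R 2).
  by rewrite is_cvg_limn_einfE; [exact: cvg_lim|apply/cvg_ex; eexists; exact: h].
have I0 : (\int[mu]_x (((f - g) x) ^+ 2)%:E = 0)%E.
  apply/eqP; rewrite eq_le le0/=; apply: integral_ge0 => x _.
  by rewrite lee_fin sqr_ge0.
have sfg : sqi (f - g) by split => //; rewrite I0 ltry.
by split => //; apply: EFin_inj; rewrite EFin_ip.
Qed.

(** The difference of the two sides is the squared norm of f - g. *)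
Lemma ip_add_le f g : sqi f -> sqi g ->
  ip (f + g) (f + g) <= 2 * ip f f + 2 * ip g g.
Proof.
move=> sf sg; have := ip_ge0 (f - g).
rewrite ipBl ?ipDl ?ipBr ?ipDr//; auto.
rewrite [ip g f]ipC; nra.
Qed.

Lemma cvg_ip (I : Type) (F : set_system I) {FF : Filter F}
    (f_ g_ : I -> T -> R) f g :
  (forall n, sqi (f_ n)) -> (forall n, sqi (g_ n)) -> sqi f -> sqi g ->
  ip (f_ n - f) (f_ n - f) @[n --> F] --> 0 ->
  ip (g_ n - g) (g_ n - g) @[n --> F] --> 0 ->
  ip (f_ n) (g_ n) @[n --> F] --> ip f g.
Proof.
move=> sf_ sg_ sf sg fl gl.
have sqrt0 (u : I -> R) : u n @[n --> F] --> 0 ->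
    Num.sqrt (u n) @[n --> F] --> (0 : R).
  by move=> u0; rewrite -[X in _ --> X]sqrtr0; apply: continuous_cvg => //;
    exact: sqrt_continuous.
have small (u v : I -> T -> R) : (forall n, sqi (u n)) ->
    (forall n, sqi (v n)) ->
    Num.sqrt (ip (u n) (u n)) * Num.sqrt (ip (v n) (v n)) @[n --> F] --> 0 ->
    ip (u n) (v n) @[n --> F] --> (0 : R).
  move=> su sv h; apply: norm_cvg0.
  apply: (@squeeze_cvgr _ _ _ _ (fun=> 0) _ _ _ _ _ h); last exact: cvg_cst.
  by apply: nearW => n; rewrite normr_ge0 ip_cauchy_schwarz.
(* bilinearity leaves three products with a small factor *)
have e n : ip (f_ n) (g_ n) = ip (f_ n - f) (g_ n - g) + ip (f_ n - f) g +
    ip f (g_ n - g) + ip f g.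
  rewrite !ipBl ?ipBr//; auto.
  ring.
rewrite (funext e).
rewrite -[X in _ --> X]add0r; apply: cvgD; last exact: cvg_cst.
rewrite -[X in _ --> X]addr0; apply: cvgD; first last.
  apply: (small (fun=> f)) => // [n|]; first by auto.
  rewrite -[X in _ --> X](mulr0 (Num.sqrt (ip f f))).
  by apply: cvgM; [exact: cvg_cst|exact: sqrt0].
rewrite -[X in _ --> X]addr0; apply: cvgD; first last.
  apply: (small _ (fun=> g)) => // [n|]; first by auto.
  rewrite -[X in _ --> X](mul0r (Num.sqrt (ip g g))).
  by apply: cvgM; [exact: sqrt0|exact: cvg_cst].
apply: small => [n|n|]; [by auto..|].
by rewrite -[X in _ --> X](mulr0 0); apply: cvgM; exact: sqrt0.
Qed.

End square_integrable.

(** * Independence, and the first two moments of a scalar Levy process *)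

Section independence.
Context d (T : measurableType d) (R : realType) (P : probability T R).
Implicit Types U V : T -> R.

Definition indep U V := forall A B : set R, measurable A -> measurable B ->
  P (U @^-1` A `&` V @^-1` B) = (P (U @^-1` A) * P (V @^-1` B))%E.

Definition eq_law U V := forall A : set R, measurable A ->
  P (U @^-1` A) = P (V @^-1` A).

(** The law of the pair is the product of the two laws, so that Tonelli's theorem
applies. *)
Lemma ge0_integral_indep U V (f : R * R -> \bar R) :
  measurable_fun setT U -> measurable_fun setT V -> indep U V ->
  measurable_fun setT f -> (forall x, (0 <= f x)%E) ->
  (\int[P]_w f (U w, V w) = \int[P]_w \int[P]_w' f (U w, V w'))%E.
Proof.
move=> mU mV UV mf f0.
pose U' : {mfun T >-> R} := mfun_Sub (mem_set mU).
pose V' : {mfun T >-> R} := mfun_Sub (mem_set mV).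
have mUV : measurable_fun setT (fun w => (U w, V w)) by exact: measurable_fun_pair.
pose W : {mfun T >-> (R * R)%type} := mfun_Sub (mem_set mUV).
transitivity (\int[distribution P W]_z f z)%E.
  by rewrite ge0_integral_distribution.
transitivity (\int[distribution P U' \x distribution P V']_z f z)%E.
  apply: eq_measure_integral => A mA _; apply/esym.
  exact: product_measure_unique.
rewrite fubini_tonelli1// ge0_integral_distribution//; last first.
- by move=> y; apply: integral_ge0.
- exact: measurable_fun_fubini_tonelli_F.
apply: eq_integral => w _; rewrite /fubini_F /= ge0_integral_distribution//.
exact: measurable_fun_pair2.
Qed.

Lemma ge0_integral_eq_law U V (f : R -> \bar R) :
  measurable_fun setT U -> measurable_fun setT V -> eq_law U V ->
  measurable_fun setT f -> (forall x, (0 <= f x)%E) ->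
  (\int[P]_w f (U w) = \int[P]_w f (V w))%E.
Proof.
move=> mU mV UV mf f0.
pose U' : {mfun T >-> R} := mfun_Sub (mem_set mU).
pose V' : {mfun T >-> R} := mfun_Sub (mem_set mV).
transitivity (\int[distribution P U']_z f z)%E.
  by rewrite ge0_integral_distribution.
transitivity (\int[distribution P V']_z f z)%E.
  by apply: eq_measure_integral => A mA _; exact: UV.
by rewrite ge0_integral_distribution.
Qed.

Lemma sqi_cst (c : R) : sqi P (fun=> c).
Proof.
split; first exact: measurable_cst.
by rewrite integral_cst//= probability_setT mule1 ltry.
Qed.

Lemma ip_cst (c c' : R) : ip P (fun=> c) (fun=> c') = c * c'.
Proof. by rewrite /ip Rintegral_cst// [fine _](_ : _ = 1) ?mulr1// -[RHS]/(fine 1%:E); congr fine; exact: probability_setT. Qed.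

Let one : T -> R := fun=> 1.
Let s1 : sqi P one := sqi_cst 1.
#[local] Hint Resolve sqi0 sqiD sqiB sqiN sqiZ s1 : core.

Lemma sqi_eq_law U V : measurable_fun setT V -> eq_law U V ->
  sqi P U -> sqi P V.
Proof.
move=> mV UV [mU IU]; split => //.
rewrite -(ge0_integral_eq_law (f := fun x => (x ^+ 2)%:E) mU mV)//.
  by apply/measurable_EFinP; exact: measurable_funX.
by move=> x; rewrite lee_fin sqr_ge0.
Qed.

Lemma ip_sqr_shift U c : sqi P U ->
  ip P (U + c *: one) (U + c *: one) = ip P U U + 2 * c * ip P U one + c ^+ 2.
Proof.
move=> sU; rewrite !ipDl ?ipDr ?ipZl ?ipZr//; auto.
by rewrite [ip P one U]ipC ip_cst; ring.
Qed.

(** The second moments of U and of U + 1 determine the first two moments of U;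
only integrals of nonnegative functions are transported from one law to the
other. *)
Lemma ip_eq_law U V : eq_law U V -> sqi P U -> sqi P V ->
  ip P U U = ip P V V /\ ip P U one = ip P V one.
Proof.
move=> UV sU sV; have [[mU _] [mV _]] := (sU, sV).
have h c : ip P (U + c *: one) (U + c *: one) = ip P (V + c *: one) (V + c *: one).
  apply: EFin_inj; rewrite !EFin_ip//; auto.
  apply: (ge0_integral_eq_law (f := fun x => ((x + c * 1) ^+ 2)%:E) mU mV UV).
    by apply/measurable_EFinP/measurable_funX; exact: measurable_funD.
  by move=> x; rewrite lee_fin sqr_ge0.
have h0 := h 0; have h1 := h 1.
rewrite !ip_sqr_shift// in h0 h1; split; lra.
Qed.

(** By Tonelli's theorem U + c is square integrable for some value c of V. *)
Lemma sqi_indep_summand U V : measurable_fun setT U -> measurable_fun setT V ->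
  indep U V -> sqi P (U + V) -> sqi P U.
Proof.
move=> mU mV UV [_ IUV].
have h := ge0_integral_indep (f := fun x => ((x.2 + x.1) ^+ 2)%:E) mV mU.
have VU : indep V U.
  by move=> A B mA mB; rewrite setIC UV// muleC.
have mf : measurable_fun setT (fun x : R * R => ((x.2 + x.1) ^+ 2)%:E).
  by apply/measurable_EFinP/measurable_funX; apply: measurable_funD;
    [exact: measurable_snd|exact: measurable_fst].
have {}h := h VU mf (fun x => sqr_ge0 _).
have [w Iw] : exists w, (\int[P]_w' ((U w' + V w) ^+ 2)%:E < +oo)%E.
  apply: contrapT => /forallNP no.
  move: IUV; rewrite [X in (X < _)%E]h.
  under eq_integral => w _.
    have -> : (\int[P]_w' ((U w' + V w) ^+ 2)%:E = +oo)%E.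
      by apply/eqP; rewrite -leye_eq leNgt; apply/negP/no.
    over.
  by rewrite integral_cst//= probability_setT mule1 ltxx.
have sw : sqi P (U + V w *: one).
  split; first by apply: measurable_funD => //; exact: (measurable_cst (V w * 1)).
  rewrite (_ : (fun x => _) = fun x => ((U x + V w) ^+ 2)%:E)//.
  by apply/funext => x; rewrite -[(U + _) x]/(U x + V w * 1) mulr1.
have -> : U = (U + V w *: one) - V w *: one by rewrite addrK.
auto.
Qed.

(** The second moment of U + V, computed with Tonelli's theorem over the product of
the laws, is compared with its expansion by bilinearity. *)
Lemma ip_indep U V : indep U V -> sqi P U -> sqi P V ->
  ip P U V = ip P U one * ip P V one.
Proof.
move=> UV sU sV; have [[mU _] [mV _]] := (sU, sV).
have mf : measurable_fun setT (fun x : R * R => ((x.2 + x.1) ^+ 2)%:E).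
  by apply/measurable_EFinP/measurable_funX; apply: measurable_funD;
    [exact: measurable_snd|exact: measurable_fst].
have h := ge0_integral_indep mU mV UV mf (fun x => sqr_ge0 _).
have sUV : sqi P (V + U) by auto.
have e : ip P (V + U) (V + U) = ip P U U + 2 * ip P V one * ip P U one + ip P V V.
  apply: EFin_inj; rewrite EFin_ip//.
  rewrite [LHS]h.
  pose g : T -> R := fun w => U w * U w + 2 * ip P V one * (U w * one w) +
    ip P V V * (one w * one w).
  rewrite (eq_integral (EFin \o g)); last first.
    move=> w _ /=.
    transitivity (\int[P]_x (((V + U w *: one) x) ^+ 2)%:E)%E.
      by apply: eq_integral => x _; rewrite -[(V + _) x]/(V x + U w * 1) mulr1.
    rewrite -EFin_ip; last by auto.
    by rewrite ip_sqr_shift// /g /one; congr EFin; ring.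
  have i1 := integrable_ip sU sU; have i2 := integrable_ip sU s1.
  have i3 := integrable_ip s1 s1.
  have i4 := integrableZl measurableT (2 * ip P V one) i2.
  have i5 := integrableZl measurableT (ip P V V) i3.
  have i14 := integrableD measurableT i1 i4.
  have ig := integrableD measurableT i14 i5.
  transitivity (\int[P]_w g w)%:E.
    by rewrite /Rintegral fineK//; exact: (integrable_fin_num measurableT ig).
  congr EFin; rewrite /g RintegralD// RintegralD//.
  rewrite RintegralZl// RintegralZl//.
  by rewrite -/(ip P U U) -/(ip P U one) -/(ip P one one) ip_cst; ring.
move: e; rewrite ipDl ?ipDr//; auto; rewrite [ip P V U]ipC.
lra.
Qed.

End independence.

Section additive_functions.
Variable R : realType.

(** A nonnegative additive function is nondecreasing, and n t lies between two
consecutive integers m and m + 1, so that n |f(t) - t f(1)| <= f(1). *)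
Lemma additive_ge0_linear (f : R -> R) :
  (forall s t, 0 <= s -> 0 <= t -> f (s + t) = f s + f t) ->
  (forall t, 0 <= t -> 0 <= f t) ->
  forall t, 0 <= t -> f t = t * f 1.
Proof.
move=> fD f0 t t0.
have fn n s : 0 <= s -> f (n%:R * s) = n%:R * f s.
  move=> s0; elim: n => [|n IH].
    by have := fD 0 0 (lexx _) (lexx _); rewrite !mul0r addr0; lra.
  by rewrite -natr1 !mulrDl !mul1r fD// ?IH// mulr_ge0.
have fle s u : 0 <= s -> s <= u -> f s <= f u.
  move=> s0 su; have := fD s (u - s) s0; rewrite subr_ge0 => /(_ su).
  by rewrite subrKC => ->; rewrite lerDl f0// subr_ge0.
have key (n : nat) : n%:R * `|f t - t * f 1| <= f 1.
  rewrite -[X in X * _]normr_nat -normrM.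
  have nt0 : 0 <= n%:R * t by rewrite mulr_ge0.
  have /andP[le1 lt1] := truncn_itv nt0.
  set m := Num.truncn _ in le1 lt1.
  have h1 := fle _ _ (ler0n _ m) le1.
  have h2 := fle _ _ nt0 (ltW lt1).
  have := fn m 1 ler01; have := fn m.+1 1 ler01; have := fn n t t0.
  rewrite !mulr1 => e1 e2 e3; rewrite e1 e3 in h1; rewrite e1 e2 in h2.
  have f1 := f0 _ ler01.
  rewrite -natr1 in h2 lt1.
  rewrite ler_norml; apply/andP; split; nra.
apply/eqP; rewrite -subr_eq0 -normr_eq0; apply/negPn/negP => ne.
have ne0 : 0 < `|f t - t * f 1| by rewrite lt_def ne normr_ge0.
have := key (Num.truncn (f 1 / `|f t - t * f 1|)).+1.
rewrite leNgt -ltr_pdivrMr//.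
by rewrite truncnS_gt.
Qed.

(** An additive f with f(1) = 0 is 1-periodic; being bounded on an interval, it
is bounded, which excludes |f(n t)| = n |f(t)| unless f(t) = 0. *)
Lemma additive_bounded_eq0 (f : R -> R) (e : R) : 0 < e ->
  (forall s t, 0 <= s -> 0 <= t -> f (s + t) = f s + f t) ->
  (forall t, 0 <= t <= e -> `|f t| <= 1) -> f 1 = 0 ->
  forall t, 0 <= t -> f t = 0.
Proof.
move=> e0 fD fb f1 t t0.
have fn n s : 0 <= s -> f (n%:R * s) = n%:R * f s.
  move=> s0; elim: n => [|n IH].
    by have := fD 0 0 (lexx _) (lexx _); rewrite !mul0r addr0; lra.
  by rewrite -natr1 !mulrDl !mul1r fD// ?IH// mulr_ge0.
pose N := (Num.truncn e^-1).+1.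
have N0 : 0 < N%:R :> R by rewrite ltr0n.
have Ne : N%:R^-1 <= e.
  by rewrite -[leRHS]invrK lef_pV2 ?posrE ?invr_gt0// ltW// truncnS_gt.
have b1 r : 0 <= r <= 1 -> `|f r| <= N%:R.
  move=> /andP[r0 r1].
  have -> : r = N%:R * (r / N%:R) by rewrite mulrCA divff ?mulr1// gt_eqF.
  rewrite fn ?divr_ge0// normrM normr_nat ler_piMr//.
  apply: fb; rewrite divr_ge0//=; apply: le_trans Ne.
  by rewrite -[leRHS]mul1r ler_wpM2r// invr_ge0.
have key (n : nat) : n%:R * `|f t| <= N%:R.
  have nt0 : 0 <= n%:R * t by rewrite mulr_ge0.
  have /andP[le1 lt1] := truncn_itv nt0.
  set m := Num.truncn _ in le1 lt1.
  rewrite -[X in X * _]normr_nat -normrM -fn//.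
  have -> : n%:R * t = m%:R * 1 + (n%:R * t - m%:R) by ring.
  rewrite fD ?mulr1 ?subr_ge0//.
  have := fn m 1 ler01; rewrite mulr1 => ->; rewrite f1 mulr0 add0r.
  by apply: b1; rewrite subr_ge0 le1/= lerBlDr addrC natr1 ltW.
apply/eqP; rewrite -normr_eq0; apply/negPn/negP => ne.
have ne0 : 0 < `|f t| by rewrite lt_def ne normr_ge0.
have := key (Num.truncn (N%:R / `|f t|)).+1.
by rewrite leNgt -ltr_pdivrMr// truncnS_gt.
Qed.

End additive_functions.

Section scalar_levy.
Context d (T : measurableType d) (R : realType) (P : probability T R).
Variable W : R -> T -> R.
Let one : T -> R := fun=> 1.
Hypothesis mW : forall t, 0 <= t -> measurable_fun setT (W t).
Hypothesis W0 : W 0 = 0.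
Hypothesis W_indep : forall s t, 0 <= s -> 0 <= t ->
  indep P (W s) (W (s + t) - W s).
Hypothesis W_law : forall s t, 0 <= s -> 0 <= t ->
  eq_law P (W (s + t) - W s) (W t).
Hypothesis W_cont : forall e : R, 0 < e ->
  P [set w | e < `|W t w|] @[t --> within [set t | 0 <= t] (nbhs (0 : R))] --> 0%E.
Hypothesis W1 : sqi P (W 1).
Hypothesis W1_mean : ip P (W 1) one = 0.

Let s1 : sqi P one := sqi_cst P 1.
#[local] Hint Resolve sqi0 sqiD sqiB sqiN sqiZ s1 : core.

(** For an integer n >= t, W n is a sum of independent copies of W 1, hence is square
integrable, and W t is an independent summand of W n. *)
Lemma sqi_levy t : 0 <= t -> sqi P (W t).
Proof.
have mD s u : 0 <= s -> 0 <= u -> measurable_fun setT (W (s + u) - W s).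
  by move=> s0 u0; apply: measurable_funB; apply: mW => //; exact: addr_ge0.
have Wn (n : nat) : sqi P (W n%:R).
  elim: n => [|n IH]; first by rewrite W0.
  rewrite -natr1; have -> : W (n%:R + 1) = W n%:R + (W (n%:R + 1) - W n%:R).
    by rewrite subrKC.
  apply: sqiD => //; apply: (sqi_eq_law (U := W 1)) => //; first exact: mD.
  by move=> A mA; rewrite W_law.
move=> t0; pose n := (Num.truncn t).+1.
have tn : 0 <= n%:R - t by rewrite subr_ge0 ltW// truncnS_gt.
apply: (sqi_indep_summand (V := W (t + (n%:R - t)) - W t)) => //.
- exact: mW.
- exact: mD.
- exact: W_indep.
- by rewrite !subrKC.
Qed.

Let m t := ip P (W t) one.
Let q t := ip P (W t) (W t).

Let mD s t : 0 <= s -> 0 <= t -> m (s + t) = m s + m t.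
Proof.
move=> s0 t0; have ss := sqi_levy s0; have st := sqi_levy t0.
have sst := sqi_levy (addr_ge0 s0 t0).
have [_ e] := ip_eq_law (W_law s0 t0) (sqiB sst ss) st.
by rewrite {3}/m -e ipBl// subrKC.
Qed.

Let qD s t : 0 <= s -> 0 <= t -> q (s + t) = q s + q t + 2 * (m s * m t).
Proof.
move=> s0 t0; have ss := sqi_levy s0; have st := sqi_levy t0.
have sst := sqi_levy (addr_ge0 s0 t0).
have [e1 e2] := ip_eq_law (W_law s0 t0) (sqiB sst ss) st.
have := ip_indep (W_indep s0 t0) ss (sqiB sst ss).
rewrite e2 -/(m s) -/(m t) => h.
rewrite /q -e1 -h !ipBl ?ipBr//; auto.
by rewrite [ip P (W s) (W (s + t))]ipC; ring.
Qed.

Let v t := q t - m t ^+ 2.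

Let v_ge0 t : 0 <= t -> 0 <= v t.
Proof.
move=> t0; have st := sqi_levy t0.
have := ip_ge0 P (W t + (- m t) *: one).
by rewrite ip_sqr_shift// -/(q t) -/(m t) /v; nra.
Qed.

Let vE t : 0 <= t -> v t = t * q 1.
Proof.
move=> t0; rewrite (@additive_ge0_linear _ v)//.
  by rewrite {1}/v {1}/m W1_mean expr0n subr0.
by move=> s u s0 u0; rewrite /v qD// mD//; ring.
Qed.

(* Chebyshev: near 0 the centred variable W t - m t is small in probability,
   and so is W t; hence m t is small *)
Let m_small : exists2 e : R, 0 < e & forall t, 0 <= t <= e -> `|m t| <= 1.
Proof.
have half0 : 0 < 2^-1 :> R by rewrite invr_gt0.
have := W_cont half0.
move=> /fine_cvgP[_ /cvgrPdist_lt/(_ _ half0)].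
rewrite near_withinE => -[e /= e0 He].
have q1 : 0 <= q 1 by exact: ip_ge0.
have q1' : 0 < 8 * (q 1 + 1) by rewrite mulr_gt0// ltr_wpDl.
exists (Num.min (e / 2) (8 * (q 1 + 1))^-1).
  by rewrite lt_min divr_gt0//= invr_gt0.
move=> t /andP[t0]; rewrite le_min => /andP[te tq].
have st := sqi_levy t0; have [mWt _] := st.
have vt : v t < 8^-1.
  rewrite vE//; apply: (@le_lt_trans _ _ ((8 * (q 1 + 1))^-1 * q 1)).
    by rewrite ler_wpM2r.
  rewrite mulrC ltr_pdivrMr//; lra.
pose A := [set w | 2^-1 < `|W t w|].
have mA : measurable A.
  rewrite [A](_ : _ = [set: T] `&` (Num.norm \o W t) @^-1` `]2^-1, +oo[); last first.
    by apply/seteqP; split=> w /=; rewrite in_itv/= andbT; [split|case].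
  apply: (measurableT_comp (@normr_measurable R setT) mWt) => //.
have PA : fine (P A) < 2^-1.
  have te' : ball_ Num.norm 0 e t.
    rewrite /= sub0r normrN ger0_norm// (le_lt_trans te)//.
    by rewrite ltr_pdivrMr// ltr_pMr// ltr1n.
  by have := He t te' t0; rewrite sub0r normrN ger0_norm ?fine_ge0.
rewrite leNgt; apply/negP => mt1.
have : ((4^-1 : R)%:E * P (~` A) <= (v t)%:E)%E.
  have -> : v t = ip P (W t + (- m t) *: one) (W t + (- m t) *: one).
    by rewrite ip_sqr_shift// -/(q t) -/(m t) /v; ring.
  rewrite EFin_ip; last by auto.
  rewrite -(setIT (~` A)) -integral_indic//; last exact: measurableC.
  rewrite -ge0_integralZl//=; last first.
    by apply/measurable_EFinP; apply: measurable_indic; exact: measurableC.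
  apply: ge0_le_integral => //.
  - apply: emeasurable_funM => //; apply/measurable_EFinP.
    by apply: measurable_indic; exact: measurableC.
  - apply/measurable_EFinP/measurable_funX; apply: measurable_funD => //.
    exact: (measurable_cst (- m t * 1)).
  move=> w _; rewrite -EFinM lee_fin -[(W t + _) w]/(W t w + - m t * 1) indicE.
  have [wA|wA] := boolP (w \in ~` A); last by rewrite mulr0 sqr_ge0.
  rewrite mulr1 mulr1; move: wA; rewrite inE /A /= => /negP; rewrite -leNgt => Ww.
  have h : 2^-1 <= `|W t w - m t|.
    rewrite distrC (le_trans _ (lerB_dist _ _))//; lra.
  rewrite -real_normK ?num_real//; nra.
rewrite probability_setC// -(fineK (fin_num_measure P A mA)).
rewrite -EFinB -EFinM lee_fin => h; lra.
Qed.

(** The mean is additive in t and bounded near 0. *)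
Lemma levy_mean t : 0 <= t -> ip P (W t) one = 0.
Proof.
move=> t0; have [e e0 me] := m_small.
exact: (additive_bounded_eq0 e0 mD me W1_mean).
Qed.

(** The variance is additive in t and nonnegative, hence linear. *)
Lemma levy_variance t : 0 <= t -> ip P (W t) (W t) = t * ip P (W 1) (W 1).
Proof.
move=> t0; have := vE t0; rewrite /v /m levy_mean// expr0n subr0; exact.
Qed.

End scalar_levy.

(** * Covariances of a vector-valued Levy process *)

Section one_sided.
Context d (T : measurableType d) (R : realType) (P : probability T R).
Let one : T -> R := fun=> 1.
Let s1 : sqi P one := sqi_cst P 1.
#[local] Hint Resolve sqi0 sqiD sqiB sqiN sqiZ s1 : core.

Definition coord n (L : R -> T -> 'cV[R]_n) (t : R) (i : 'I_n) : T -> R :=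
  fun w => L t w i 0.

Lemma borel_preimage n (f : 'cV[R]_n -> R) (A : set R) :
  continuous f -> measurable A -> borel (f @^-1` A).
Proof.
move=> cf mA.
pose f' : g_sigma_algebraType (@open 'cV[R]_n) -> R := f.
suff : measurable_fun setT f' by move=> /(_ measurableT A mA); rewrite setTI.
apply: (measurability _ (RGenOInfty.measurableE R)) => _ [_ [x ->] <-].
rewrite setTI; apply: sub_sigma_algebra.
by move/continuousP : cf; apply; exact: interval_open.
Qed.

Lemma continuous_mulmx_entry n (u : 'rV[R]_n) :
  continuous (fun x : 'cV[R]_n => (u *m x) 0 0).
Proof.
have -> : (fun x : 'cV[R]_n => (u *m x) 0 0) =
    \sum_i (fun x : 'cV[R]_n => u 0 i * x i 0).
  by apply/funext => y; rewrite mxE fct_sumE.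
apply: (big_ind (fun f : 'cV[R]_n -> R => continuous f)) => [x|f g cf cg x|i _ x].
- exact: cst_continuous.
- by apply: continuousD; [exact: cf|exact: cg].
- by apply: continuousM; [exact: cst_continuous|exact: coord_continuous].
Qed.

(** Linear functionals of the increments are increments of scalar Levy processes;
polarization then recovers the joint moments of the coordinates. *)
Definition lin_incr n (L : R -> T -> 'cV[R]_n) (u : 'rV[R]_n) (s t : R) : T -> R :=
  fun w => (u *m (L t w - L s w)) 0 0.

Section moments.
Variables (n : nat) (L : R -> T -> 'cV[R]_n).
Hypothesis hL : one_sided_levy P L.

Local Notation incr := (lin_incr L).

Let incrE u s t : incr u s t = \sum_i u 0 i *: (coord L t i - coord L s i).
Proof.
apply/funext => w; rewrite /lin_incr mxE fct_sumE; apply: eq_bigr => i _.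
by rewrite !mxE.
Qed.

Let measurable_incr u s t : 0 <= s -> 0 <= t -> measurable_fun setT (incr u s t).
Proof.
move=> s0 t0; rewrite incrE.
rewrite (_ : \sum_i _ = fun w => \sum_i u 0 i * (L t w i 0 - L s w i 0)).
  apply: measurable_sum => i; apply: measurable_funM; first exact: measurable_cst.
  by apply: measurable_funB; exact: levy_measurable hL _ _ i.
by apply/funext => w; rewrite fct_sumE.
Qed.

Let incr_indep u v s t : 0 <= s -> 0 <= t ->
  indep P (incr u 0 s) (incr v s (s + t)).
Proof.
move=> s0 t0 A B mA mB.
pose tt (m : nat) := if m == 0%N then 0 else if m == 1%N then s else s + t.
pose BB (m : nat) := if m == 0%N then (fun x : 'cV[R]_n => (u *m x) 0 0) @^-1` A
  else (fun x : 'cV[R]_n => (v *m x) 0 0) @^-1` B.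
have tt_mono : {homo tt : i j / (i <= j)%N >-> i <= j}.
  move=> [|[|i]] [|[|j]]//= _; rewrite /tt /=; rewrite ?lexx ?addr_ge0 ?lerDl//.
have bB i : borel (BB i).
  by rewrite /BB; case: ifP => _; apply: borel_preimage => //;
    exact: continuous_mulmx_entry.
have := levy_indep_incr hL 2 (lexx _ : 0 <= tt 0%N) tt_mono bB.
rewrite !big_ord_recl big_ord0 mule1 /= => <-; congr (P _).
apply/seteqP; split => [w [wA wB] [|[|i]]//|w h].
by split; [have := h 0%N erefl|have := h 1%N erefl].
Qed.

Let incr_law u s t : 0 <= s -> 0 <= t ->
  eq_law P (incr u s (s + t)) (incr u 0 t).
Proof.
move=> s0 t0 A mA.
exact: (levy_stat_incr hL s0 t0 (borel_preimage (@continuous_mulmx_entry n u) mA)).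
Qed.

Let incr0 u : incr u 0 0 = 0.
Proof. by apply/funext => w; rewrite /lin_incr subrr mulmx0 mxE. Qed.

Let incrB u s t : incr u 0 t - incr u 0 s = incr u s t.
Proof.
apply/funext => w; rewrite /lin_incr -[LHS]/((u *m _) 0 0 - (u *m _) 0 0).
by rewrite !mxE -sumrB; apply: eq_bigr => i _; rewrite !mxE; ring.
Qed.

Let incr_cont u (e : R) : 0 < e ->
  P [set w | e < `|incr u 0 t w|] @[t --> within [set t | 0 <= t] (nbhs (0 : R))]
    --> 0%E.
Proof.
move=> e0.
pose c := 1 + \sum_i `|u 0 i|.
have c0 : 0 < c by rewrite ltr_pwDl// sumr_ge0.
have h := levy_stoch_cont hL (lexx (0 : R)) (divr_gt0 e0 c0).
have mnorm t (a : R) : 0 <= t -> 0 < a ->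
    measurable [set w | a < `|L t w - L 0 w|].
  move=> t0 a0; rewrite (_ : [set _ | _] =
      \bigcup_(i : 'I_n) [set w | a < `|L t w i 0 - L 0 w i 0|]).
    apply: countable_bigcupT_measurable => // i.
    rewrite -[X in measurable X]setTI.
    have mi : measurable_fun setT (fun w => `|L t w i 0 - L 0 w i 0|).
      apply: (measurableT_comp (@normr_measurable R setT)).
      by apply: measurable_funB; exact: levy_measurable hL _ _ i.
    have := mi measurableT `]a, +oo[%classic (measurable_itv _).
    by congr (measurable (_ `&` _)); apply/seteqP; split=> w /=; rewrite in_itv/= andbT.
  apply/seteqP; split => w /=.
    rewrite [X in _ < X]mx_normrE => /bigmax_gtP[|[[i j] _ /= aij]].
      by move=> /lt_trans/(_ a0); rewrite ltxx.
    by exists i => //; move: aij; rewrite !mxE (ord1 j).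
  move=> [i _ /= ai]; rewrite [X in _ < X]mx_normrE; apply/bigmax_gtP.
  by right; exists (i, 0) => //=; rewrite !mxE.
apply: (@squeeze_cvge _ _ _ _ (fun=> 0%E) _ _ _ _ _ h); last exact: cvg_cst.
rewrite near_withinE; apply: nearW => t t0; rewrite measure_ge0/=.
apply: le_measure; rewrite ?inE.
- rewrite -[X in measurable X]setTI.
  have mi : measurable_fun setT (fun w => `|incr u 0 t w|).
    by apply: (measurableT_comp (@normr_measurable R setT)); exact: measurable_incr.
  have := mi measurableT `]e, +oo[%classic (measurable_itv _).
  by congr (measurable (_ `&` _)); apply/seteqP; split=> w /=; rewrite in_itv/= andbT.
- by apply: mnorm => //; exact: divr_gt0.
move=> w /= ew; rewrite ltr_pdivrMr//; apply: lt_le_trans ew _.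
rewrite /lin_incr mxE (le_trans (ler_norm_sum _ _ _))//.
apply: (@le_trans _ _ (\sum_i `|L t w - L 0 w| * `|u 0 i|)).
  apply: ler_sum => i _; rewrite normrM mulrC ler_wpM2r//.
  rewrite [leRHS]mx_normrE.
  exact: (le_bigmax _ (fun ij : 'I_n * 'I_1 => `|(L t w - L 0 w) ij.1 ij.2|) (i, 0)).
by rewrite -mulr_sumr ler_wpM2l// lerDr.
Qed.

Hypothesis L1_sqi : forall i, sqi P (coord L 1 i).
Hypothesis L1_mean : forall i, ip P (coord L 1 i) one = 0.

Let null_L0 i : null P (coord L 0 i).
Proof.
apply: null_ae; first exact: levy_measurable hL _ (lexx _) i.
by apply: filterS (levy_init hL) => w; rewrite /coord => ->; rewrite mxE.
Qed.

Let incr1E u : incr u 0 1 = \sum_i u 0 i *: (coord L 1 i - coord L 0 i).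
Proof. exact: incrE. Qed.

Let sqi_incr1 u : sqi P (incr u 0 1).
Proof.
rewrite incr1E; apply: sqi_sum => i.
by apply/sqiZ/sqiB => //; have [] := null_L0 i.
Qed.

Let incr1_mean u : ip P (incr u 0 1) one = 0.
Proof.
have sL0 i : sqi P (coord L 0 i) by have [] := null_L0 i.
rewrite incr1E ip_suml => [|i|]; rewrite ?big1//; auto => i _.
rewrite ipZl ?ipBl ?L1_mean//; auto.
by rewrite (ip_null (sL0 i) s1 (proj2 (null_L0 i))) subrr mulr0.
Qed.

Let delta i : 'rV[R]_n := delta_mx 0 i.

Let incr_delta i s t : incr (delta i) s t = coord L t i - coord L s i.
Proof.
apply/funext => w; rewrite /lin_incr -rowE !mxE//.
Qed.

Let sqi_incr u t : 0 <= t -> sqi P (incr u 0 t).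
Proof.
apply: (@sqi_levy _ _ _ _ (incr u 0)) => [s s0||||]//.
- exact: measurable_incr.
- by move=> s r s0 r0; rewrite incrB; exact: incr_indep.
- by move=> s r s0 r0; rewrite incrB; exact: incr_law.
Qed.

Let incr_mean u t : 0 <= t -> ip P (incr u 0 t) one = 0.
Proof.
apply: (@levy_mean _ _ _ _ (incr u 0)) => [s s0|||e e0|||]//.
- exact: measurable_incr.
- by move=> s r s0 r0; rewrite incrB; exact: incr_indep.
- by move=> s r s0 r0; rewrite incrB; exact: incr_law.
- exact: incr_cont.
Qed.

Let incr_variance u t : 0 <= t ->
  ip P (incr u 0 t) (incr u 0 t) = t * ip P (incr u 0 1) (incr u 0 1).
Proof.
apply: (@levy_variance _ _ _ _ (incr u 0)) => [s s0|||e e0|||]//.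
- exact: measurable_incr.
- by move=> s r s0 r0; rewrite incrB; exact: incr_indep.
- by move=> s r s0 r0; rewrite incrB; exact: incr_law.
- exact: incr_cont.
Qed.

Lemma one_sided_sqi t i : 0 <= t -> sqi P (coord L t i).
Proof.
move=> t0; have := sqi_incr (delta i) t0; rewrite incr_delta => h.
by rewrite -[coord L t i](subrK (coord L 0 i)); apply: sqiD => //; have [] := null_L0 i.
Qed.

Let null_incr t i : 0 <= t -> null P (coord L t i - incr (delta i) 0 t).
Proof. by move=> t0; rewrite incr_delta subKr. Qed.

Lemma one_sided_mean t i : 0 <= t -> ip P (coord L t i) one = 0.
Proof.
move=> t0; rewrite (ip_nulll (one_sided_sqi i t0) (null_incr i t0) s1).
exact: incr_mean.
Qed.

Let incr_addu u v s t : incr (u + v) s t = incr u s t + incr v s t.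
Proof. by apply/funext => w; rewrite /lin_incr mulmxDl mxE. Qed.

Let incr_cov u v t : 0 <= t ->
  ip P (incr u 0 t) (incr v 0 t) = t * ip P (incr u 0 1) (incr v 0 1).
Proof.
move=> t0; have := incr_variance (u + v) t0; rewrite !incr_addu.
have su := sqi_incr u t0; have sv := sqi_incr v t0.
have su1 := sqi_incr u ler01; have sv1 := sqi_incr v ler01.
rewrite !ipDl ?ipDr//; [|exact: sqiD|exact: sqiD].
rewrite (incr_variance u t0) (incr_variance v t0).
have e1 := ipC P (incr v 0 t) (incr u 0 t).
have e2 := ipC P (incr v 0 1) (incr u 0 1).
rewrite e1 e2.
have polar (a b x y : R) : t * a + x + (x + t * b) = t * (a + y + (y + b)) ->
    x = t * y by lra.
exact: polar.
Qed.

Let incr_cov_le u v s t : 0 <= s -> s <= t ->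
  ip P (incr u 0 s) (incr v 0 t) = s * ip P (incr u 0 1) (incr v 0 1).
Proof.
move=> s0 st; have t0 := le_trans s0 st.
have ss := sqi_incr u s0; have sv := sqi_incr v s0; have sv' := sqi_incr v t0.
have h : indep P (incr u 0 s) (incr v 0 t - incr v 0 s).
  rewrite incrB; have := @incr_indep u v s (t - s) s0; rewrite subrKC; apply.
  by rewrite subr_ge0.
have sB := sqiB sv' sv.
rewrite -(incr_cov u v s0) -[incr v 0 t](subrKC (incr v 0 s)) ipDr//.
by rewrite (ip_indep h ss sB) (incr_mean u s0) mul0r addr0.
Qed.

(** The increment of L_j after time s is centred and independent of L_i(s). *)
Lemma one_sided_cov s t i j : 0 <= s -> 0 <= t ->
  ip P (coord L s i) (coord L t j) =
  Num.min s t * ip P (coord L 1 i) (coord L 1 j).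
Proof.
move=> s0 t0.
have toi a b s' t' : 0 <= s' -> 0 <= t' -> ip P (coord L s' a) (coord L t' b) =
    ip P (incr (delta a) 0 s') (incr (delta b) 0 t').
  move=> ? ?.
  rewrite (ip_nulll (one_sided_sqi _ _) (null_incr _ _) (one_sided_sqi _ _))//.
  by rewrite (ip_nullr (one_sided_sqi _ _) (null_incr _ _) (sqi_incr _ _)).
rewrite !toi//; have [st|ts] := leP s t; first exact: incr_cov_le.
rewrite ipC [in RHS]ipC; exact/incr_cov_le/ltW.
Qed.

End moments.
End one_sided.

Section indicator_functions.
Variable R : realType.
Local Notation mu := (@lebesgue_measure R).

Lemma sqi_indic_itv (a b : R) : sqi mu (\1_`]a, b] : R -> R).
Proof.
split; first exact: measurable_indic.
have -> : (\int[mu]_x ((\1_`]a, b] x ^+ 2)%:E) = \int[mu]_x (\1_`]a, b] x)%:E)%E.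
  apply: eq_integral => x _.
  by rewrite indicE; case: (_ \in _); rewrite ?expr0n ?expr1n.
have -> : (\int[mu]_x (\1_`]a, b] x)%:E = mu `]a, b])%E.
  by rewrite integral_indic// setIT.
rewrite lebesgue_measure_itv/=.
by case: ifP => _; rewrite ?ltry// -EFinB ltry.
Qed.

Lemma ip_indic_itv (a b c e : R) :
  ip mu (\1_`]a, b] : R -> R) (\1_`]c, e] : R -> R) =
  Num.max 0 (Num.min b e - Num.max a c).
Proof.
have -> : ip mu (\1_`]a, b] : R -> R) (\1_`]c, e] : R -> R) =
    fine (mu `]Num.max a c, Num.min b e]).
  rewrite /ip /Rintegral; congr fine.
  rewrite -[X in mu X]setIT -integral_indic//; apply: eq_integral => x _.
  rewrite !indicE -natrM mulnb -in_setI; congr ((_ \in _)%:R%:E).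
  apply/seteqP; split => y /=; rewrite !in_itv/= gt_max le_min.
    by move=> [/andP[-> ->] /andP[-> ->]].
  by move=> /andP[/andP[-> ->] /andP[-> ->]].
rewrite lebesgue_measure_itv/= lte_fin; case: ltP => h.
  by rewrite [RHS]max_r//= subr_ge0 ltW.
by rewrite [RHS]max_l// subr_le0.
Qed.

(** The integrand with Levy integral L(t) - L(0), for t of either sign. *)
Definition chi (t : R) : R -> R := \1_`]0, t] - \1_`]t, 0].

Lemma sqi_chi t : sqi mu (chi t).
Proof. by apply: sqiB; exact: sqi_indic_itv. Qed.

Lemma chiB s t : s <= t -> chi t - chi s = \1_`]s, t].
Proof.
move=> st; apply/funext => u.
rewrite -[LHS]/((\1_`]0, t] u - \1_`]t, 0] u) - (\1_`]0, s] u - \1_`]s, 0] u)).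
rewrite !indicE !mem_setE !in_itv/=.
case: (ltP 0 u) => u0; case: (leP u t) => ut; case: (leP u s) => us;
  rewrite /= ?andbT ?andbF /=; try lra.
Qed.

Lemma ip_chi s t : ip mu (chi s) (chi t) =
  if (0 <= s) && (0 <= t) then Num.min s t
  else if (s < 0) && (t < 0) then Num.min (- s) (- t) else 0.
Proof.
have c0 r : 0 <= r -> chi r = \1_`]0, r].
  move=> r0; apply/funext => x; rewrite -[LHS]/(\1_`]0, r] x - \1_`]r, 0] x).
  rewrite [X in _ - X]indicE mem_setE in_itv/=.
  by case: ltP => //= rx; [rewrite leNgt (le_lt_trans r0)// subr0|rewrite subr0].
have c1 r : r < 0 -> chi r = - \1_`]r, 0].
  move=> r0; apply/funext => x; rewrite -[LHS]/(\1_`]0, r] x - \1_`]r, 0] x).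
  rewrite [X in X - _]indicE mem_setE in_itv/=.
  case: ltP => //= rx; last by rewrite sub0r.
  by rewrite leNgt (lt_trans r0)//= sub0r.
have si a b : sqi mu (\1_`]a, b] : R -> R) by exact: sqi_indic_itv.
have [s0|s0] := leP 0 s; have [t0|t0] := leP 0 t => /=.
- rewrite !c0// ip_indic_itv maxxx subr0 max_r// le_min s0 t0//.
- rewrite c0// c1// ipNr// ip_indic_itv max_l ?oppr0//.
  by rewrite subr_le0 le_max ge_min lexx orbT.
- rewrite c1// c0// ipNl// ip_indic_itv max_l ?oppr0//.
  by rewrite subr_le0 le_max !ge_min lexx !orbT.
- rewrite !c1// ipNl ?ipNr ?opprK//; last exact: sqiN.
  by rewrite ip_indic_itv minxx sub0r oppr_max max_r// le_min !oppr_ge0 !ltW.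
Qed.

End indicator_functions.

Section two_sided.
Context d (T : measurableType d) (R : realType) (P : probability T R).
Let one : T -> R := fun=> 1.
Let s1 : sqi P one := sqi_cst P 1.
Variables (n : nat) (L : R -> T -> 'cV[R]_n).
Hypothesis hL : two_sided_levy P L.
Hypothesis hc : levy_centered P L.
Hypothesis h2 : levy_square_integrable P L.

Let mL t i : measurable_fun setT (coord L t i).
Proof. exact: levy2_measurable hL _ i. Qed.

Let sqi_L1 i : sqi P (coord L 1 i).
Proof.
split => //; apply: le_lt_trans h2; rewrite unlock; apply: ge0_le_integral => //.
- by move=> w _; rewrite lee_fin sqr_ge0.
- by apply/measurable_EFinP/measurable_funX.
- apply/measurable_EFinP; rewrite /sqnorm.
  apply: measurable_sum => a; apply: measurable_sum => b.
  by rewrite (ord1 b); apply: measurable_funX; exact: mL.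
move=> w _; rewrite lee_fin /sqnorm (bigD1 i)//= big_ord1 lerDl.
by apply: sumr_ge0 => a _; rewrite big_ord1 sqr_ge0.
Qed.

Let mean_L1 i : ip P (coord L 1 i) one = 0.
Proof.
have := hc i; rewrite unlock => h.
rewrite /ip /Rintegral -[RHS]/(fine 0%E) -h; congr fine.
by apply: eq_integral => w _; rewrite mulr1.
Qed.

Lemma Sigma_LE i j : Sigma_L P L i j = ip P (coord L 1 i) (coord L 1 j).
Proof.
rewrite mxE unlock /ip /Rintegral; congr fine; apply: eq_integral => w _.
by rewrite mxE big_ord1 mxE.
Qed.

(** At negative times, L(s) is minus the left limit at -s of the independent copy
L2; since L2 is mean-square continuous, this is almost surely
- L2(-s). Hence L(s) and L(t) are uncorrelated when s and t have opposite signs,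
as are the indicator functions chi. *)
Lemma levy_cov t i : sqi P (coord L t i) /\
  forall s j, ip P (coord L s i) (coord L t j) =
     Sigma_L P L i j * ip lebesgue_measure (chi s) (chi t).
Proof.
have [L1 [L2 [h1 h2' hi hl hae]]] := levy2_decomp hL.
have nul1 s a : 0 <= s -> null P (coord L s a - coord L1 s a).
  move=> s0; apply: null_ae; first by apply: measurable_funB => //;
    exact: levy_measurable h1 _ s0 a.
  apply: filterS hae => w [hw _].
  by rewrite -[LHS]/(L s w a 0 - L1 s w a 0) hw// subrr.
have sL1 a : sqi P (coord L1 1 a) by exact: null_sqi (sqi_L1 a) (nul1 _ _ ler01).
have mL1 a : ip P (coord L1 1 a) one = 0.
  by rewrite -(ip_nulll (sqi_L1 a) (nul1 1 a ler01) s1).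
have law (u : 'rV[R]_n) : eq_law P (fun w => (u *m L1 1 w) 0 0) (fun w => (u *m L2 1 w) 0 0).
  move=> A mA.
  have := hl 1%N (fun=> 1) (fun=> (fun x : 'cV[R]_n => (u *m x) 0 0) @^-1` A).
  move=> /(_ (fun _ => ler01)
    (fun _ => borel_preimage (@continuous_mulmx_entry R n u) mA)) h.
  have e (M : T -> 'cV[R]_n) : \bigcap_(i : 'I_1) (M @^-1`
      ((fun x : 'cV[R]_n => (u *m x) 0 0) @^-1` A)) =
      (fun w => (u *m M w) 0 0) @^-1` A.
    by apply/seteqP; split => [w /(_ 0 I)//|w hw i' _].
  by rewrite !e in h.
pose S a b := ip P (coord L 1 a) (coord L 1 b).
have S1 a b : ip P (coord L1 1 a) (coord L1 1 b) = S a b.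
  have n1 c := nul1 1 c ler01.
  by rewrite -(ip_nulll (sqi_L1 a) (n1 a) (sL1 b)) -(ip_nullr (sqi_L1 b) (n1 b) (sqi_L1 a)).
have dl (M : T -> 'cV[R]_n) a :
    (fun w => ((delta_mx 0 a : 'rV[R]_n) *m M w) 0 0) = (fun w => M w a 0).
  by apply/funext => w; rewrite -rowE mxE.
have mL2 a : measurable_fun setT (coord L2 1 a).
  exact: levy_measurable h2' _ ler01 a.
have sL2 a : sqi P (coord L2 1 a).
  apply: (sqi_eq_law (U := coord L1 1 a)) => //.
  by have := law (delta_mx 0 a); rewrite !dl.
have mean2 a : ip P (coord L2 1 a) one = 0.
  have := law (delta_mx 0 a); rewrite !dl => h.
  by have [_ e] := ip_eq_law h (sL1 a) (sL2 a); rewrite -[LHS]e; exact: mL1.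
have q2 a : ip P (coord L2 1 a) (coord L2 1 a) = S a a.
  have := law (delta_mx 0 a); rewrite !dl => h.
  by have [e _] := ip_eq_law h (sL1 a) (sL2 a); rewrite -[LHS]e; exact: S1.
have S2 a b : ip P (coord L2 1 a) (coord L2 1 b) = S a b.
  have dl2 (M : T -> 'cV[R]_n) : (fun w => (((delta_mx 0 a : 'rV[R]_n) + delta_mx 0 b) *m M w) 0 0)
      = (fun w => M w a 0) + (fun w => M w b 0).
    by apply/funext => w; rewrite mulmxDl mxE -!rowE !mxE.
  have := law ((delta_mx 0 a : 'rV[R]_n) + delta_mx 0 b); rewrite !dl2 => h.
  have {}h : eq_law P (coord L1 1 a + coord L1 1 b) (coord L2 1 a + coord L2 1 b).
    exact: h.
  have sD1 := sqiD (sL1 a) (sL1 b); have sD2 := sqiD (sL2 a) (sL2 b).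
  have [+ _] := ip_eq_law h sD1 sD2.
  rewrite !ipDl// !ipDr// !S1 !q2 [ip P (coord L2 1 b) _]ipC.
  have -> : S b a = S a b by exact: ipC.
  lra.
have cov1 := one_sided_cov h1 sL1 mL1; have cov2 := one_sided_cov h2' sL2 mean2.
have sq1 := one_sided_sqi h1 sL1; have sq2 := one_sided_sqi h2' sL2.
have nul2 s a : s < 0 -> null P (- coord L s a - coord L2 (- s) a).
  move=> s0; pose s_ (m : nat) := - s - (- s) * m.+1%:R^-1.
  have ns0 : 0 < - s by rewrite oppr_gt0.
  have s_0 m : 0 <= s_ m.
    by rewrite subr_ge0 ler_piMr ?(ltW ns0)// invf_le1 ?ltr0n// ler1n.
  have s_s m : s_ m < - s by rewrite ltrBlDr ltrDl mulr_gt0// invr_gt0.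
  have s_cvg : s_ m @[m --> \oo] --> - s.
    rewrite -[X in _ --> X]subr0; apply: cvgB; first exact: cvg_cst.
    rewrite -[X in _ --> X](mulr0 (- s)); apply: cvgM; first exact: cvg_cst.
    exact: cvg_harmonic.
  apply: (null_ae_cvg (f_ := fun m => coord L2 (s_ m) a)).
  - by move=> m; exact: sq2.
  - exact: measurableT_comp (mL s a).
  - by apply: sq2; exact: ltW.
  - apply: filterS hae => w [_ /(_ s s0) hw].
    have hw' : (L2 (s_ m) w @[m --> \oo] --> - L s w).
      apply: cvg_trans hw => A [e /= e0 eA]; move/cvgrPdist_lt : s_cvg => /(_ e e0).
      by apply: filterS => m me; exact: eA (s_s m).
    have -> : (- coord L s a) w = (- L s w) a 0 by rewrite mxE.
    exact: (cvg_comp _ _ hw' (@coord_continuous _ _ _ a 0 (- L s w))).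
  have -> : (fun m => ip P (coord L2 (s_ m) a - coord L2 (- s) a)
      (coord L2 (s_ m) a - coord L2 (- s) a)) = fun m => (- s - s_ m) * S a a.
    apply/funext => m; have := ltW (s_s m) => sm.
    have a1 := sq2 _ a (s_0 m); have a2 := sq2 _ a (ltW ns0).
    rewrite ipBl ?ipBr//; last exact: sqiB.
    have s'0 := ltW ns0; have sm0 := s_0 m.
    rewrite (cov2 _ _ a a sm0 sm0) (cov2 _ _ a a sm0 s'0) (cov2 _ _ a a s'0 sm0).
    rewrite (cov2 _ _ a a s'0 s'0).
    rewrite !minxx (min_l sm) minC (min_l sm) S2; ring.
  rewrite -[X in _ --> X](mul0r (S a a)); apply: cvgM; last exact: cvg_cst.
  by rewrite -[X in _ --> X](subrr (- s)); apply: cvgB => //; exact: cvg_cst.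
have cross s r a b : 0 <= s -> 0 <= r -> ip P (coord L1 s a) (coord L2 r b) = 0.
  move=> s0 r0; rewrite (ip_indep _ (sq1 _ _ s0) (sq2 _ _ r0)).
    by rewrite (one_sided_mean h1 sL1 mL1)// mul0r.
  move=> A B mA mB; apply: hi; apply: sub_sigma_algebra => /=.
    exists s, ((fun x : 'cV[R]_n => x a 0) @^-1` A); split => //.
    by apply: borel_preimage => //; exact: coord_continuous.
  exists r, ((fun x : 'cV[R]_n => x b 0) @^-1` B); split => //.
  by apply: borel_preimage => //; exact: coord_continuous.
pose r s a := if 0 <= s then coord L1 s a else - coord L2 (- s) a.
have sr s a : sqi P (r s a).
  rewrite /r; case: leP => s0; first exact: sq1.
  by apply/sqiN/sq2; rewrite oppr_ge0 ltW.
have nr s a : null P (r s a - coord L s a).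
  rewrite /r; case: leP => s0; last by rewrite addrC; exact: nul2.
  by rewrite -opprB; apply/nullN/nul1.
have sL s a : sqi P (coord L s a) by exact: null_sqi (sr s a) (nr s a).
split=> // s j.
rewrite -(ip_nulll (sr s i) (nr s i) (sL t j)) -(ip_nullr (sr t j) (nr t j) (sr s i)).
rewrite ip_chi Sigma_LE -/(S i j) /r.
have np (x : R) : x < 0 -> 0 <= - x by move=> x0; rewrite oppr_ge0 ltW.
have [s0|s0] := leP 0 s; have [t0|t0] := leP 0 t => /=.
- by rewrite cov1// S1 mulrC.
- by rewrite mulr0 ipNr ?cross ?oppr0//; [exact: np|apply/sq2/np|exact: sq1].
- by rewrite mulr0 ipNl ?(ipC _ (coord L2 _ _)) ?cross ?oppr0//;
    [exact: np|apply/sq2/np|exact: sq1].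
- have a1 := sq2 _ i (np _ s0); have a2 := sq2 _ j (np _ t0).
  rewrite (ipNl a1 (sqiN a2)) (ipNr a2 a1) opprK (cov2 _ _ i j (np _ s0) (np _ t0)).
  by rewrite S2 mulrC.
Qed.

End two_sided.

(** * The isometry of integrals with respect to a Levy process *)

Section mean_square_domination.
Context d (T : measurableType d) (R : realType) (mu : {measure set T -> \bar R}).

Lemma sqi_cvg_dominated (f : T -> R) (h_ G_ : nat -> T -> R) :
  measurable_fun setT f -> (forall r, sqi mu (h_ r)) ->
  (forall r, measurable_fun setT (G_ r)) ->
  (forall r x, (f x - h_ r x) ^+ 2 <= G_ r x) ->
  (\int[mu]_x (G_ r x)%:E)%E @[r --> \oo] --> 0%E ->
  sqi mu f /\ ip mu (h_ r - f) (h_ r - f) @[r --> \oo] --> 0.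
Proof.
move=> mf sh mG fG /fine_cvgP[Gfin G0].
have mD r : measurable_fun setT (h_ r - f).
  by apply: measurable_funB => //; have [] := sh r.
have le r : (\int[mu]_x (((h_ r - f) x) ^+ 2)%:E <= \int[mu]_x (G_ r x)%:E)%E.
  apply: ge0_le_integral => //.
  - by move=> x _; rewrite lee_fin sqr_ge0.
  - by apply/measurable_EFinP/measurable_funX.
  - exact/measurable_EFinP.
  - move=> x _; rewrite lee_fin (le_trans _ (fG r x))//.
    by rewrite -[(h_ r - f) x]/(h_ r x - f x) -sqrrN opprB.
have [r0 /= Gr0] : exists r, (\int[mu]_x (G_ r x)%:E)%E \is a fin_num.
  have [N _ HN] := Gfin; by exists N; exact: HN N (leqnn N).
have sf : sqi mu f.
  rewrite -[f](subKr (h_ r0)); apply: sqiB => //; split => //.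
  by apply: le_lt_trans (le r0) _; rewrite ltey_eq Gr0.
split=> //; apply: (@squeeze_cvgr _ _ _ _ (fun=> 0) _ _ _ _ _ G0); last exact: cvg_cst.
apply: filterS Gfin => r Gr; have sD : sqi mu (h_ r - f) by exact: sqiB.
by apply/andP; split; [exact: ip_ge0|rewrite -lee_fin EFin_ip//= fineK].
Qed.

End mean_square_domination.

Section levy_isometry.
Context d (T : measurableType d) (R : realType) (P : probability T R).
Variables (k : nat) (L : R -> T -> 'cV[R]_k).
Hypothesis hL : two_sided_levy P L.
Hypothesis hc : levy_centered P L.
Hypothesis h2 : levy_square_integrable P L.
Local Notation mu := (@lebesgue_measure R).
Local Notation Sigma := (Sigma_L P L).

(** The inner product of the integrands f and g of two scalar Levy integrals, the
values of an integrand being row vectors. *)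
Definition sigma_form (f g : 'I_k -> R -> R) : R :=
  \sum_l \sum_l' Sigma l l' * ip mu (f l) (g l').

Let sL t i : sqi P (coord L t i). Proof. by have [] := levy_cov hL hc h2 t i. Qed.
#[local] Hint Resolve sL : core.
Let sc t : sqi mu (chi t) := sqi_chi t.
#[local] Hint Resolve sc : core.

Let incr_cov s t s' t' l l' :
  ip P (coord L t l - coord L s l) (coord L t' l' - coord L s' l') =
  Sigma l l' * ip mu (chi t - chi s) (chi t' - chi s').
Proof.
have c a b i j : ip P (coord L a i) (coord L b j) = Sigma i j * ip mu (chi a) (chi b).
  have [_ ->] := levy_cov hL hc h2 b i.
  by [].
rewrite (ipBB (sL _ _) (sL _ _) (sL _ _) (sL _ _)).
by rewrite (ipBB (sc _) (sc _) (sc _) (sc _)) !c; ring.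
Qed.

Lemma step_integral_coord m (phi : seq (R * R * 'M[R]_(m, k))) i :
  (fun w => step_integral L phi w i 0) =
  \sum_(x <- phi) \sum_l x.2 i l *: (coord L x.1.2 l - coord L x.1.1 l).
Proof.
apply/funext => w; rewrite /step_integral summxE fct_sumE.
apply: eq_bigr => x _; rewrite mxE fct_sumE; apply: eq_bigr => l _.
by rewrite !mxE.
Qed.

Lemma step_fun_entry m (phi : seq (R * R * 'M[R]_(m, k))) i l :
  all (fun x => x.1.1 <= x.1.2) phi ->
  (fun u => step_fun phi u i l) =
  \sum_(x <- phi) x.2 i l *: (chi x.1.2 - chi x.1.1).
Proof.
move=> /allP phile; apply/funext => u; rewrite /step_fun summxE fct_sumE.
apply: eq_big_seq => x /phile xle; rewrite chiB//.
rewrite -[RHS]/(x.2 i l * \1_(`]x.1.1, x.1.2]) u) indicE mem_setE in_itv/=.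
by case: ifP => _; rewrite ?mulr1// mxE mulr0.
Qed.

Lemma step_isometry m m' (phi : seq (R * R * 'M[R]_(m, k)))
    (psi : seq (R * R * 'M[R]_(m', k))) i j :
  all (fun x => x.1.1 <= x.1.2) phi -> all (fun x => x.1.1 <= x.1.2) psi ->
  ip P (fun w => step_integral L phi w i 0) (fun w => step_integral L psi w j 0) =
  sigma_form (fun l u => step_fun phi u i l) (fun l u => step_fun psi u j l).
Proof.
move=> hphi hpsi; rewrite !step_integral_coord /sigma_form.
have sI (x : R * R) l c : sqi P (c *: (coord L x.2 l - coord L x.1 l)).
  by apply/sqiZ/sqiB.
have sC (x : R * R) c : sqi mu (c *: (chi x.2 - chi x.1)) by apply/sqiZ/sqiB.
pose F (x : R * R * 'M[R]_(m, k)) l (y : R * R * 'M[R]_(m', k)) l' : R := x.2 i l * (y.2 j l' *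
  (Sigma l l' * ip mu (chi x.1.2 - chi x.1.1) (chi y.1.2 - chi y.1.1))).
transitivity (\sum_(x <- phi) \sum_l \sum_(y <- psi) \sum_l' F x l y l').
  rewrite ip_suml => [|x|]; [|exact: sqi_sum|by apply: sqi_sum => y; exact: sqi_sum].
  apply: eq_bigr => x _.
  rewrite ip_suml => [|l|]; [|by []|by apply: sqi_sum => y; exact: sqi_sum].
  apply: eq_bigr => l _; rewrite ip_sumr => [|y|]; [|exact: sqi_sum|by []].
  apply: eq_bigr => y _; rewrite ip_sumr => [|l'|]; [|by []|by []].
  apply: eq_bigr => l' _; rewrite ipZl ?ipZr ?incr_cov//; by [exact: sqiB|apply/sqiZ/sqiB].
have -> : \sum_l \sum_l' Sigma l l' * ip mu (fun u => step_fun phi u i l)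
     (fun u => step_fun psi u j l') =
    \sum_l \sum_l' \sum_(x <- phi) \sum_(y <- psi) F x l y l'.
  apply: eq_bigr => l _; apply: eq_bigr => l' _.
  rewrite !step_fun_entry// ip_suml => [|x|]; [|by []|exact: sqi_sum].
  rewrite mulr_sumr; apply: eq_bigr => x _.
  rewrite ip_sumr => [|y|]; [|by []|by []].
  rewrite mulr_sumr; apply: eq_bigr => y _.
  rewrite ipZl ?ipZr /F//; by [ring|exact: sqiB|apply/sqiZ/sqiB].
rewrite exchange_big; apply: eq_bigr => l _ /=.
under eq_bigr do rewrite exchange_big.
by rewrite exchange_big.
Qed.

Lemma entry_le_sqnorm m n (M : 'M[R]_(m, n)) i j : M i j ^+ 2 <= sqnorm M.
Proof.
rewrite /sqnorm (bigD1 i)//= (bigD1 j)//= -addrA lerDl addr_ge0// sumr_ge0//.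
  by move=> b _; exact: sqr_ge0.
by move=> a _; apply: sumr_ge0 => b _; exact: sqr_ge0.
Qed.

Lemma measurable_sqnorm d' (X : measurableType d') m n (M : X -> 'M[R]_(m, n)) :
  (forall i j, measurable_fun setT (fun x => M x i j)) ->
  measurable_fun setT (fun x => sqnorm (M x)).
Proof.
move=> mM; apply: measurable_sum => i; apply: measurable_sum => j.
exact: measurable_funX.
Qed.

(** One sequence of step functions approximates the integrand and the integral,
with convergence of each entry in the respective space of square-integrable
functions. *)
Lemma levy_integral_approx m (f : R -> 'M[R]_(m, k)) (Z : T -> 'cV[R]_m) :
  (forall i l, measurable_fun setT (fun u => f u i l)) ->
  is_levy_integral P L f Z ->
  exists phi : nat -> seq (R * R * 'M[R]_(m, k)),
  [/\ forall r, all (fun x => x.1.1 <= x.1.2) (phi r),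
      forall i, sqi P (fun w => Z w i 0) /\
        let h r := fun w => step_integral L (phi r) w i 0 in
        ip P (h r - (fun w => Z w i 0)) (h r - (fun w => Z w i 0))
          @[r --> \oo] --> 0 &
      forall i l, sqi mu (fun u => f u i l) /\
        let h r := fun u => step_fun (phi r) u i l in
        ip mu (h r - (fun u => f u i l)) (h r - (fun u => f u i l))
          @[r --> \oo] --> 0].
Proof.
move=> mf [mZ [phi [phile If IZ]]]; exists phi.
have ss r i : sqi P (fun w => step_integral L (phi r) w i 0).
  rewrite step_integral_coord; apply: sqi_sum => x; apply: sqi_sum => l.
  exact/sqiZ/sqiB.
have sg r i l : sqi mu (fun u => step_fun (phi r) u i l).
  by rewrite step_fun_entry//; apply: sqi_sum => x; exact/sqiZ/sqiB.
split => // [i|i l].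
  apply: (sqi_cvg_dominated (G_ := fun r w => sqnorm (Z w - step_integral L (phi r) w))).
  - exact: mZ.
  - by move=> r; exact: ss.
  - move=> r; apply: measurable_sqnorm => a b; rewrite (ord1 b).
    have [ms _] := ss r a.
    have -> : (fun x => (Z x - step_integral L (phi r) x) a 0) =
        (fun x => Z x a 0 - step_integral L (phi r) x a 0).
      by apply/funext => x; rewrite !mxE.
    exact: measurable_funB.
  - move=> r w; apply: le_trans (entry_le_sqnorm _ i 0); rewrite !mxE//.
  - by move: IZ; rewrite unlock.
apply: (@sqi_cvg_dominated _ _ R mu (fun u => f u i l)
  (fun r u => step_fun (phi r) u i l) (fun r u => sqnorm (f u - step_fun (phi r) u))).
- exact: mf.
- by move=> r; exact: sg.
- move=> r; apply: measurable_sqnorm => a b.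
  have [ms _] := sg r a b.
  have -> : (fun x => (f x - step_fun (phi r) x) a b) =
      (fun x => f x a b - step_fun (phi r) x a b).
    by apply/funext => x; rewrite !mxE.
  exact: (measurable_funB (mf a b) ms).
- by move=> r w; apply: le_trans (entry_le_sqnorm _ i l); rewrite !mxE.
- exact: If.
Qed.

(** On step functions this is the covariance formula of L; it extends to limits
by continuity of the inner products. *)
Lemma levy_isometry m m' (f : R -> 'M[R]_(m, k)) (Z : T -> 'cV[R]_m)
    (g : R -> 'M[R]_(m', k)) (W : T -> 'cV[R]_m') i j :
  (forall i l, measurable_fun setT (fun u => f u i l)) ->
  (forall i l, measurable_fun setT (fun u => g u i l)) ->
  is_levy_integral P L f Z -> is_levy_integral P L g W ->
  ip P (fun w => Z w i 0) (fun w => W w j 0) =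
  sigma_form (fun l u => f u i l) (fun l u => g u j l).
Proof.
move=> mf mg /(levy_integral_approx mf)[phi [phile phiZ phif]].
move=> /(levy_integral_approx mg)[psi [psile psiW psig]].
have ss m0 (xi : seq (R * R * 'M[R]_(m0, k))) a :
    sqi P (fun w => step_integral L xi w a 0).
  rewrite step_integral_coord; apply: sqi_sum => x; apply: sqi_sum => l.
  exact/sqiZ/sqiB.
have sg m0 (xi : seq (R * R * 'M[R]_(m0, k))) a l :
    all (fun x => x.1.1 <= x.1.2) xi -> sqi mu (fun u => step_fun xi u a l).
  by move=> ?; rewrite step_fun_entry//; apply: sqi_sum => x; exact/sqiZ/sqiB.
have [sZ cZ] := phiZ i; have [sW cW] := psiW j.
have lim1 : ip P (fun w => step_integral L (phi r) w i 0)
    (fun w => step_integral L (psi r) w j 0) @[r --> \oo] -->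
    ip P (fun w => Z w i 0) (fun w => W w j 0).
  exact: (cvg_ip (fun r => ss _ (phi r) i) (fun r => ss _ (psi r) j) sZ sW cZ cW).
have lim2 : sigma_form (fun l u => step_fun (phi r) u i l)
    (fun l u => step_fun (psi r) u j l) @[r --> \oo] -->
    sigma_form (fun l u => f u i l) (fun l u => g u j l).
  apply: cvg_big => [|l _]; first exact: add_continuous.
  apply: cvg_big => [|l' _]; first exact: add_continuous.
  apply: cvgM; first exact: cvg_cst.
  have [sf cf] := phif i l; have [sg' cg] := psig j l'.
  exact: (cvg_ip (fun r => sg _ (phi r) i l (phile r))
                 (fun r => sg _ (psi r) j l' (psile r)) sf sg' cf cg).
rewrite (funext (fun r => step_isometry i j (phile r) (psile r))) in lim1.
exact: (cvg_unique _ lim1 lim2).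
Qed.

(** Linear combinations of Levy integrals at different times are compared with
those of their integrands without showing that they are Levy integrals. *)
Lemma levy_isometry_comb (I J : finType) (c : I -> R) (e : J -> R)
    (Z : I -> T -> R) (f : I -> 'I_k -> R -> R)
    (W : J -> T -> R) (g : J -> 'I_k -> R -> R) :
  (forall a, sqi P (Z a)) -> (forall b, sqi P (W b)) ->
  (forall a l, sqi mu (f a l)) -> (forall b l, sqi mu (g b l)) ->
  (forall a b, ip P (Z a) (W b) = sigma_form (f a) (g b)) ->
  ip P (\sum_a c a *: Z a) (\sum_b e b *: W b) =
  sigma_form (fun l => \sum_a c a *: f a l) (fun l => \sum_b e b *: g b l).
Proof.
move=> sZ sW sf sg h.
have scZ a : sqi P (c a *: Z a) by exact: sqiZ.
have seW b : sqi P (e b *: W b) by exact: sqiZ.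
have scf a l : sqi mu (c a *: f a l) by exact: sqiZ.
have seg b l : sqi mu (e b *: g b l) by exact: sqiZ.
have sWs : sqi P (\sum_b e b *: W b) by exact: sqi_sum.
have sgs l : sqi mu (\sum_b e b *: g b l) by exact: sqi_sum.
pose F a b l l' := c a * (e b * (Sigma l l' * ip mu (f a l) (g b l'))).
transitivity (\sum_a \sum_b \sum_l \sum_l' F a b l l').
  rewrite ip_suml//; apply: eq_bigr => a _; rewrite ip_sumr//.
  apply: eq_bigr => b _; rewrite (ipZl _ (sZ a) (seW b)) (ipZr _ (sW b) (sZ a)).
  rewrite h /sigma_form !mulr_sumr; apply: eq_bigr => l _.
  by rewrite !mulr_sumr.
have -> : sigma_form (fun l => \sum_a c a *: f a l) (fun l => \sum_b e b *: g b l)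
    = \sum_l \sum_l' \sum_a \sum_b F a b l l'.
  apply: eq_bigr => l _; apply: eq_bigr => l' _.
  rewrite ip_suml//; rewrite mulr_sumr; apply: eq_bigr => a _.
  rewrite ip_sumr// mulr_sumr; apply: eq_bigr => b _.
  by rewrite (ipZl _ (sf a l) (seg b l')) (ipZr _ (sg b l') (sf a l)) /F; ring.
under eq_bigr => a _ do rewrite exchange_big.
rewrite exchange_big; apply: eq_bigr => l _ /=.
under eq_bigr => a _ do rewrite exchange_big.
by rewrite exchange_big.
Qed.

End levy_isometry.

(** * Complex square-integrable variables *)

Section complex_L2.
Context d (T : measurableType d) (R : realType) (P : probability T R).
Implicit Types U V W X Y Z : T -> R[i].

Definition cre U : T -> R := fun w => complex.Re (U w).
Definition cim U : T -> R := fun w => complex.Im (U w).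
Definition cscale (c : R[i]) U : T -> R[i] := fun w => c * U w.
Definition cplx (f : T -> R) : T -> R[i] := fun w => (f w)%:C.

Lemma cre_add U V : cre (U + V) = cre U + cre V.
Proof. by apply/funext => w; rewrite /cre -[(U + V) w]/(U w + V w) raddfD. Qed.
Lemma cim_add U V : cim (U + V) = cim U + cim V.
Proof. by apply/funext => w; rewrite /cim -[(U + V) w]/(U w + V w) raddfD. Qed.
Lemma cre_opp U : cre (- U) = - cre U.
Proof. by apply/funext => w; rewrite /cre -[(- U) w]/(- U w) raddfN. Qed.
Lemma cim_opp U : cim (- U) = - cim U.
Proof. by apply/funext => w; rewrite /cim -[(- U) w]/(- U w) raddfN. Qed.
Lemma cre_scale c U : cre (cscale c U) =
  complex.Re c *: cre U - complex.Im c *: cim U.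
Proof.
apply/funext => w; rewrite -[RHS]/(complex.Re c * cre U w - complex.Im c * cim U w).
by rewrite /cre /cim /cscale; case: c (U w) => [a b] [x y].
Qed.
Lemma cim_scale c U : cim (cscale c U) =
  complex.Re c *: cim U + complex.Im c *: cre U.
Proof.
apply/funext => w; rewrite -[RHS]/(complex.Re c * cim U w + complex.Im c * cre U w).
by rewrite /cre /cim /cscale; case: c (U w) => [a b] [x y].
Qed.
Lemma cre_cplx f : cre (cplx f) = f. Proof. by []. Qed.
Lemma cim_cplx f : cim (cplx f) = 0. Proof. by []. Qed.
Lemma cplxB f g : cplx (f - g) = cplx f - cplx g.
Proof. by apply/funext => w; rewrite -[RHS]/((f w)%:C - (g w)%:C) -rmorphB. Qed.
Lemma cplxZ a f : cplx (a *: f) = cscale a%:C (cplx f).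
Proof. by apply/funext => w; rewrite /cscale /cplx -rmorphM. Qed.
Lemma cplx_sum (I : Type) (r : seq I) (F : I -> T -> R) :
  cplx (\sum_(i <- r) F i) = \sum_(i <- r) cplx (F i).
Proof.
apply/funext => w; rewrite fct_sumE /cplx fct_sumE.
by rewrite (rmorph_sum (real_complex R)).
Qed.

#[local] Hint Resolve sqi0 sqiD sqiB sqiN sqiZ : core.

Lemma sqdist_sub U V : sqdist P U V = sqdist P (U - V) (fun=> 0).
Proof.
by rewrite /sqdist; congr ('E_P[_])%E; apply/funext => w; rewrite subr0.
Qed.

Lemma sqdist0E U : sqdist P U (fun=> 0) =
  (\int[P]_w ((cre U w) ^+ 2 + (cim U w) ^+ 2)%:E)%E.
Proof.
by rewrite /sqdist unlock; apply: eq_integral => w _; rewrite subr0.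
Qed.

Lemma L2P U : L2 P U <-> sqi P (cre U) /\ sqi P (cim U).
Proof.
have le m (f g : T -> R) : measurable_fun setT f -> measurable_fun setT g ->
    (\int[P]_w (f w ^+ 2 + g w ^+ 2)%:E < +oo)%E ->
    (\int[P]_w ((if m then f w else g w) ^+ 2)%:E < +oo)%E.
  move=> mf mg; apply: le_lt_trans; apply: ge0_le_integral => //.
  - by move=> w _; rewrite lee_fin sqr_ge0.
  - by case: m; apply/measurable_EFinP/measurable_funX.
  - by apply/measurable_EFinP; apply: measurable_funD; exact: measurable_funX.
  - by move=> w _; rewrite lee_fin; case: m; rewrite ?lerDl ?lerDr sqr_ge0.
split=> [[mr mi]|[[mr Ir] [mi Ii]]].
  rewrite sqdist0E => fin; split; split => //.
    exact: (le true _ _ mr mi fin).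
  exact: (le false _ _ mr mi fin).
split=> //; rewrite sqdist0E; under eq_integral => w _ do rewrite EFinD.
rewrite ge0_integralD//; [exact: lte_add_pinfty|..].
- by move=> w _; rewrite lee_fin sqr_ge0.
- by apply/measurable_EFinP/measurable_funX.
- by move=> w _; rewrite lee_fin sqr_ge0.
- by apply/measurable_EFinP/measurable_funX.
Qed.

Definition sqnm U : R := ip P (cre U) (cre U) + ip P (cim U) (cim U).

Lemma sqnm_ge0 U : 0 <= sqnm U.
Proof. by rewrite addr_ge0// ip_ge0. Qed.

Lemma L2D U V : L2 P U -> L2 P V -> L2 P (U + V).
Proof.
move=> /L2P[ur ui] /L2P[vr vi]; apply/L2P.
by rewrite cre_add cim_add; auto.
Qed.
Lemma L2N U : L2 P U -> L2 P (- U).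
Proof. by move=> /L2P[ur ui]; apply/L2P; rewrite cre_opp cim_opp; auto. Qed.
Lemma L2B U V : L2 P U -> L2 P V -> L2 P (U - V).
Proof. by move=> lu lv; apply: L2D => //; exact: L2N. Qed.
Lemma L2Z c U : L2 P U -> L2 P (cscale c U).
Proof. by move=> /L2P[ur ui]; apply/L2P; rewrite cre_scale cim_scale; auto. Qed.
Lemma L20 : L2 P 0.
Proof.
by apply/L2P; split; exact: sqi0.
Qed.
Lemma L2_cplx f : L2 P (cplx f) <-> sqi P f.
Proof. by rewrite L2P cre_cplx cim_cplx; split=> [[]//|?]; split => //; exact: sqi0. Qed.
Lemma L2_sum (I : Type) (r : seq I) (Q : pred I) (F : I -> T -> R[i]) :
  (forall i, L2 P (F i)) -> L2 P (\sum_(i <- r | Q i) F i).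
Proof. by move=> lF; elim/big_ind: _ => //; [exact: L20|exact: L2D]. Qed.

Lemma sqdistE U V : L2 P U -> L2 P V -> sqdist P U V = (sqnm (U - V))%:E.
Proof.
move=> lu lv; have /L2P[wr wi] := L2B lu lv.
rewrite sqdist_sub sqdist0E /sqnm EFinD !EFin_ip//.
have [[mr _] [mi _]] := (wr, wi); rewrite -ge0_integralD//.
- by move=> w _; rewrite lee_fin sqr_ge0.
- by apply/measurable_EFinP/measurable_funX.
- by move=> w _; rewrite lee_fin sqr_ge0.
- by apply/measurable_EFinP/measurable_funX.
Qed.

Lemma innerE U V : L2 P U -> L2 P V -> inner P U V =
  (ip P (cre U) (cre V) + ip P (cim U) (cim V)) +i*
  (ip P (cim U) (cre V) - ip P (cre U) (cim V)).
Proof.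
move=> /L2P[ur ui] /L2P[vr vi]; rewrite /inner /cexpectation unlock.
congr (_ +i* _).
  rewrite /ip -RintegralD//; [|exact: integrable_ip..].
  congr fine; apply: eq_integral => w _; congr EFin; rewrite /cre /cim.
  by case: (U w) (V w) => [a b] [a' b'] /=; ring.
rewrite /ip -RintegralB//; [|exact: integrable_ip..].
congr fine; apply: eq_integral => w _; congr EFin; rewrite /cre /cim.
by case: (U w) (V w) => [a b] [a' b'] /=; ring.
Qed.

Lemma inner_cplx f g : sqi P f -> sqi P g -> inner P (cplx f) (cplx g) = (ip P f g)%:C.
Proof.
move=> sf sg; rewrite innerE ?L2_cplx// !cre_cplx !cim_cplx.
by rewrite [ip P f 0]ipC !ip0l subr0 addr0.
Qed.

Lemma innerDl U V W : L2 P U -> L2 P V -> L2 P W ->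
  inner P (U + V) W = inner P U W + inner P V W.
Proof.
move=> lu lv lw; rewrite !innerE//; last exact: L2D.
move: lu lv lw => /L2P[ur ui] /L2P[vr vi] /L2P[wr wi].
rewrite cre_add cim_add !ipDl//; apply/eqP; rewrite eq_complex /=.
by apply/andP; split; apply/eqP; ring.
Qed.

Lemma innerZl c U W : L2 P U -> L2 P W ->
  inner P (cscale c U) W = c * inner P U W.
Proof.
move=> lu lw; rewrite !innerE//; last exact: L2Z.
move: lu lw => /L2P[ur ui] /L2P[wr wi].
case: c => [a b]; rewrite cre_scale cim_scale /=.
have sar := sqiZ a ur; have sai := sqiZ a ui.
have sbr := sqiZ b ur; have sbi := sqiZ b ui.
rewrite (ipBl sar sbi wr) (ipBl sar sbi wi) (ipDl sai sbr wr) (ipDl sai sbr wi).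
rewrite !(ipZl _ ur wr) !(ipZl _ ur wi) !(ipZl _ ui wr) !(ipZl _ ui wi).
apply/eqP; rewrite eq_complex /=; apply/andP; split; apply/eqP; ring.
Qed.

Lemma inner_conj U V : L2 P U -> L2 P V -> inner P V U = (inner P U V)^*%C.
Proof.
move=> lu lv; rewrite !innerE//; apply/eqP; rewrite eq_complex /=.
rewrite (ipC P (cre V) (cre U)) (ipC P (cim V) (cim U)) (ipC P (cim V) (cre U)).
by rewrite (ipC P (cre V) (cim U)) opprB !eqxx.
Qed.

Lemma inner0l W : L2 P W -> inner P 0 W = 0.
Proof.
move=> lw; rewrite innerE//; last exact: L20.
have -> : cre 0 = 0 by []. have -> : cim 0 = 0 by [].
by rewrite !ip0l subrr addr0.
Qed.

Lemma innerNl U W : L2 P U -> L2 P W -> inner P (- U) W = - inner P U W.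
Proof.
move=> lu lw; have -> : - U = cscale (-1) U by apply/funext => w; rewrite /cscale mulN1r.
by rewrite innerZl// mulN1r.
Qed.

Lemma innerBl U V W : L2 P U -> L2 P V -> L2 P W ->
  inner P (U - V) W = inner P U W - inner P V W.
Proof. by move=> *; rewrite innerDl ?innerNl//; exact: L2N. Qed.

Lemma inner_suml (I : Type) (r : seq I) (F : I -> T -> R[i]) W :
  (forall i, L2 P (F i)) -> L2 P W ->
  inner P (\sum_(i <- r) F i) W = \sum_(i <- r) inner P (F i) W.
Proof.
move=> sF sh; elim: r => [|i r IH]; first by rewrite !big_nil inner0l.
by rewrite !big_cons innerDl ?IH//; exact: L2_sum.
Qed.

Lemma inner_eq0_sym U V : L2 P U -> L2 P V -> inner P U V = 0 -> inner P V U = 0.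
Proof. by move=> lu lv h; rewrite inner_conj// h conjc0. Qed.

Lemma innerBr0 U V W : L2 P U -> L2 P V -> L2 P W ->
  inner P W V = 0 -> inner P W (U - V) = inner P W U.
Proof.
move=> lu lv lw h; rewrite inner_conj//; last exact: L2B.
rewrite innerBl// (inner_conj lw lu).
by rewrite (inner_eq0_sym lw lv h) subr0 conjcK.
Qed.

Lemma inner_self U : L2 P U -> inner P U U = (sqnm U)%:C.
Proof. by move=> lu; rewrite innerE// (ipC P (cim U) (cre U)) subrr. Qed.

Lemma sqnm_add_le U V : L2 P U -> L2 P V -> sqnm (U + V) <= 2 * sqnm U + 2 * sqnm V.
Proof.
move=> /L2P[ur ui] /L2P[vr vi]; rewrite /sqnm cre_add cim_add.
have := ip_add_le ur vr; have := ip_add_le ui vi; lra.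
Qed.

Lemma sqnmN U : L2 P U -> sqnm (- U) = sqnm U.
Proof.
by move=> /L2P[ur ui]; rewrite /sqnm cre_opp cim_opp !ipNl ?ipNr ?opprK//; auto.
Qed.

Lemma sqnm_cplx f : sqnm (cplx f) = ip P f f.
Proof. by rewrite /sqnm cre_cplx cim_cplx ip0l addr0. Qed.

Definition cnull U : Prop := L2 P U /\ sqnm U = 0.

Lemma cnullP U : cnull U <-> null P (cre U) /\ null P (cim U).
Proof.
rewrite /cnull L2P /sqnm; split=> [[[ur ui]]|[[ur r0] [ui i0]]]; last first.
  by rewrite r0 i0 addr0.
move=> /eqP; rewrite paddr_eq0 ?ip_ge0// => /andP[/eqP ? /eqP ?].
by split; split.
Qed.

Lemma cnull_inner U V : cnull U -> L2 P V -> inner P U V = 0.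
Proof.
move=> /cnullP[[ur r0] [ui i0]] lv; rewrite innerE//; last exact/L2P.
move: lv => /L2P[vr vi].
rewrite (ip_null ur vr r0) (ip_null ur vi r0) (ip_null ui vr i0) (ip_null ui vi i0).
by rewrite subrr addr0.
Qed.

Lemma cnullD U V : cnull U -> cnull V -> cnull (U + V).
Proof.
move=> [lu u0] [lv v0]; split; first exact: L2D.
apply/eqP; rewrite eq_le sqnm_ge0 andbT.
by apply: le_trans (sqnm_add_le lu lv) _; rewrite u0 v0 mulr0 addr0.
Qed.

Lemma cnullN U : cnull U -> cnull (- U).
Proof. by move=> [lu u0]; split; [exact: L2N|rewrite sqnmN]. Qed.

Lemma cnullZ c U : cnull U -> cnull (cscale c U).
Proof.
move=> nu; have [lu _] := nu; split; first exact: L2Z.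
have h := innerZl c lu (L2Z c lu).
rewrite (cnull_inner nu (L2Z c lu)) mulr0 inner_self in h; last exact: L2Z.
by case: h.
Qed.

Lemma inner_cnull U U' V V' : L2 P U -> L2 P V ->
  cnull (U - U') -> cnull (V - V') -> inner P U V = inner P U' V'.
Proof.
move=> lu lv nu nv; have [lUU _] := nu; have [lVV _] := nv.
have lu' : L2 P U' by rewrite -[U'](subKr U); exact: L2B.
have lv' : L2 P V' by rewrite -[V'](subKr V); exact: L2B.
apply/eqP; rewrite -subr_eq0; apply/eqP.
transitivity (inner P (U - U') V + (inner P U' V - inner P U' V')).
  by rewrite innerBl// addrA subrK.
rewrite cnull_inner// add0r (inner_conj lv)// (inner_conj lv')//.
by rewrite -rmorphB -innerBl// cnull_inner// rmorph0.
Qed.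

Lemma sqnm_cnull U V : L2 P U -> cnull (U - V) -> sqnm U = sqnm V.
Proof.
move=> lu nuv; have [luv _] := nuv.
have lv : L2 P V by rewrite -[V](subKr U); exact: L2B.
have := inner_cnull lu lu nuv nuv; rewrite !inner_self// => h.
by case: h.
Qed.

(** * Closed linear spans *)

Definition L2set (S : set (T -> R[i])) : Prop := forall X, S X -> L2 P X.

Lemma lin_spanE S X : lin_span S X <->
  exists (n : nat) (c : 'I_n -> R[i]) (Z : 'I_n -> T -> R[i]),
    (forall i, S (Z i)) /\ X = \sum_i cscale (c i) (Z i).
Proof.
split=> -[n [c [Z [SZ ->]]]]; exists n, c, Z; split => //.
  by apply/funext => w; rewrite fct_sumE.
by apply/funext => w; rewrite fct_sumE.
Qed.

Lemma lin_span_L2 S X : L2set S -> lin_span S X -> L2 P X.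
Proof.
move=> LS /lin_spanE[n [c [Z [SZ ->]]]].
by apply: L2_sum => i; exact/L2Z/LS.
Qed.

Lemma closed_span_L2 S X : closed_span P S X -> L2 P X.
Proof. by case. Qed.

Lemma closed_spanP S X : L2set S -> (closed_span P S X <-> L2 P X /\
  forall e : R, 0 < e -> exists2 Z, lin_span S Z & sqnm (X - Z) < e).
Proof.
move=> LS; split=> -[lX h]; split=> // e /h[Z SZ XZ]; exists Z => //.
  by move: XZ; rewrite sqdistE ?lte_fin//; exact: lin_span_L2 SZ.
by rewrite sqdistE ?lte_fin//; exact: lin_span_L2 SZ.
Qed.

Lemma lin_span_id S X : S X -> lin_span S X.
Proof.
move=> SX; apply/lin_spanE; exists 1%N, (fun=> 1), (fun=> X); split => //.
by rewrite big_ord1; apply/funext => w; rewrite /cscale mul1r.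
Qed.

Lemma sqnm0 : sqnm 0 = 0.
Proof.
rewrite /sqnm; have -> : cre 0 = 0 by []. have -> : cim 0 = 0 by [].
by rewrite !ip0l addr0.
Qed.

Lemma lin_span_closed S X : L2set S -> lin_span S X -> closed_span P S X.
Proof.
move=> LS SX; apply/closed_spanP => //; split; first exact: lin_span_L2 SX.
by move=> e e0; exists X => //; rewrite subrr sqnm0.
Qed.

Lemma closed_span_id S X : L2set S -> S X -> closed_span P S X.
Proof. by move=> LS SX; apply: lin_span_closed => //; exact: lin_span_id. Qed.

Lemma lin_spanD S X Y : lin_span S X -> lin_span S Y -> lin_span S (X + Y).
Proof.
move=> /lin_spanE[n [c [Z [SZ ->]]]] /lin_spanE[m [e [W [SW ->]]]].
apply/lin_spanE; exists (n + m)%N,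
  (fun i => match fintype.split i with inl a => c a | inr b => e b end),
  (fun i => match fintype.split i with inl a => Z a | inr b => W b end); split.
  by move=> i; case: fintype.split.
rewrite big_split_ord /=; congr (_ + _); apply: eq_bigr => i _.
  by rewrite (unsplitK (inl i)).
by rewrite (unsplitK (inr i)).
Qed.

Lemma lin_spanZ S a X : lin_span S X -> lin_span S (cscale a X).
Proof.
move=> /lin_spanE[n [c [Z [SZ ->]]]].
apply/lin_spanE; exists n, (fun i => a * c i), Z; split => //.
apply/funext => w; rewrite /cscale !fct_sumE mulr_sumr.
by apply: eq_bigr => i _; rewrite mulrA.
Qed.

Lemma cscaleN1 X : cscale (-1) X = - X.
Proof. by apply/funext => w; rewrite /cscale mulN1r. Qed.

Lemma sqnmZ c X : L2 P X ->
  sqnm (cscale c X) = (complex.Re c ^+ 2 + complex.Im c ^+ 2) * sqnm X.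
Proof.
move=> lX; have h := innerZl c lX (L2Z c lX).
rewrite (inner_conj (L2Z c lX) lX) (innerZl c lX lX) in h.
rewrite (inner_self (L2Z c lX)) (inner_self lX) in h.
move: h; case: c => [a b] /= [h _]; rewrite h; ring.
Qed.

Lemma closed_spanD S X Y : L2set S ->
  closed_span P S X -> closed_span P S Y -> closed_span P S (X + Y).
Proof.
move=> LS /(closed_spanP _ LS)[lX hX] /(closed_spanP _ LS)[lY hY].
apply/closed_spanP => //; split; first exact: L2D.
move=> e e0; have e4 : 0 < e / 4 by rewrite divr_gt0.
have [Z SZ XZ] := hX _ e4; have [W SW YW] := hY _ e4.
exists (Z + W); first exact: lin_spanD.
have lZ := lin_span_L2 LS SZ; have lW := lin_span_L2 LS SW.
rewrite opprD addrACA; apply: le_lt_trans (sqnm_add_le (L2B lX lZ) (L2B lY lW)) _.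
lra.
Qed.

Lemma closed_spanZ S a X : L2set S -> closed_span P S X -> closed_span P S (cscale a X).
Proof.
move=> LS /(closed_spanP _ LS)[lX hX].
apply/closed_spanP => //; split; first exact: L2Z.
move=> e e0; pose m := complex.Re a ^+ 2 + complex.Im a ^+ 2.
have m0 : 0 <= m by rewrite addr_ge0 ?sqr_ge0.
have em : 0 < e / (m + 1) by rewrite divr_gt0// ltr_wpDl.
have [Z SZ XZ] := hX _ em; exists (cscale a Z); first exact: lin_spanZ.
have lZ := lin_span_L2 LS SZ.
have -> : cscale a X - cscale a Z = cscale a (X - Z).
  apply/funext => w; rewrite -[LHS]/(a * X w - a * Z w) -[RHS]/(a * (X w - Z w)).
  by rewrite mulrBr.
rewrite sqnmZ; last exact: L2B.
rewrite -/m; apply: (@le_lt_trans _ _ (m * (e / (m + 1)))).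
  by rewrite ler_wpM2l// ltW.
by rewrite mulrCA gtr_pMr// ltr_pdivrMr ?mul1r ?ltrDl// ltr_wpDl.
Qed.

Lemma closed_spanN S X : L2set S -> closed_span P S X -> closed_span P S (- X).
Proof. by move=> LS SX; rewrite -cscaleN1; exact: closed_spanZ. Qed.

Lemma closed_spanB S X Y : L2set S ->
  closed_span P S X -> closed_span P S Y -> closed_span P S (X - Y).
Proof. by move=> LS SX SY; apply: closed_spanD => //; exact: closed_spanN. Qed.

Lemma closed_span0 S : L2set S -> closed_span P S 0.
Proof.
move=> LS; apply/closed_spanP => //; split; first exact: L20.
move=> e e0; exists 0; last by rewrite subrr sqnm0.
apply/lin_spanE; exists 0%N, (fun=> 0), (fun=> 0); split; first by case.
by rewrite big_ord0.
Qed.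

Lemma closed_span_sum S n (F : 'I_n -> T -> R[i]) : L2set S ->
  (forall i, closed_span P S (F i)) -> closed_span P S (\sum_i F i).
Proof.
move=> LS SF; elim/big_ind: _ => //; first exact: closed_span0.
by move=> x y; exact: closed_spanD.
Qed.

Lemma closed_span_limit S X : L2set S -> L2 P X ->
  (forall e : R, 0 < e -> exists2 Y, closed_span P S Y & sqnm (X - Y) < e) ->
  closed_span P S X.
Proof.
move=> LS lX h; apply/closed_spanP => //; split=> // e e0.
have e4 : 0 < e / 4 by rewrite divr_gt0.
have [Y /(closed_spanP _ LS)[lY hY] XY] := h _ e4; have [Z SZ YZ] := hY _ e4.
exists Z => //; have lZ := lin_span_L2 LS SZ.
rewrite -[X - Z](subrKA Y); apply: le_lt_trans (sqnm_add_le (L2B lX lY) (L2B lY lZ)) _.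
lra.
Qed.

(** Orthogonality to generators passes to limits by the Cauchy-Schwarz
inequality, applied to real and imaginary parts. *)
Lemma closed_span_orth S X W : L2set S -> L2 P W ->
  (forall Z, S Z -> inner P Z W = 0) -> closed_span P S X -> inner P X W = 0.
Proof.
move=> LS lW SW /(closed_spanP _ LS)[lX hX].
have span0 Z : lin_span S Z -> inner P Z W = 0.
  move=> /lin_spanE[n [c [F [SF ->]]]]; rewrite inner_suml// => [|i]; last exact/L2Z/LS.
  by apply: big1 => i _; rewrite innerZl ?SW ?mulr0//; exact: LS.
have bound (x : R) : (forall e : R, 0 < e -> `|x| <= Num.sqrt e * (2 * Num.sqrt (sqnm W))) ->
    x = 0.
  move=> hx; apply/eqP; rewrite -normr_le0; apply/ler_addgt0Pr => e e0.
  rewrite add0r; pose C := 2 * Num.sqrt (sqnm W) + 1.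
  have C0 : 0 < C by rewrite ltr_wpDl// mulr_ge0// sqrtr_ge0.
  have eC : 0 < (e / C) ^+ 2 by rewrite exprn_gt0// divr_gt0.
  apply: le_trans (hx _ eC) _.
  rewrite sqrtr_sqr gtr0_norm ?divr_gt0// -mulrA ler_piMr ?(ltW e0)//.
  by rewrite mulrC ler_pdivrMr// mul1r lerDl.
have main (e : R) : 0 < e -> `|complex.Re (inner P X W)| <= Num.sqrt e * (2 * Num.sqrt (sqnm W)) /\
    `|complex.Im (inner P X W)| <= Num.sqrt e * (2 * Num.sqrt (sqnm W)).
  move=> e0; have [Z SZ XZ] := hX e e0; have lZ := lin_span_L2 LS SZ.
  have -> : inner P X W = inner P (X - Z) W by rewrite innerBl// (span0 Z SZ) subr0.
  have lXZ := L2B lX lZ; rewrite innerE//=.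
  move: lXZ lW => /L2P[ur ui] /L2P[vr vi].
  set U := X - Z in ur ui XZ *.
  have ru : Num.sqrt (ip P (cre U) (cre U)) <= Num.sqrt e.
    by rewrite ler_wsqrtr// (le_trans _ (ltW XZ))// lerDl ip_ge0.
  have iu : Num.sqrt (ip P (cim U) (cim U)) <= Num.sqrt e.
    by rewrite ler_wsqrtr// (le_trans _ (ltW XZ))// lerDr ip_ge0.
  have rw : Num.sqrt (ip P (cre W) (cre W)) <= Num.sqrt (sqnm W).
    by rewrite ler_wsqrtr// lerDl ip_ge0.
  have iw : Num.sqrt (ip P (cim W) (cim W)) <= Num.sqrt (sqnm W).
    by rewrite ler_wsqrtr// lerDr ip_ge0.
  have cs f g : sqi P f -> sqi P g -> Num.sqrt (ip P f f) <= Num.sqrt e ->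
      Num.sqrt (ip P g g) <= Num.sqrt (sqnm W) ->
      `|ip P f g| <= Num.sqrt e * Num.sqrt (sqnm W).
    move=> sf sg hf hg; apply: le_trans (ip_cauchy_schwarz sf sg) _.
    by apply: ler_pM => //; exact: sqrtr_ge0.
  have h1 := cs _ _ ur vr ru rw; have h2 := cs _ _ ui vi iu iw.
  have h3 := cs _ _ ui vr iu rw; have h4 := cs _ _ ur vi ru iw.
  split.
    apply: le_trans (ler_normD _ _) _; lra.
  apply: le_trans (ler_normB _ _) _; lra.
apply/eqP; rewrite eq_complex; apply/andP; split; apply/eqP; apply: bound => e /main[]//.
Qed.

(** * Projections and conditional orthogonality *)

Definition is_proj S X Z := S Z /\ forall W, S W -> inner P (X - Z) W = 0.

(** The residual is a version chosen arbitrarily, but as soon as one projection Z of X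
is known, the chosen one differs from Z by an element of the closed span that
is orthogonal to itself. The variable X may be replaced by an almost surely equal
X', which is what mean-square derivatives require. *)
Lemma residual_unique S X X' Z : L2set S -> L2 P X -> cnull (X - X') ->
  is_proj (closed_span P S) X' Z ->
  L2 P (residual P (closed_span P S) X) /\
  cnull (residual P (closed_span P S) X - (X' - Z)).
Proof.
move=> LS lX nX [SZ oZ]; have [lXX _] := nX.
have lX' : L2 P X' by rewrite -[X'](subKr X); exact: L2B.
have lZ := closed_span_L2 SZ.
have oXZ W : closed_span P S W -> inner P (X - Z) W = 0.
  move=> SW; have lW := closed_span_L2 SW; rewrite -(oZ W SW).
  rewrite !innerBl//; congr (_ - _).
  by apply: inner_cnull => //; rewrite subrr; split; [exact: L20|exact: sqnm0].
pose Q := L2_proj P (closed_span P S) X.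
have [SQ oQ] : closed_span P S Q /\ forall W, closed_span P S W -> inner P (X - Q) W = 0.
  apply: (@xgetPex _ (fun=> 0) [set Z | closed_span P S Z /\
    forall W, closed_span P S W -> inner P (fun w => X w - Z w) W = 0]).
  by exists Z; split => // W SW; exact: oXZ.
have lQ := closed_span_L2 SQ.
have rE : residual P (closed_span P S) X = X - Q by [].
rewrite rE; split; first exact: L2B.
have nQZ : cnull (Q - Z).
  have lQZ := L2B lQ lZ; split=> //.
  have SQZ := closed_spanB LS SQ SZ.
  have : inner P (Q - Z) (Q - Z) = 0.
    have e : Q - Z = (X - Z) - (X - Q) by rewrite opprB [RHS]addrC addrA subrK.
    by rewrite {1}e innerBl ?oXZ ?oQ ?subrr//; exact: L2B.
  by rewrite inner_self// => -[].
have -> : X - Q - (X' - Z) = (X - X') - (Q - Z).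
  by rewrite !opprB addrACA [RHS]addrACA; congr (_ + _); rewrite addrC.
by apply: cnullD => //; exact: cnullN.
Qed.

(** Gram-Schmidt: x_0 and f are first projected on the other variables, by
induction, and the residual of f is then projected on the residual of x_0. *)
Lemma finite_proj n (x : 'I_n -> T -> R) (f : T -> R) :
  (forall i, sqi P (x i)) -> sqi P f ->
  exists c : 'I_n -> R, forall j, ip P (f - \sum_i c i *: x i) (x j) = 0.
Proof.
elim: n x f => [|n IH] x f sx sf; first by exists (fun=> 0) => -[].
pose x' i := x (lift ord0 i).
have sx' i : sqi P (x' i) by exact: sx.
have [c hc] := IH x' f sx' sf; have [e he] := IH x' (x ord0) sx' (sx ord0).
have sc (a : 'I_n -> R) : sqi P (\sum_i a i *: x' i) by apply: sqi_sum => i; auto.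
pose u := x ord0 - \sum_i e i *: x' i.
pose v := f - \sum_i c i *: x' i.
have su : sqi P u by exact: sqiB. have sv : sqi P v by exact: sqiB.
have orth g (a : 'I_n -> R) : sqi P g -> (forall j, ip P g (x' j) = 0) ->
    ip P g (\sum_i a i *: x' i) = 0.
  move=> sg hg; rewrite ip_sumr//; last by move=> i; auto.
  by apply: big1 => i _; rewrite (ipZr _ (sx' i) sg) hg mulr0.
pose al := ip P v u / ip P u u.
have vau : ip P (v - al *: u) u = 0.
  rewrite ipBl//; last exact: sqiZ. rewrite (ipZl _ su su) /al.
  have [u0|u0] := eqVneq (ip P u u) 0; last by rewrite divfK// subrr.
  by rewrite u0 mulr0 subr0 ipC; exact: ip_null.
exists (fun i => oapp (fun k => c k - al * e k) al (unlift ord0 i)).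
have -> : f - \sum_i oapp (fun k => c k - al * e k) al (unlift ord0 i) *: x i =
    v - al *: u.
  rewrite big_ord_recl unlift_none /= /v /u.
  under eq_bigr do rewrite liftK /= scalerBl.
  rewrite sumrB scalerBr scaler_sumr.
  under [X in _ = _ - (_ - X)]eq_bigr do rewrite scalerA.
  by rewrite !opprD !opprK !addrA; congr (_ + _); rewrite addrAC.
have sw : sqi P (v - al *: u) by apply: sqiB => //; exact: sqiZ.
have ox' j : ip P (v - al *: u) (x' j) = 0.
  rewrite ipBl//; last exact: sqiZ.
  by rewrite (ipZl _ su (sx' j)) (hc j) (he j) mulr0 subrr.
move=> j; case: (unliftP ord0 j) => [k ->|->]; first exact: ox'.
by rewrite -[x ord0](subrK (\sum_i e i *: x' i)) ipDr// vau (orth _ _ sw ox') addr0.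
Qed.

Definition cspan n (x : 'I_n -> T -> R) Z : Prop :=
  exists c : 'I_n -> R[i], Z = \sum_i cscale (c i) (cplx (x i)).

Section finite_cspan.
Variables (n : nat) (x : 'I_n -> T -> R).
Hypothesis sx : forall i, sqi P (x i).

Let lx i : L2 P (cplx (x i)). Proof. exact/L2_cplx. Qed.

Lemma cspan_L2 Z : cspan x Z -> L2 P Z.
Proof. by move=> [c ->]; apply: L2_sum => i; exact: L2Z. Qed.

Lemma cspan_orth U Z : L2 P U -> (forall i, inner P U (cplx (x i)) = 0) ->
  cspan x Z -> inner P Z U = 0.
Proof.
move=> lU hU [c ->]; rewrite inner_suml// => [|i]; last exact: L2Z.
apply: big1 => i _; rewrite innerZl//.
by rewrite (inner_eq0_sym lU (lx i) (hU i)) mulr0.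
Qed.

Lemma cspan_proj X : L2 P X ->
  exists2 Z, cspan x Z & forall j, inner P (X - Z) (cplx (x j)) = 0.
Proof.
move=> lX; move/L2P : (lX) => [rX iX].
have [a ha] := finite_proj sx rX; have [b hb] := finite_proj sx iX.
pose Z := \sum_i cscale (a i +i* b i) (cplx (x i)).
have cZ : cspan x Z by exists (fun i => a i +i* b i).
exists Z => // j; have lZ := cspan_L2 cZ.
have rZ : cre (X - Z) = cre X - \sum_i a i *: x i.
  rewrite cre_add cre_opp; congr (_ - _); rewrite /Z.
  rewrite (big_morph cre cre_add (erefl : cre 0 = 0)).
  by apply: eq_bigr => i _; rewrite cre_scale cre_cplx cim_cplx scaler0 subr0.
have iZ : cim (X - Z) = cim X - \sum_i b i *: x i.
  rewrite cim_add cim_opp; congr (_ - _); rewrite /Z.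
  rewrite (big_morph cim cim_add (erefl : cim 0 = 0)).
  by apply: eq_bigr => i _; rewrite cim_scale cre_cplx cim_cplx scaler0 add0r.
rewrite innerE//; last exact: L2B.
rewrite rZ iZ cre_cplx cim_cplx ha hb.
by rewrite (ipC P _ 0) (ipC P _ 0) !ip0l subr0 addr0.
Qed.

(** Conditional orthogonality may be checked on generators, provided that the
predictions of the generators from G3 lie in the span of finitely many variables
x of the closed span of G3: the prediction of any element of the two closed
spans is then its projection on that finite-dimensional span. In particular it
exists. *)
Lemma cond_orth_generators (I1 I2 : Type) (D1 : set I1) (D2 : set I2)
    (Y1 pr1 : I1 -> T -> R[i]) (Y2 pr2 : I2 -> T -> R[i]) (G3 : set (T -> R[i])) :
  (forall u, L2 P (Y1 u)) -> (forall u, L2 P (Y2 u)) -> L2set G3 ->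
  (forall i, closed_span P G3 (cplx (x i))) ->
  (forall u, D1 u -> cspan x (pr1 u) /\
     forall W, G3 W -> inner P (Y1 u - pr1 u) W = 0) ->
  (forall u, D2 u -> cspan x (pr2 u) /\
     forall W, G3 W -> inner P (Y2 u - pr2 u) W = 0) ->
  (forall u v, D1 u -> D2 v -> inner P (Y1 u - pr1 u) (Y2 v - pr2 v) = 0) ->
  cond_orth P (closed_span P (Y1 @` D1)) (closed_span P (Y2 @` D2)) (closed_span P G3).
Proof.
move=> L1 L2' L3 x3 hpr1 hpr2 h12.
have cspan3 Z : cspan x Z -> closed_span P G3 Z.
  by move=> [c ->]; apply: closed_span_sum => // i; exact: closed_spanZ.
pose predicted (J : Type) (D : set J) (Y pr : J -> T -> R[i]) :=
  (forall u, L2 P (Y u)) /\ forall u, D u -> cspan x (pr u) /\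
     forall W, G3 W -> inner P (Y u - pr u) W = 0.
have orth3 J (D : set J) (Y pr : J -> T -> R[i]) u W : predicted J D Y pr -> D u ->
    closed_span P G3 W -> inner P (Y u - pr u) W = 0.
  move=> [lY hpr] Du GW; have [cY oY] := hpr u Du.
  have lR : L2 P (Y u - pr u) by exact: L2B (lY u) (cspan_L2 cY).
  have lW := closed_span_L2 GW; apply: inner_eq0_sym => //.
  apply: (closed_span_orth L3 lR _ GW) => V GV; have lV := L3 V GV.
  by apply: inner_eq0_sym => //; exact: oY.
(* it suffices that a vector be orthogonal to x and to the prediction errors *)
have genE J (D : set J) (Y pr : J -> T -> R[i]) (Z U : T -> R[i]) : predicted J D Y pr ->
    closed_span P (Y @` D) Z -> L2 P U ->
    (forall i, inner P U (cplx (x i)) = 0) ->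
    (forall u, D u -> inner P (Y u - pr u) U = 0) -> inner P Z U = 0.
  move=> [lY hpr] GZ lU oU hU.
  have LG : L2set (Y @` D) by move=> _ [u _ <-].
  apply: (closed_span_orth LG lU _ GZ) => _ [u Du <-].
  have [cV _] := hpr u Du; have lpV := cspan_L2 cV.
  rewrite -[Y u](subrK (pr u)) innerDl//; last exact: L2B.
  by rewrite hU// add0r; exact: cspan_orth oU cV.
have projE J (D : set J) (Y pr : J -> T -> R[i]) (Z : T -> R[i]) : predicted J D Y pr -> closed_span P (Y @` D) Z ->
    exists Q, [/\ cspan x Q, forall j, inner P (Z - Q) (cplx (x j)) = 0 &
      is_proj (closed_span P G3) Z Q].
  move=> GG GZ; have lZ := closed_span_L2 GZ.
  have [Q cQ oQ] := cspan_proj lZ; exists Q; split => //; split; first exact: cspan3.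
  have lQ := cspan_L2 cQ; have lZQ := L2B lZ lQ => W GW; have lW := closed_span_L2 GW.
  have [V cV oV] := cspan_proj lW; have lV := cspan_L2 cV; have lWV := L2B lW lV.
  have -> : inner P (Z - Q) W = inner P (Z - Q) (W - V).
    rewrite innerBr0//; apply: inner_eq0_sym => //; exact: cspan_orth oQ cV.
  rewrite innerBl// (cspan_orth lWV oV cQ) subr0.
  apply: (genE J D Y pr Z (W - V) GG GZ lWV oV) => u Du.
  apply: (orth3 _ _ _ _ _ _ GG Du).
  by apply: closed_spanB => //; exact: cspan3.
have p1 : predicted I1 D1 Y1 pr1 by [].
have p2 : predicted I2 D2 Y2 pr2 by [].
move=> X Y GX GY.
have lX := closed_span_L2 GX; have lY := closed_span_L2 GY.
have [Z [cZ oZ pZ]] := projE _ _ _ _ X p1 GX.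
have [V [cV oV pV]] := projE _ _ _ _ Y p2 GY.
have lZ := cspan_L2 cZ; have lV := cspan_L2 cV.
have n0 U : cnull (U - U) by rewrite subrr; split; [exact: L20|exact: sqnm0].
have [lrX nX] := residual_unique L3 lX (n0 X) pZ.
have [lrY nY] := residual_unique L3 lY (n0 Y) pV.
rewrite (inner_cnull lrX lrY nX nY).
have lXZ := L2B lX lZ; have lYV := L2B lY lV.
rewrite innerBl// (cspan_orth lYV oV cZ) subr0.
apply: (genE _ _ _ _ X (Y - V) p1 GX lYV oV) => u Du.
have [cU _] := hpr1 u Du; have lR := L2B (L1 u) (cspan_L2 cU).
have oU3 W : closed_span P G3 W -> inner P (Y1 u - pr1 u) W = 0.
  exact: orth3 p1 Du.
rewrite innerBr0//; last exact/oU3/cspan3.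
apply: inner_eq0_sym => //.
apply: (genE _ _ _ _ Y _ p2 GY lR) => [i|v Dv]; first exact: oU3.
have [cW _] := hpr2 v Dv; have lRW := L2B (L2' v) (cspan_L2 cW).
by apply: inner_eq0_sym => //; exact: h12.
Qed.

End finite_cspan.

Lemma closed_span_sub (S S' : set (T -> R[i])) : S `<=` S' ->
  closed_span P S `<=` closed_span P S'.
Proof.
move=> SS X [lX h]; split=> // e /h[Z [n [c [W [SW ->]]]] XZ].
by exists (fun w => \sum_i c i * W i w) => //; exists n, c, W; split => // i; exact: SS.
Qed.

(** Mean-square limits are unique up to almost sure equality. *)
Lemma ms_derive_unique (V : R -> T -> R[i]) t D :
  (forall s, L2 P (V s)) -> L2 P D ->
  sqnm (cscale (h^-1)%:C (V (t + h) - V t) - D) @[h --> (0 : R)^'] --> (0 : R) ->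
  L2 P (ms_derive P V t) /\ cnull (ms_derive P V t - D).
Proof.
move=> lV lD VD; pose Q (h : R) := cscale (h^-1)%:C (V (t + h) - V t).
have lQ h : L2 P (Q h) by exact/L2Z/L2B.
pose lim Z := L2 P Z /\
  sqdist P (fun w => (h^-1)%:C * (V (t + h) w - V t w)) Z @[h --> (0 : R)^'] --> 0%E.
have sqE Z : L2 P Z -> (fun h : R => sqdist P (fun w => (h^-1)%:C * (V (t + h) w - V t w)) Z)
    = EFin \o (fun h => sqnm (Q h - Z)).
  by move=> lZ; apply/funext => h; rewrite /= -sqdistE.
have limD : lim D.
  split => //; rewrite sqE//; apply: cvg_EFin; [exact: nearW|exact: VD].
pose Z := ms_derive P V t.
have [lZ ZZ] : lim Z by apply: (@xgetPex _ (fun=> 0) lim); exists D.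
split=> //; split; first exact: L2B.
have {}ZZ : sqnm (Q h - Z) @[h --> (0 : R)^'] --> (0 : R).
  by move: ZZ; rewrite sqE// => /fine_cvgP[].
have lim2 : 2 * sqnm (Q h - Z) + 2 * sqnm (Q h - D) @[h --> (0 : R)^'] --> (0 : R).
  rewrite -[X in _ --> X]addr0; apply: cvgD.
    by rewrite -[X in _ --> X](mulr0 2); apply: cvgM => //; exact: cvg_cst.
  by rewrite -[X in _ --> X](mulr0 2); apply: cvgM => //; exact: cvg_cst.
apply/eqP; rewrite eq_le sqnm_ge0 andbT.
rewrite -(cvg_lim _ lim2)//; apply: limr_ge; first by apply/cvg_ex; eexists; exact: lim2.
apply: nearW => h.
have -> : Z - D = - (Q h - Z) + (Q h - D) by rewrite opprB subrKA.
rewrite -[X in 2 * X + _]sqnmN; last exact: L2B.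
by apply: sqnm_add_le; [apply/L2N/L2B|exact: L2B].
Qed.

End complex_L2.

Lemma cvg_real_complex (R : realType) (F : set_system R) (FF : Filter F) (f : R -> R) (l : R) :
  (f h @[h --> F] --> l) ->
  ((f h)%:C : R[i]^o) @[h --> F] --> (l%:C : R[i]^o).
Proof.
move=> fl; apply/(@cvgrPdist_lt _ R[i]^o) => e e0.
have [e' e'0 ->] : exists2 e' : R, 0 < e' & e = e'%:C.
  by move: e0; case: e => r i; rewrite ltcE /= => /andP[/eqP -> r0]; exists r.
move/cvgrPdist_lt/(_ e' e'0) : fl; apply: filterS => h.
by rewrite -rmorphB normc_def /= expr0n /= addr0 sqrtr_sqr ltcR.
Qed.

(** * Integrals of continuous functions over an interval *)

Section lebesgue_integrals.
Variable R : realType.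
Local Notation mu := (@lebesgue_measure R).

Lemma lebesgue_measure_shift (t : R) (A : set R) : measurable A ->
  pushforward mu ((fun v => v + t) : R -> measurableTypeR R) A = mu A.
Proof.
have mphi : measurable_fun [set: R] ((fun v => v + t) : R -> measurableTypeR R).
  by apply: measurable_funD => //; exact: measurable_cst.
move=> mA; apply/esym/lebesgue_measure_unique => //= _ [[a b]] _ <-.
rewrite /pushforward.
have -> : (fun v => v + t) @^-1` `]a, b]%classic = `]a - t, b - t]%classic.
  by apply/seteqP; split => v /=; rewrite !in_itv/= ltrBlDr lerBrDr.
rewrite !lebesgue_measure_itv/= !lte_fin ltrD2r -!EFinD.
by rewrite opprB addrA subrK.
Qed.

Lemma continuous_integrable_itv (q : R -> R) (m : R) : continuous q ->
  mu.-integrable `[0, m] (EFin \o q).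
Proof.
move=> cq; apply: continuous_compact_integrable; first exact: segment_compact.
exact: continuous_subspaceT.
Qed.

Lemma Rintegral_shift (q : R -> R) (t m : R) : continuous q ->
  \int[mu]_u (\1_`]t, t + m] u * q (u - t)) = \int[mu]_(v in `[0, m]) q v.
Proof.
move=> cq; have iq := continuous_integrable_itv m cq.
have iq' : mu.-integrable `]0, m] (EFin \o q).
  by apply: integrableS iq => //; exact: subset_itv_oc_cc.
rewrite -(Rintegral_itv_obnd_cbnd iq').
have -> : \int[mu]_u (\1_`]t, t + m] u * q (u - t)) =
    \int[mu]_(u in `]t, t + m]) q (u - t).
  rewrite [RHS]Rintegral_mkcond; apply: eq_Rintegral => u _.
  by rewrite patchE indicE; case: (u \in _); rewrite ?mul1r ?mul0r.
pose phi : R -> measurableTypeR R := fun v => v + t.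
have mq : measurable_fun [set: R] (fun u => (q (u - t))%:E).
  apply/measurable_EFinP; apply: continuous_measurable_fun => u.
  apply: (@continuous_comp _ _ _ (fun u => u - t) q); last exact: cq.
  by apply: continuousB; [exact: cvg_id|exact: cst_continuous].
have pre : phi @^-1` `]t, t + m]%classic = `]0, m]%classic.
  by apply/seteqP; split => v /=; rewrite !in_itv/= ltrDr [t + m]addrC lerD2r.
have mphi : measurable_fun [set: R] phi.
  by apply: measurable_funD => //; exact: measurable_cst.
rewrite /Rintegral; congr fine.
transitivity (\int[pushforward mu phi]_(u in `]t, (t + m)%R]) (q (u - t)%R)%:E)%E.
  by apply: eq_measure_integral => A mA _; exact/esym/lebesgue_measure_shift.
rewrite integral_pushforward//.
  by rewrite pre; apply: eq_integral => v _; rewrite /= /phi addrK.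
rewrite pre; apply: eq_integrable iq' => // v _; rewrite /= /phi addrK//.
Qed.

Lemma Rintegral_sum_continuous (I : Type) (r : seq I) (F : I -> R -> R) (m : R) :
  (forall i, continuous (F i)) ->
  \int[mu]_(u in `[0, m]) (\sum_(i <- r) F i u) =
  \sum_(i <- r) \int[mu]_(u in `[0, m]) F i u.
Proof.
move=> cF; elim: r => [|i r IH].
  rewrite big_nil /Rintegral integral0_eq// => u _; by rewrite big_nil.
rewrite big_cons -IH -RintegralD//.
- by apply: eq_Rintegral => u _; rewrite big_cons.
- exact: continuous_integrable_itv.
apply: continuous_integrable_itv.
have -> : (fun u => \sum_(j <- r) F j u) = \sum_(j <- r) F j.
  by apply/funext => u; rewrite fct_sumE.
apply: (big_ind (fun f : R -> R => continuous f)) => [x|f g cf cg x|j _ //].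
  exact: cst_continuous.
by apply: continuousD; [exact: cf|exact: cg].
Qed.

Lemma Rintegral_average (q : R -> R) : continuous q ->
  h^-1 * \int[mu]_(v in `[0, h]) q (h - v) @[h --> (0 : R)^'+] --> q 0.
Proof.
move=> cq; apply/cvgrPdist_le => e e0.
have /cvgrPdist_le/(_ e e0)[r /= r0 hr] := cq 0.
near=> h.
have h0 : 0 < h by near: h; exact: nbhs_right_gt.
have hlt : h < r by near: h; exact: nbhs_right_lt.
have cqh : continuous (fun v => q (h - v)).
  move=> v; apply: (@continuous_comp _ _ _ (fun v => h - v) q); last exact: cq.
  by apply: continuousB; [exact: cst_continuous|exact: cvg_id].
have iq := continuous_integrable_itv h cqh.
have ic (c : R) : mu.-integrable `[0, h] (EFin \o (fun=> c)).
  by apply: continuous_integrable_itv; exact: cst_continuous.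
have muh : fine (mu `[0, h]%classic) = h.
  by rewrite lebesgue_measure_itv/= lte_fin h0 sube0.
have near0 v : `[0, h]%classic v -> q 0 - e <= q (h - v) <= q 0 + e.
  rewrite /= in_itv/= => /andP[v0 vh].
  have : `|q 0 - q (h - v)| <= e.
    apply: hr; rewrite /= sub0r normrN ger0_norm ?subr_ge0//.
    by rewrite (le_lt_trans _ hlt)// gerBl.
  by rewrite ler_distl lerBlDr => /andP[? ?]; lra.
have lb : (q 0 - e) * h <= \int[mu]_(v in `[0, h]) q (h - v).
  rewrite -[X in _ * X]muh -Rintegral_cst//; apply: le_Rintegral => // v /near0.
  by case/andP.
have ub : \int[mu]_(v in `[0, h]) q (h - v) <= (q 0 + e) * h.
  rewrite -[X in _ * X]muh -Rintegral_cst//; apply: le_Rintegral => // v /near0.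
  by case/andP.
rewrite mulrC ler_distl.
have ub' : \int[mu]_(v in `[0, h]) q (h - v) / h <= q 0 + e by rewrite ler_pdivrMr.
have lb' : q 0 - e <= \int[mu]_(v in `[0, h]) q (h - v) / h by rewrite ler_pdivlMr.
by rewrite lerBlDr ub' -lerBlDr lb'.
Unshelve. all: by end_near. Qed.

End lebesgue_integrals.

(** * Innovations of a linear state-space process *)

Section state_space.
Context d (T : measurableType d) (R : realType) (P : probability T R).
Variables (n k : nat) (A : 'M[R]_n) (B : 'M[R]_(n, k)).
Variables (L : R -> T -> 'cV[R]_k) (X : R -> T -> 'cV[R]_n).
Hypothesis hL : two_sided_levy P L.
Hypothesis hc : levy_centered P L.
Hypothesis h2 : levy_square_integrable P L.
Local Notation mu := (@lebesgue_measure R).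
Local Notation Sigma := (Sigma_L P L).

Definition causal_kernel (t u : R) : 'M[R]_(n, k) :=
  if u <= t then expmx ((t - u) *: A) *m B else 0.

Hypothesis hX : forall t, is_levy_integral P L (causal_kernel t) (X t).

Definition impulse (s : R) (i : 'I_n) (l : 'I_k) : R := (expmx (s *: A) *m B) i l.

Lemma continuous_impulse i l : continuous (fun s => impulse s i l).
Proof.
have -> : (fun s => impulse s i l) =
    \sum_j (fun s => expmx (s *: A) i j * B j l).
  by apply/funext => s; rewrite /impulse mxE fct_sumE.
apply: (big_ind (fun f : R -> R => continuous f)) => [x|f g cf cg x|j _ x].
- exact: cst_continuous.
- by apply: continuousD; [exact: cf|exact: cg].
- by apply: continuousM; [exact: continuous_expmx|exact: cst_continuous].
Qed.

Lemma measurable_impulse t i l : measurable_fun setT (fun u : R => impulse (t - u) i l).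
Proof.
apply: continuous_measurable_fun => u.
apply: (@continuous_comp _ _ _ (fun u => t - u) (fun s => impulse s i l)).
  by apply: continuousB; [exact: cst_continuous|exact: cvg_id].
exact: continuous_impulse.
Qed.

Lemma measurable_causal_kernel t i l :
  measurable_fun setT (fun u => causal_kernel t u i l).
Proof.
have -> : (fun u => causal_kernel t u i l) =
    (fun u => \1_`]-oo, t] u * impulse (t - u) i l).
  apply/funext => u; rewrite /causal_kernel indicE mem_setE in_itv/=.
  by case: ifP => _; rewrite ?mul1r// mxE mul0r.
apply: measurable_funM; first exact: measurable_indic.
exact: measurable_impulse.
Qed.

Local Notation x := (coord X).
Let f t i l : R -> R := fun u => causal_kernel t u i l.

Lemma sqi_state t i : sqi P (x t i).
Proof.
have [phi [_ h _]] := levy_integral_approx hL hc h2 (measurable_causal_kernel t) (hX t).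
by have [] := h i.
Qed.

Let sf t i l : sqi mu (f t i l).
Proof.
have [phi [_ _ h]] := levy_integral_approx hL hc h2 (measurable_causal_kernel t) (hX t).
by have [] := h i l.
Qed.

Let state_cov s t i j : ip P (x s i) (x t j) = sigma_form P L (f s i) (f t j).
Proof.
exact: (levy_isometry hL hc h2 i j (measurable_causal_kernel s)
  (measurable_causal_kernel t) (hX s) (hX t)).
Qed.

(** The error of the prediction of X t at time s. It also makes sense for t < s,
which serves for difference quotients from the left; the Levy integral that it
equals then runs from t to s with the opposite sign, as in innovation_kernel. *)
Definition innovation (s t : R) (i : 'I_n) : T -> R :=
  x t i - \sum_j expmx ((t - s) *: A) i j *: x s j.

Definition innovation_kernel (s t : R) (i : 'I_n) (l : 'I_k) : R -> R :=
  fun u => (\1_`]s, t] u - \1_`]t, s] u) * impulse (t - u) i l.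

Let coef s t i (a : option 'I_n) : R :=
  if a is Some j then - expmx ((t - s) *: A) i j else 1.

Lemma innovation_kernelE s t i l : innovation_kernel s t i l =
  f t i l - \sum_j expmx ((t - s) *: A) i j *: f s j l.
Proof.
apply/funext => u.
rewrite -[RHS]/(causal_kernel t u i l - (\sum_j expmx ((t - s) *: A) i j *: f s j l) u).
rewrite fct_sumE.
have -> : \sum_j (expmx ((t - s) *: A) i j *: f s j l) u =
    if u <= s then impulse (t - u) i l else 0.
  rewrite /f /causal_kernel; have [us|us] := boolP (u <= s); last first.
    by apply: big1 => j _; rewrite -[LHS]/(_ * (if u <= s then _ else _ : 'M[R]_(n, k)) j l) (negbTE us) mxE mulr0.
  have -> : t - u = (t - s) + (s - u) by rewrite subrKA.
  rewrite /impulse (expmxD A (t - s) (s - u)) -mulmxA [RHS]mxE; apply: eq_bigr => j _.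
  by rewrite -[LHS]/(_ * (if u <= s then _ else _ : 'M[R]_(n, k)) j l) us.
rewrite /innovation_kernel /causal_kernel !indicE !mem_setE !in_itv/= /impulse.
by case: (leP u t) => ut; case: (leP u s) => us /=; rewrite ?mxE; ring.
Qed.

Lemma sqi_innovation s t i : sqi P (innovation s t i).
Proof.
apply: sqiB; first exact: sqi_state.
by apply: sqi_sum => j; apply: sqiZ; exact: sqi_state.
Qed.

Lemma sqi_innovation_kernel s t i l : sqi mu (innovation_kernel s t i l).
Proof.
rewrite innovation_kernelE; apply: sqiB; first exact: sf.
by apply: sqi_sum => j; apply: sqiZ; exact: sf.
Qed.

Let Zfam s t i (a : option 'I_n) : T -> R := if a is Some j then x s j else x t i.
Let ffam s t i (a : option 'I_n) : 'I_k -> R -> R := if a is Some j then f s j else f t i.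

Let sum_option (V : zmodType) (F : option 'I_n -> V) :
  \sum_a F a = F None + \sum_j F (Some j).
Proof.
rewrite (bigD1 None)//=; congr (_ + _); rewrite (reindex_omap Some id) => [|[]]//.
by apply: eq_bigl => j; rewrite eqxx.
Qed.

Let innovation_comb s t i : innovation s t i = \sum_a coef s t i a *: Zfam s t i a.
Proof.
rewrite sum_option /= scale1r; congr (_ + _); rewrite -sumrN.
by apply: eq_bigr => j _; rewrite scaleNr.
Qed.

Let innovation_kernel_comb s t i l :
  innovation_kernel s t i l = \sum_a coef s t i a *: ffam s t i a l.
Proof.
rewrite innovation_kernelE sum_option /= scale1r; congr (_ + _); rewrite -sumrN.
by apply: eq_bigr => j _; rewrite scaleNr.
Qed.

Let sZ s t i a : sqi P (Zfam s t i a).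
Proof. by case: a => [j|]; exact: sqi_state. Qed.
Let sff s t i a l : sqi mu (ffam s t i a l).
Proof. by case: a => [j|]; exact: sf. Qed.

Lemma innovation_cov s t i s' t' j : ip P (innovation s t i) (innovation s' t' j) =
  sigma_form P L (innovation_kernel s t i) (innovation_kernel s' t' j).
Proof.
have sc a b : ip P (Zfam s t i a) (Zfam s' t' j b) =
    sigma_form P L (ffam s t i a) (ffam s' t' j b).
  by case: a b => [a|] [b|]; exact: state_cov.
rewrite !innovation_comb (levy_isometry_comb (coef s t i) (coef s' t' j)
  (sZ s t i) (sZ s' t' j) (sff s t i) (sff s' t' j) sc).
by congr sigma_form; apply/funext => l; exact/esym/innovation_kernel_comb.
Qed.

Lemma innovation_state_cov s t i r j : ip P (innovation s t i) (x r j) =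
  sigma_form P L (innovation_kernel s t i) (f r j).
Proof.
have e : ip P (innovation s t i) (\sum_(b < 1) (1 : R) *: x r j) =
    sigma_form P L (innovation_kernel s t i) (fun l => \sum_(b < 1) (1 : R) *: f r j l).
  have sc a (b : 'I_1) : ip P (Zfam s t i a) (x r j) = sigma_form P L (ffam s t i a) (f r j).
    by case: a => [a|]; exact: state_cov.
  rewrite innovation_comb (levy_isometry_comb (coef s t i) (fun=> 1)
    (sZ s t i) (fun=> sqi_state r j) (sff s t i) (fun=> sf r j) sc).
  by congr sigma_form; apply/funext => l; exact/esym/innovation_kernel_comb.
rewrite big_ord1 scale1r in e; rewrite e; congr sigma_form.
by apply/funext => l; rewrite big_ord1 scale1r.
Qed.

(** The integrands of the innovation and of the past state have disjoint
supports. *)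
Lemma innovation_orth s t i r j : r <= s -> s <= t ->
  ip P (innovation s t i) (x r j) = 0.
Proof.
move=> rs st; rewrite innovation_state_cov /sigma_form.
apply: big1 => l _; apply: big1 => l' _.
have -> : ip mu (innovation_kernel s t i l) (f r j l') = 0.
  rewrite /ip /Rintegral integral0_eq// => u _.
  rewrite /innovation_kernel /f /causal_kernel !indicE !mem_setE !in_itv/=.
  case: (leP u r) => ur; last by rewrite mxE mulr0.
  have us := le_trans ur rs; have ut := le_trans us st.
  by rewrite [s < u]ltNge [t < u]ltNge us ut /= subrr !mul0r.
by rewrite mulr0.
Qed.

Lemma innovation_kernel_ge0 t h i l : 0 <= h ->
  innovation_kernel t (t + h) i l =
  fun u => \1_`]t, t + h] u * impulse (t + h - u) i l.
Proof.
move=> h0; apply/funext => u; rewrite /innovation_kernel.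
rewrite [X in (_ - X) * _]indicE mem_setE in_itv/=.
case: (ltP (t + h) u) => //= tu; last by rewrite subr0.
by rewrite leNgt (le_lt_trans _ tu) ?lerDl// subr0.
Qed.

Lemma innovation_cov_integral t h h' i j : 0 <= h -> 0 <= h' ->
  ip P (innovation t (t + h) i) (innovation t (t + h') j) =
  \int[mu]_(u in `[0, Num.min h h'])
    (\sum_l \sum_l' Sigma l l' * (impulse (h - u) i l * impulse (h' - u) j l')).
Proof.
move=> h0 h'0; rewrite innovation_cov /sigma_form.
have cimp a (r : R) l : continuous (fun u => impulse (r - u) a l).
  move=> u; apply: (@continuous_comp _ _ _ (fun u => r - u) (fun s => impulse s a l)).
    by apply: continuousB; [exact: cst_continuous|exact: cvg_id].
  exact: continuous_impulse.
have cq l l' : continuous (fun u => impulse (h - u) i l * impulse (h' - u) j l').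
  by move=> u; apply: continuousM; exact: cimp.
have csq l l' : continuous (fun u =>
    Sigma l l' * (impulse (h - u) i l * impulse (h' - u) j l')).
  by move=> u; apply: cvgM; [exact: cvg_cst|exact: cq].
rewrite Rintegral_sum_continuous; last first.
  move=> l.
  have -> : (fun u => \sum_l' Sigma l l' * (impulse (h - u) i l * impulse (h' - u) j l')) =
      \sum_l' (fun u => Sigma l l' * (impulse (h - u) i l * impulse (h' - u) j l')).
    by apply/funext => u; rewrite fct_sumE.
  apply: (big_ind (fun f : R -> R => continuous f)) => [x|f' g cf cg x|l' _ //].
    exact: cst_continuous.
  by apply: continuousD; [exact: cf|exact: cg].
apply: eq_bigr => l _; rewrite Rintegral_sum_continuous//.
apply: eq_bigr => l' _; rewrite RintegralZl//; last exact: continuous_integrable_itv.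
congr (_ * _).
rewrite -(Rintegral_shift t (Num.min h h') (cq l l')).
rewrite (innovation_kernel_ge0 t i l h0) (innovation_kernel_ge0 t j l' h'0).
apply: eq_Rintegral => u _; rewrite mulrACA.
have -> : \1_`]t, t + h] u * \1_`]t, t + h'] u = \1_`]t, t + Num.min h h'] u :> R.
  rewrite !indicE -natrM mulnb !mem_setE !in_itv/= addr_minr le_min.
  by case: (t < u).
by rewrite opprB ![t + _ - u]addrAC ![h + _]addrC ![h' + _]addrC ![t - u + _]addrC !addrA.
Qed.

(** The covariance is the integral over `[0, h] of a continuous function of h - u
whose value at 0 is the limit. *)
Lemma innovation_cov_average t i j :
  (h^-1 * ip P (innovation t (t + h) i) (innovation t (t + h) j)) @[h --> (0 : R)^'+]
  --> (B *m Sigma *m B^T) i j.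
Proof.
pose q s := \sum_l \sum_l' Sigma l l' * (impulse s i l * impulse s j l').
have cq : continuous q.
  have -> : q = \sum_l \sum_l' (fun s => Sigma l l' * (impulse s i l * impulse s j l')).
    apply/funext => u; rewrite fct_sumE; apply: eq_bigr => l _.
    by rewrite fct_sumE.
  apply: (big_ind (fun f : R -> R => continuous f)) => [x|f' g cf cg x|l _].
  - exact: cst_continuous.
  - by apply: continuousD; [exact: cf|exact: cg].
  apply: (big_ind (fun f : R -> R => continuous f)) => [x|f' g cf cg x|l' _ x].
  - exact: cst_continuous.
  - by apply: continuousD; [exact: cf|exact: cg].
  apply: cvgM; first exact: cvg_cst.
  by apply: cvgM; exact: continuous_impulse.
have -> : (B *m Sigma *m B^T) i j = q 0.
  rewrite /q /impulse expmx0 mul1mx mxE exchange_big; apply: eq_bigr => l' _ /=.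
  rewrite !mxE mulr_suml; apply: eq_bigr => l _; rewrite !mxE; ring.
apply: cvg_trans (Rintegral_average cq); apply: near_eq_cvg.
near=> h; have h0 : 0 < h by near: h; exact: nbhs_right_gt.
by rewrite innovation_cov_integral ?ltW// minxx.
Unshelve. all: by end_near. Qed.

Lemma ip_le_itv (g : R -> R) (M a b : R) : sqi mu g -> a <= b ->
  (forall u, `|g u| <= M * \1_`]a, b] u) -> ip mu g g <= M ^+ 2 * (b - a).
Proof.
move=> sg ab gM; have si := sqi_indic_itv a b; have sMi := sqiZ M si.
have -> : M ^+ 2 * (b - a) = ip mu (M *: \1_`]a, b]) (M *: \1_`]a, b]).
  rewrite (ipZl _ si sMi) (ipZr _ si si) ip_indic_itv minxx maxxx max_r ?subr_ge0//.
  by rewrite mulrA.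
apply: le_Rintegral => //; [exact: integrable_ip|exact: integrable_ip|].
move=> u _; rewrite -[leRHS]/((M * \1_`]a, b] u) * (M * \1_`]a, b] u)).
by rewrite -!expr2 -real_normK ?num_real// lerXn2r ?nnegrE// (le_trans _ (gM u)).
Qed.

(** If row i of B vanishes, row i of exp(sA) B is O(s); its square is integrated
over an interval of length |h|. *)
Lemma innovation_small t i : (forall l, B i l = 0) ->
  exists K : R, \forall h \near (0 : R),
    ip P (innovation t (t + h) i) (innovation t (t + h) i) <= K * `|h| ^+ 3.
Proof.
move=> Bi; have [C C0 [r /= r0 Hr]] := expmx_lipschitz A.
pose b := \sum_j \sum_l `|B j l|.
have b0 : 0 <= b by apply: sumr_ge0 => j _; apply: sumr_ge0.
have small s l : `|s| < r -> `|impulse s i l| <= C * b * `|s|.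
  move=> sr; have hs : forall i j, `|expmx (s *: A) i j - (1%:M : 'M[R]_n) i j| <= C * `|s|.
    by apply: Hr; rewrite /= sub0r normrN.
  have -> : impulse s i l = \sum_j (expmx (s *: A) i j - (1%:M : 'M[R]_n) i j) * B j l.
    have e1 : \sum_j (1%:M : 'M[R]_n) i j * B j l = 0.
      by rewrite -[RHS](Bi l) -[in RHS](mul1mx B) mxE.
    rewrite /impulse mxE -[LHS]subr0 -[X in _ - X]e1.
    by rewrite -sumrB; apply: eq_bigr => j _; rewrite mulrBl.
  apply: le_trans (ler_norm_sum _ _ _) _.
  rewrite mulrAC /b mulr_sumr; apply: ler_sum => j _; rewrite normrM.
  apply: ler_pM => //; rewrite (bigD1 l)//= lerDl; exact: sumr_ge0.
pose SS := \sum_l \sum_l' `|Sigma l l'|.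
exists (SS * (C * b) ^+ 2); exists r => //= h /=; rewrite sub0r normrN => hr.
have gle l u : `|innovation_kernel t (t + h) i l u| <=
    (C * b * `|h|) * \1_`]Num.min t (t + h), Num.max t (t + h)] u.
  have imp : Num.min t (t + h) <= u <= Num.max t (t + h) ->
      `|impulse (t + h - u) i l| <= C * b * `|h|.
    have [h0|h0] := leP 0 h.
      rewrite min_l ?max_r ?lerDl// => /andP[u1 u2].
      have s0 : 0 <= t + h - u by rewrite subr_ge0.
      have sh : `|t + h - u| <= `|h| by rewrite !ger0_norm//; lra.
      apply: le_trans (small _ _ (le_lt_trans sh hr)) _.
      by rewrite ler_wpM2l// mulr_ge0// ltW.
    rewrite min_r ?max_l ?gerDl ?(ltW h0)// => /andP[u1 u2].
    have s0 : t + h - u <= 0 by rewrite subr_le0.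
    have sh : `|t + h - u| <= `|h| by rewrite !ler0_norm ?(ltW h0)//; lra.
    apply: le_trans (small _ _ (le_lt_trans sh hr)) _.
    by rewrite ler_wpM2l// mulr_ge0// ltW.
  have Cbh : 0 <= C * b * `|h| by rewrite !mulr_ge0// ltW.
  rewrite /innovation_kernel !indicE !mem_setE !in_itv/=.
  move: imp; have [h0|h0] := leP 0 h.
    rewrite min_l ?max_r ?lerDl// => imp.
    rewrite [X in _ - X](_ : _ = 0); last first.
      by case: (ltP (t + h) u) => //= tu; rewrite leNgt (le_lt_trans _ tu) ?lerDl.
    rewrite subr0; case: (boolP (t < u <= t + h)) => /= [/andP[u1 u2]|_]; last first.
      by rewrite mul0r normr0 mulr0.
    by rewrite mul1r mulr1 imp// u2 ltW.
  rewrite min_r ?max_l ?gerDl ?(ltW h0)// => imp.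
  rewrite [X in X - _](_ : _ = 0); last first.
    by case: (ltP t u) => //= tu; rewrite leNgt (le_lt_trans _ tu)// gerDl ltW.
  rewrite sub0r; case: (boolP (t + h < u <= t)) => /= [/andP[u1 u2]|_]; last first.
    by rewrite oppr0 mul0r normr0 mulr0.
  by rewrite mulN1r normrN mulr1 imp// u2 ltW.
have sk l := sqi_innovation_kernel t (t + h) i l.
have gg l : ip mu (innovation_kernel t (t + h) i l) (innovation_kernel t (t + h) i l)
    <= (C * b) ^+ 2 * `|h| ^+ 3.
  have ab : Num.min t (t + h) <= Num.max t (t + h) by rewrite le_max ge_min lexx.
  apply: le_trans (ip_le_itv (sk l) ab (gle l)) _.
  have -> : Num.max t (t + h) - Num.min t (t + h) = `|h|.
    have [h0|h0] := leP 0 h.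
      by rewrite max_r ?min_l ?lerDl// ger0_norm// addrC addKr.
    by rewrite max_l ?min_r ?gerDl ?(ltW h0)// ltr0_norm// opprD addNKr.
  by rewrite exprMn -mulrA -exprSr.
have K0 : 0 <= (C * b) ^+ 2 * `|h| ^+ 3 by rewrite mulr_ge0// ?sqr_ge0// exprn_ge0.
rewrite innovation_cov /sigma_form -mulrA /SS mulr_suml.
apply: ler_sum => l _; rewrite mulr_suml; apply: ler_sum => l' _.
apply: le_trans (ler_norm _) _; rewrite normrM ler_wpM2l//.
apply: le_trans (ip_cauchy_schwarz (sk l) (sk l')) _.
rewrite -[leRHS]sqr_sqrtr// expr2.
by apply: ler_pM; rewrite ?sqrtr_ge0// ler_wsqrtr.
Qed.

(** The increment of the state is the innovation, of variance O(h^3) here, plus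
(exp(hA) - 1) X t, whose quotient by h converges to A X t. *)
Lemma state_ms_derivative t i : (forall l, B i l = 0) ->
  let D h := h^-1 *: (x (t + h) i - x t i) - \sum_j A i j *: x t j in
  ip P (D h) (D h) @[h --> (0 : R)^'] --> (0 : R).
Proof.
move=> Bi D; have [K [r /= r0 HK]] := innovation_small t Bi.
pose c (h : R) j := h^-1 * (expmx (h *: A) i j - (1%:M : 'M[R]_n) i j) - A i j.
pose S (h : R) := \sum_j c h j *: x t j.
have sx s j : sqi P (x s j) := sqi_state s j.
have sS h : sqi P (S h) by apply: sqi_sum => j; exact: sqiZ.
have sN h := sqi_innovation t (t + h) i.
have DE h : D h = h^-1 *: innovation t (t + h) i + S h.
  have -> : S h = h^-1 *: (\sum_j expmx (h *: A) i j *: x t j - x t i)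
      - \sum_j A i j *: x t j.
    have -> : x t i = \sum_j (1%:M : 'M[R]_n) i j *: x t j.
      rewrite (bigD1 i)//= mxE eqxx scale1r big1 ?addr0// => j ji.
      by rewrite mxE eq_sym (negbTE ji) scale0r.
    rewrite -sumrB scaler_sumr -sumrB; apply: eq_bigr => j _.
    by rewrite /c scalerBl -(scalerBl (expmx (h *: A) i j)) scalerA.
  rewrite addrA -scalerDr /innovation [t + h - t]addrAC subrr add0r.
  by rewrite subrKA.
have S0 : ip P (S h) (S h) @[h --> (0 : R)^'] --> (0 : R).
  have c0 j : c h j @[h --> (0 : R)^'] --> (0 : R).
    rewrite -[X in _ --> X](subrr (A i j)); apply: cvgB; last exact: cvg_cst.
    exact: expmx_diff_quotient.
  have -> : (fun h => ip P (S h) (S h)) =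
      fun h => \sum_j \sum_j' c h j * (c h j' * ip P (x t j) (x t j')).
    apply/funext => h; rewrite ip_suml//; last by move=> j; exact: sqiZ.
    apply: eq_bigr => j _; rewrite ip_sumr//; [|by move=> j'; exact: sqiZ|exact: sqiZ].
    apply: eq_bigr => j' _.
    by rewrite (ipZl _ (sx t j) (sqiZ _ (sx t j'))) (ipZr _ (sx t j') (sx t j)).
  have e0 : \sum_(j < n) \sum_(j' < n) 0 * (0 * ip P (x t j) (x t j')) = (0 : R).
    by rewrite big1// => j _; rewrite big1// => j' _; rewrite mul0r.
  rewrite -[X in _ --> X]e0.
  apply: cvg_big => [|j _]; first exact: add_continuous.
  apply: cvg_big => [|j' _]; first exact: add_continuous.
  by apply: cvgM; [exact: c0|apply: cvgM; [exact: c0|exact: cvg_cst]].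
have U0 : 2 * (K * `|h|) + 2 * ip P (S h) (S h) @[h --> (0 : R)^'] --> (0 : R).
  rewrite -[X in _ --> X]addr0; apply: cvgD.
    rewrite -[X in _ --> X](mulr0 2); apply: cvgM; first exact: cvg_cst.
    rewrite -[X in _ --> X](mulr0 K); apply: cvgM; first exact: cvg_cst.
    rewrite -[X in _ --> X](normr0 R); apply: cvg_norm; exact: cvg_within.
  by rewrite -[X in _ --> X](mulr0 2); apply: cvgM; first exact: cvg_cst.
apply: (@squeeze_cvgr _ _ _ _ (fun=> 0) _ _ _ _ _ U0); last exact: cvg_cst.
have cancel3 (y : R) : y != 0 -> y^-1 ^+ 2 * (K * y ^+ 3) = K * y.
  by move=> y0; field.
near=> h; rewrite ip_ge0/= DE.
have h0 : h != 0 by near: h; exact: nbhs_dnbhs_neq.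
have hr : `|h| < r.
  near: h; apply: dnbhs0_lt; exact: r0.
apply: le_trans (ip_add_le (sqiZ _ (sN h)) (sS h)) _.
rewrite lerD2r ler_wpM2l//.
rewrite (ipZl _ (sN h) (sqiZ _ (sN h))) (ipZr _ (sN h) (sN h)) mulrA -expr2.
have hh : 0 <= (h^-1) ^+ 2 by exact: sqr_ge0.
apply: (@le_trans _ _ ((h^-1) ^+ 2 * (K * `|h| ^+ 3))).
  by rewrite ler_wpM2l//; apply: HK; rewrite /= sub0r normrN.
rewrite -[(h^-1) ^+ 2]real_normK ?num_real// normfV.
by rewrite cancel3// normr_eq0.
Unshelve. all: by end_near. Qed.

End state_space.

(** * The blocks of the companion form *)

Section companion_indices.
Variables (R : realType) (k p : nat).
Implicit Types (j : 'I_p) (v : 'I_k).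

Definition block_index j v : 'I_(\sum_(i < p) k) :=
  @tagnat.Rank p (fun=> k) j v.

Lemma sig1_block_index j v : tagnat.sig1 (block_index j v) = j.
Proof. exact: tagnat.Rank1K. Qed.

Lemma sig2_block_index j v : tagnat.sig2 (block_index j v) = v :> 'I_k.
Proof. by apply: val_inj; rewrite /block_index tagnat.Rank2K. Qed.

Lemma mcar_B_block j v l :
  (mcar_B : 'M[R]_(_, k)) (block_index j v) l = (if j.+1 == p then (v == l)%:R else 0).
Proof.
rewrite mxE sig1_block_index sig2_block_index.
by case: ifP => _; rewrite mxE.
Qed.

Lemma block_indexP (i : 'I_(\sum_(i < p) k)) : exists j v, i = block_index j v.
Proof. by exists (tagnat.sig1 i), (tagnat.sig2 i); rewrite /block_index tagnat.sig2K. Qed.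

Lemma eq_block_index j v (i : 'I_(\sum_(i < p) k)) :
  (i == block_index j v) = (tagnat.sig1 i == j) && ((tagnat.sig2 i : 'I_k) == v).
Proof.
apply/eqP/andP => [->|[/eqP i1 /eqP i2]].
  by rewrite sig1_block_index sig2_block_index !eqxx.
by have [j' [v' e]] := block_indexP i; move: i1 i2; rewrite e sig1_block_index sig2_block_index => -> ->.
Qed.

Lemma mcar_C_mul m (M : 'M[R]_(_, m)) j0 v c : val j0 = 0%N ->
  (mcar_C *m M) v c = M (block_index j0 v) c.
Proof.
move=> j00; rewrite mxE (bigD1 (block_index j0 v))//= mxE.
rewrite sig1_block_index sig2_block_index j00 eqxx mxE eqxx mul1r.
rewrite [X in _ + X]big1 ?addr0// => i; rewrite eq_block_index negb_and => ne.
rewrite mxE; case: eqP => [e0|_]; last by rewrite mxE mul0r.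
rewrite mxE eq_sym; suff /negbTE -> : (tagnat.sig2 i : 'I_k) != v by rewrite mul0r.
by move: ne; case: eqP => //= -[]; apply: val_inj; rewrite j00.
Qed.

Lemma companion_shift (A_ : 'I_p -> 'M[R]_k) j j' v i : val j' = j.+1 ->
  companion A_ (block_index j v) i = (i == block_index j' v)%:R.
Proof.
move=> jj'; rewrite mxE sig1_block_index sig2_block_index eq_block_index.
rewrite ifF; last by apply/negbTE; rewrite neq_ltn -jj' (ltn_ord j').
rewrite -jj' (inj_eq val_inj); case: eqP => _ /=; last by rewrite mxE.
by rewrite mxE eq_sym.
Qed.

End companion_indices.

(** * The state and the observations of an MCAR process *)

Section mcar_process.
Context d (T : measurableType d) (R : realType) (P : probability T R).
Variables (k p : nat) (A_ : 'I_p -> 'M[R]_k) (L Y : R -> T -> 'cV[R]_k).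
Variable X : R -> T -> 'cV[R]_(\sum_(i < p) k).
Hypothesis hL : two_sided_levy P L.
Hypothesis hc : levy_centered P L.
Hypothesis h2 : levy_square_integrable P L.
Local Notation A := (companion A_).
Local Notation B := (mcar_B : 'M[R]_(\sum_(i < p) k, k)).
Hypothesis hX : forall t, is_levy_integral P L (causal_kernel A B t) (X t).
Hypothesis hY : forall t w, Y t w = mcar_C *m X t w.
Local Notation x := (coord X).
Local Notation idx := (@block_index k p).

Let sx t i : sqi P (x t i). Proof. exact: sqi_state hL hc h2 hX t i. Qed.
Let lx t i : L2 P (cplx (x t i)). Proof. exact/L2_cplx. Qed.

Lemma component_state v t j0 : val j0 = 0%N -> component Y v t = cplx (x t (idx j0 v)).
Proof.
by move=> j00; apply/funext => w; rewrite /component hY (mcar_C_mul _ _ _ j00).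
Qed.

Lemma noise_free_block (j j' : 'I_p) v l : val j' = j.+1 -> B (idx j v) l = 0.
Proof.
by move=> jj'; rewrite mcar_B_block ifF//; apply/negbTE; rewrite neq_ltn -jj' (ltn_ord j').
Qed.

Lemma companion_state (j j' : 'I_p) v t : val j' = j.+1 ->
  \sum_i A (idx j v) i *: x t i = x t (idx j' v).
Proof.
move=> jj'; rewrite (bigD1 (idx j' v))//= (companion_shift _ _ _ jj') eqxx scale1r.
rewrite [X in _ + X]big1 ?addr0// => i ne.
by rewrite (companion_shift _ _ _ jj') (negbTE ne) scale0r.
Qed.

Lemma block_ms_derivative (j j' : 'I_p) v t : val j' = j.+1 ->
  sqnm P (cscale (h^-1)%:C (cplx (x (t + h) (idx j v)) - cplx (x t (idx j v)))
          - cplx (x t (idx j' v))) @[h --> (0 : R)^'] --> (0 : R).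
Proof.
move=> jj'; have := state_ms_derivative hL hc h2 hX t (fun l => noise_free_block v l jj').
apply: cvg_trans; apply: near_eq_cvg; apply: nearW => h.
by rewrite (companion_state v t jj') -!cplxB -cplxZ -cplxB sqnm_cplx.
Qed.

Definition past t : set (T -> R[i]) :=
  [set Z | exists v u, [/\ [set: 'I_k] v, `]-oo, t]%classic u & Z = component Y v u]].

Lemma L2_component v t : L2 P (component Y v t).
Proof.
apply/L2_cplx; have -> : (fun w => Y t w v 0) = \sum_i (mcar_C : 'M[R]_(k, _)) v i *: x t i.
  by apply/funext => w; rewrite hY mxE fct_sumE.
by apply: sqi_sum => i; exact: sqiZ.
Qed.

Lemma L2_past t : L2set P (past t).
Proof. by move=> _ [v [u [_ _ ->]]]; exact: L2_component. Qed.

Lemma past_sub s t : s <= t -> past s `<=` past t.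
Proof.
move=> st _ [v [u [Vv us ->]]]; exists v, u; split => //.
by move: us; rewrite /= !in_itv/= => us; exact: le_trans st.
Qed.

(** The state at time t is a mean-square limit of linear combinations of
present and past observations: its first block is observed, and each further
block is the mean-square derivative of the block before, which may be taken
from the left. *)
Lemma state_in_past t i : closed_span P (past t) (cplx (x t i)).
Proof.
have [j [v ->]] := block_indexP i.
case: j => m; elim: m t => [|m IH] t mp; pose j := Ordinal mp; rewrite -/j.
  apply: closed_span_id; first exact: L2_past.
  exists v, t; split => //; first by rewrite /= in_itv/=.
  by rewrite (component_state v t (j0 := j)).
pose j' := Ordinal (ltnW mp).
have lp := @L2_past t.
(* the difference quotient over [t - r / 2, t], for r small *)
apply: closed_span_limit => // e e0.
have := @block_ms_derivative j' j v t erefl.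
move=> /cvgrPdist_lt/(_ e e0)[r /= r0 hr].
have r2 : - (r / 2) < 0 by rewrite oppr_lt0 divr_gt0.
have := hr (- (r / 2)).
set Q := cscale _ _ => he; exists Q.
  apply: closed_spanZ => //; apply: closed_spanB => //; last exact: IH.
  by apply: closed_span_sub (IH (t - r / 2) (ltnW mp)); apply: past_sub; lra.
rewrite -sqnmN; last by apply: L2B => //; exact/L2Z/L2B.
rewrite opprB -[ltLHS]ger0_norm ?sqnm_ge0// -[X in `|X|]opprK normrN -[- sqnm _ _]add0r.
by apply: he; rewrite ?lt_eqF//= sub0r opprK ger0_norm; lra.
Qed.

(** The j-th mean-square derivative of an observed component is the
corresponding component of the j-th block of the state. Each step of the
recursion chooses a version of the derivative, so that the two sides agree only
almost surely. *)
Lemma ms_derive_n_state (j : 'I_p) v t :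
  L2 P (ms_derive_n P j (component Y v) t) /\
  cnull P (ms_derive_n P j (component Y v) t - cplx (x t (idx j v))).
Proof.
case: j => m; elim: m t => [|m IH] t mp; pose j := Ordinal mp; rewrite -/j.
  rewrite /ms_derive_n /= -(component_state v t (j0 := j))// subrr.
  by split; [exact: L2_component|split; [exact: L20|exact: sqnm0]].
pose j' := Ordinal (ltnW mp).
have IHm s := IH s (ltnW mp).
pose V := ms_derive_n P m (component Y v).
have lV s : L2 P (V s) := (IHm s).1.
have nV s : cnull P (V s - cplx (x s (idx j' v))) := (IHm s).2.
apply: (@ms_derive_unique _ _ _ P V t (cplx (x t (idx j v)))) => //.
have := @block_ms_derivative j' j v t erefl.
apply: cvg_trans; apply: near_eq_cvg; apply: nearW => h.
apply/esym/sqnm_cnull; first by apply: L2B => //; exact/L2Z/L2B.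
set a := V (t + h); set b := V t.
set a' := cplx (x (t + h) _); set b' := cplx (x t (idx j' v)); set z := cplx _.
have -> : cscale (h^-1)%:C (a - b) - z - (cscale (h^-1)%:C (a' - b') - z) =
    cscale (h^-1)%:C ((a - a') - (b - b')).
  apply/funext => w.
  rewrite -[LHS]/((h^-1)%:C * (a w - b w) - z w - ((h^-1)%:C * (a' w - b' w) - z w)).
  rewrite -[RHS]/((h^-1)%:C * ((a w - a' w) - (b w - b' w))); ring.
by apply/cnullZ/cnullD; [exact: nV|apply/cnullN/nV].
Qed.

Definition prediction t s i : T -> R[i] :=
  cplx (\sum_j expmx ((s - t) *: A) i j *: x t j).

Lemma innovationE t s i :
  cplx (x s i) - prediction t s i = cplx (innovation A X t s i).
Proof. by rewrite -cplxB. Qed.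

Lemma prediction_cspan t s i : cspan (x t) (prediction t s i).
Proof.
exists (fun j => (expmx ((s - t) *: A) i j)%:C); rewrite /prediction cplx_sum.
by apply: eq_bigr => j _; rewrite cplxZ.
Qed.

Lemma innovation_orth_past t s i W : t <= s -> past t W ->
  inner P (cplx (x s i) - prediction t s i) W = 0.
Proof.
move=> ts [v [u [_ ut ->]]]; rewrite innovationE.
have [p0|p0] := posnP p.
  by case: (tagnat.sig1 i) => m mp; move: (mp); rewrite [X in (_ < X)%N]p0.
rewrite (component_state v u (j0 := Ordinal p0))// inner_cplx//; last first.
  exact: sqi_innovation hL hc h2 hX t s i.
by rewrite (innovation_orth hL hc h2 hX).
Qed.

Lemma innovation_orth_closed_past t s i W : t <= s -> closed_span P (past t) W ->
  inner P (cplx (x s i) - prediction t s i) W = 0.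
Proof.
move=> ts SW; have lW := closed_span_L2 SW.
have lI : L2 P (cplx (x s i) - prediction t s i).
  by apply: L2B => //; apply: cspan_L2 (prediction_cspan t s i).
apply: inner_eq0_sym => //; apply: (closed_span_orth (@L2_past t) lI _ SW) => Z pZ.
by apply: inner_eq0_sym => //; [exact: L2_past pZ|exact: innovation_orth_past].
Qed.

Lemma prediction_proj t s i : t <= s ->
  is_proj P (closed_span P (past t)) (cplx (x s i)) (prediction t s i).
Proof.
move=> ts; split; last by move=> W; exact: innovation_orth_closed_past.
have lp := @L2_past t.
have [c ->] := prediction_cspan t s i; apply: closed_span_sum => // j.
exact/closed_spanZ/state_in_past.
Qed.

(** The variables U and U' stand for versions of two state coordinates, such as
iterated mean-square derivatives of observed components. *)
Lemma inner_residual t s s' i i' U U' : t <= s -> t <= s' ->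
  L2 P U -> cnull P (U - cplx (x s i)) -> L2 P U' -> cnull P (U' - cplx (x s' i')) ->
  inner P (residual P (closed_span P (past t)) U)
    (residual P (closed_span P (past t)) U') =
  (ip P (innovation A X t s i) (innovation A X t s' i'))%:C.
Proof.
move=> ts ts' lU nU lU' nU'; have lp := @L2_past t.
have [lr nr] := residual_unique lp lU nU (prediction_proj i ts).
have [lr' nr'] := residual_unique lp lU' nU' (prediction_proj i' ts').
rewrite (inner_cnull lr lr' nr nr') !innovationE inner_cplx//.
- exact: sqi_innovation hL hc h2 hX t s i.
- exact: sqi_innovation hL hc h2 hX t s' i'.
Qed.


(** * The two uncorrelatedness relations *)

Section components.
Variables a b : 'I_k.
Variable j0 : 'I_p.
Hypothesis j00 : val j0 = 0%N.

Let error_cov t s s' := ip P (innovation A X t s (idx j0 a)) (innovation A X t s' (idx j0 b)).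

Lemma lin_space1 v t : lin_space P Y [set v] `[t, t + 1] =
  closed_span P ((fun s => cplx (x s (idx j0 v))) @` `[t, t + 1]).
Proof.
congr closed_span; apply/seteqP; split => [_ [_ [u [-> ut ->]]]|_ [u ut <-]].
  by exists u => //; rewrite (component_state v u j00).
by exists v, u; split => //; rewrite (component_state v u j00).
Qed.

Lemma contemp_uncorrelatedE : contemp_uncorrelated P Y a b <->
  forall t h h', 0 <= h <= 1 -> 0 <= h' <= 1 -> error_cov t (t + h) (t + h') = 0.
Proof.
split=> [ab t h h' /andP[h0 h1] /andP[h'0 h'1]|ab t].
  have gen v s : 0 <= s <= 1 -> lin_space P Y [set v] `[t, t + 1] (cplx (x (t + s) (idx j0 v))).
    move=> /andP[s0 s1]; rewrite lin_space1; apply: closed_span_id; first by move=> _ [u _ <-].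
    by exists (t + s) => //; rewrite /= in_itv/= lerDl s0 lerD2l.
  have n0 U : cnull P (U - U) by rewrite subrr; split; [exact: L20|exact: sqnm0].
  have := ab t _ _ (gen a h _) (gen b h' _); rewrite h0 h1 h'0 h'1 => /(_ erefl erefl).
  rewrite (inner_residual (s := t + h) (s' := t + h') (i := idx j0 a) (i' := idx j0 b))//;
    rewrite ?lerDl//.
  by case.
rewrite !lin_space1; apply: (cond_orth_generators (sx t)
  (pr1 := fun s => prediction t s (idx j0 a)) (pr2 := fun s => prediction t s (idx j0 b))) => //.
- exact: L2_past.
- exact: state_in_past.
- move=> s; rewrite /= in_itv/= => /andP[ts _]; split; first exact: prediction_cspan.
  by move=> W; exact: innovation_orth_past.
- move=> s; rewrite /= in_itv/= => /andP[ts _]; split; first exact: prediction_cspan.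
  by move=> W; exact: innovation_orth_past.
move=> s s'; rewrite /= !in_itv/= => /andP[ts s1] /andP[ts' s'1].
rewrite !innovationE inner_cplx.
- have := ab t (s - t) (s' - t); rewrite /error_cov !subrKC => -> //; lra.
- exact: sqi_innovation hL hc h2 hX t s _.
- exact: sqi_innovation hL hc h2 hX t s' _.
Qed.

Lemma error_cov_integral t h h' : 0 <= h -> 0 <= h' ->
  error_cov t (t + h) (t + h') =
  mx_integral `[0, Num.min h h']
    (fun u => mcar_C *m expmx ((h - u) *: A) *m B *m Sigma_L P L *m B^T
              *m expmx ((h' - u) *: A^T) *m mcar_C^T) a b.
Proof.
move=> h0 h'0; rewrite /error_cov (innovation_cov_integral hL hc h2 hX)// mxE.
apply: eq_Rintegral => u _.
pose G (r : R) : 'M[R]_k := mcar_C *m (expmx (r *: A) *m B).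
have GE r v l : G r v l = impulse A B r (idx j0 v) l.
  by rewrite /G (mcar_C_mul _ _ _ j00).
rewrite -trmx_expmx.
have -> : mcar_C *m expmx ((h - u) *: A) *m B *m Sigma_L P L *m B^T
    *m (expmx ((h' - u) *: A))^T *m mcar_C^T = G (h - u) *m Sigma_L P L *m (G (h' - u))^T.
  by rewrite /G !trmx_mul !mulmxA.
rewrite mxE exchange_big /=; apply: eq_bigr => l' _.
rewrite [(G _ *m _) _ _]mxE [_^T _ _]mxE mulr_suml.
by apply: eq_bigr => l _; rewrite !GE; ring.
Qed.

End components.

(** The noise enters through the last block, which carries the derivative of
order p - 1. *)
Lemma noise_cov_last_block (j1 : 'I_p) a b : j1.+1 = p ->
  (B *m Sigma_L P L *m B^T) (idx j1 a) (idx j1 b) = Sigma_L P L a b.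
Proof.
move=> j1p; have BE v l : B (idx j1 v) l = (v == l)%:R by rewrite mcar_B_block j1p eqxx.
rewrite mxE (bigD1 b)//= [_^T b _]mxE (BE b b) eqxx mulr1.
rewrite [X in _ + X]big1 ?addr0; last first.
  by move=> l lb; rewrite [_^T _ _]mxE BE eq_sym (negbTE lb) mulr0.
rewrite mxE (bigD1 a)//= BE eqxx mul1r big1 ?addr0// => l la.
by rewrite BE eq_sym (negbTE la) mul0r.
Qed.

Lemma local_contemp_uncorrelatedE a b : (0 < p)%N ->
  local_contemp_uncorrelated P Y p a b <-> Sigma_L P L a b = 0.
Proof.
move=> p0.
have pp : (p.-1 < p)%N by rewrite prednK.
pose j1 := Ordinal pp; have j1p : j1.+1 = p by rewrite /= prednK.
have lim t : ((h^-1)%:C *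
    inner P
     (residual P (lin_space_past P Y setT t) (ms_derive_n P p.-1 (component Y a) (t + h)))
     (residual P (lin_space_past P Y setT t) (ms_derive_n P p.-1 (component Y b) (t + h))) : R[i]^o)
    @[h --> 0^'+] --> ((Sigma_L P L a b)%:C : R[i]^o).
  have := innovation_cov_average hL hc h2 hX t (i := idx j1 a) (j := idx j1 b).
  rewrite (noise_cov_last_block _ _ j1p) => /cvg_real_complex.
  apply: cvg_trans; apply: near_eq_cvg; near=> h.
  have h0 : 0 <= h by apply: ltW; near: h; exact: nbhs_right_gt.
  have [la na] := ms_derive_n_state j1 a (t + h).
  have [lb nb] := ms_derive_n_state j1 b (t + h).
  by rewrite (inner_residual _ _ la na lb nb) ?lerDl// -rmorphM.
split=> [ab|S0 t]; last first.
  have := lim t; rewrite S0; exact.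
have := cvg_unique (@norm_hausdorff _ R[i]^o) (ab 0) (lim 0).
by move=> /(_ _)[].
Unshelve. all: by end_near. Qed.

End mcar_process.

Theorem proposition6p13 (d : measure_display) (T : measurableType d)
    (R : realType) (P : probability T R) (k p : nat)
    (A_ : 'I_p -> 'M[R]_k) (L Y : R -> T -> 'cV[R]_k)
    (hY : causal_MCAR P A_ L Y) (a b : 'I_k) (hab : a != b) :
  (contemp_uncorrelated P Y a b <->
   forall h h' : R, 0 <= h <= 1 -> 0 <= h' <= 1 ->
     mx_integral `[0, Num.min h h']
       (fun u => mcar_C *m expmx ((h - u) *: companion A_) *m mcar_B
                 *m Sigma_L P L *m mcar_B^T
                 *m expmx ((h' - u) *: (companion A_)^T) *m mcar_C^T) a b = 0)
  /\
  (local_contemp_uncorrelated P Y p a b <-> Sigma_L P L a b = 0).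
Proof.
case: hY => p0 hL hc h2 _ [X [hX hCX]].
split; last exact: (local_contemp_uncorrelatedE hL hc h2 hX hCX a b p0).
pose j0 := Ordinal p0.
have cE := contemp_uncorrelatedE hL hc h2 hX hCX a b (j0 := j0) erefl.
have iE := error_cov_integral hL hc h2 hX a b (j0 := j0) erefl.
split=> [/cE ab h h' hh hh'|ab].
  by rewrite -(iE 0) ?ab//; [case/andP: hh|case/andP: hh'].
apply/cE => t h h' hh hh'; rewrite iE ?ab//; first by case/andP: hh.
by case/andP: hh'.
Qed.
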